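(* Let $0<\gamma<1$ and let $w$ be a weight on $\mathbb{R}^{n+1}$. The following conditions are equivalent. (i) $w\in A_q^+(\gamma)$ for some $1<q<\infty$. (ii) There exist constants $K,\delta>0$ such that \[ \frac{|E|}{|R^+(\gamma)|}\le K\biggl(\frac{w(E)}{w(R^-(\gamma))}\biggr)^\delta \] for every parabolic rectangle $R\subset\mathbb{R}^{n+1}$ and every measurable set $E\subset R^+(\gamma)$. (iii) For every $0<\alpha<1$ there exists $0<\beta<1$ such that for every parabolic rectangle $R$ and every measurable set $E\subset R^+(\gamma)$ for which $w(E)<\beta w(R^-(\gamma))$ we have $|E|<\alpha|R^+(\gamma)|$. (iv) There exist $0<\alpha,\beta<1$ such that for every parabolic rectangle $R$ and every measurable set $E\subset R^+(\gamma)$ for which $w(E)<\beta w(R^-(\gamma))$ we have $|E|<\alpha|R^+(\gamma)|$. (v) There exist $0<\alpha,\beta<1$ such that for every parabolic rectangle $R$ we have \[ |R^+(\gamma)\cap\{w<\beta w_{R^-(\gamma)}\}|<\alpha|R^+(\gamma)|. \] (vi) There exists $0<\varepsilon<1$ such that for every parabolic rectangle $R$ we have \[ \frac{1}{|R^+(\gamma)|}\int_{R^+(\gamma)}(w-w_{R^-(\gamma)})^-\le\varepsilon w_{R^-(\gamma)}. \]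
   Context: Fix a dimension $n\ge1$ and an exponent $1<p<\infty$. For $x\in\mathbb{R}^n$, $L>0$ let $Q(x,L)=\{y\in\mathbb{R}^n:|y_i-x_i|\le L,\ i=1,\dots,n\}$. For $t\in\mathbb{R}$, the parabolic rectangle centered at $(x,t)$ with side length $L$ is $R=R(x,t,L)=Q(x,L)\times(t-L^p,t+L^p)\subset\mathbb{R}^{n+1}$. For $0\le\gamma<1$ (the time lag) its upper and lower parts are $R^+(\gamma)=Q(x,L)\times(t+\gamma L^p,t+L^p)$ and $R^-(\gamma)=Q(x,L)\times(t-L^p,t-\gamma L^p)$. $|A|$ is the Lebesgue measure of $A\subset\mathbb{R}^{n+1}$; integrals are with respect to Lebesgue measure. A weight is a locally integrable nonnegative function on $\mathbb{R}^{n+1}$. Write $w(A)=\int_A w$ and $w_A=\frac{1}{|A|}\int_A w$. The negative part of $f$ is $f^-=\max\{-f,0\}$. For $1<q<\infty$, $w\in A_q^+(\gamma)$ means \[ [w]_{A_q^+(\gamma)}=\sup_{R}\biggl(\frac{1}{|R^-(\gamma)|}\int_{R^-(\gamma)}w\biggr)\biggl(\frac{1}{|R^+(\gamma)|}\int_{R^+(\gamma)}w^{\frac1{1-q}}\biggr)^{q-1}<\infty, \] the supremum over all parabolic rectangles $R\subset\mathbb{R}^{n+1}$. *)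

(* Defs.v *)
From HB Require Import structures.
From mathcomp Require Import all_boot all_order all_algebra.
From mathcomp Require Import all_classical all_reals all_analysis.

Set Implicit Arguments.
Unset Strict Implicit.
Unset Printing Implicit Defensive.

Import Order.TTheory GRing.Theory Num.Theory.
Import numFieldNormedType.Exports.

Local Open Scope classical_set_scope.
Local Open Scope ring_scope.

Definition measure_rV_display : measure_display -> measure_display.
Proof. exact. Qed.

(* Borel sigma-algebra of R^n: the one generated by the coordinates. *)
Section measurable_rV.
Context {d} {T : sigmaRingType d} (n : nat).

Let coors : 'I_n -> 'rV[T]_n -> T := fun i x => x ord0 i.

Let rV_set0 : g_sigma_preimage coors set0.
Proof. exact: sigma_algebra0. Qed.

Let rV_setC A : g_sigma_preimage coors A -> g_sigma_preimage coors (~` A).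
Proof. exact: sigma_algebraC. Qed.

Let rV_bigcup (F : _^nat) : (forall i, g_sigma_preimage coors (F i)) ->
  g_sigma_preimage coors (\bigcup_i (F i)).
Proof. exact: sigma_algebra_bigcup. Qed.

HB.instance Definition _ := @isMeasurable.Build (measure_rV_display d)
  'rV[T]_n (g_sigma_preimage coors) rV_set0 rV_setC rV_bigcup.

End measurable_rV.

Section lebesgue_rV.
Context {R : realType}.

(* R^n x R -> R^(n+1), the real number being the last coordinate *)
Definition snoc_rV n (z : 'rV[measurableTypeR R]_n * measurableTypeR R) :
    'rV[measurableTypeR R]_n.+1 :=
  \row_i oapp (z.1 ord0) z.2 (unlift ord_max i).

Lemma measurable_snoc_rV n : measurable_fun setT (@snoc_rV n).
Proof.
have mcoor (i : 'I_n) :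
    measurable_fun setT (fun x : 'rV[measurableTypeR R]_n => x ord0 i).
  move=> _ Y mY; rewrite setTI; apply: sub_sigma_algebra => /=.
  rewrite -bigcup_seq/=; exists i => /=; first by rewrite mem_index_enum.
  by exists Y => //; rewrite setTI.
have mz (i : 'I_n.+1) : measurable_fun setT
    (fun z : 'rV[measurableTypeR R]_n * measurableTypeR R => snoc_rV z ord0 i).
  rewrite /snoc_rV; under eq_fun do rewrite mxE.
  case: unliftP => [j _|_] /=; last exact: measurable_snd.
  exact: measurableT_comp (mcoor j) measurable_fst.
move=> _ Y mY; rewrite setTI; move: Y mY.
apply: smallest_sub => /=.
  split => /=.
  - by rewrite preimage_set0; exact: measurable0.
  - move=> A mA; rewrite setTD preimage_setC; exact: measurableC.
  - move=> F mF; rewrite preimage_bigcup; exact: bigcup_measurable.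
rewrite -bigcup_mkord_ord; apply: bigcup_sub => i _ A [B mB <-].
by have := mz (inord i) measurableT B mB; rewrite !setTI.
Qed.

Definition lebesgue_snoc n
    (mu : {measure set 'rV[measurableTypeR R]_n -> \bar R}) :=
  pushforward (mu \x lebesgue_measure)%E (@snoc_rV n).

Section lebesgue_snoc.
Context n (mu : {measure set 'rV[measurableTypeR R]_n -> \bar R}).

Let lebesgue_snoc0 : lebesgue_snoc mu set0 = 0%E.
Proof. by rewrite /lebesgue_snoc /pushforward preimage_set0 measure0. Qed.

Let lebesgue_snoc_ge0 A : (0 <= lebesgue_snoc mu A)%E.
Proof. by rewrite /lebesgue_snoc /pushforward; apply: measure_ge0. Qed.

Let lebesgue_snoc_sigma_additive : semi_sigma_additive (lebesgue_snoc mu).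
Proof.
move=> F mF tF mUF.
rewrite /lebesgue_snoc /pushforward preimage_bigcup.
have mpre A : measurable A -> measurable (@snoc_rV n @^-1` A).
  by move=> mA; rewrite -[X in measurable X]setTI; exact: measurable_snoc_rV.
apply: measure_semi_sigma_additive.
- by move=> k; exact: mpre.
- apply/trivIsetP => /= i j _ _ ij; rewrite -preimage_setI.
  by move/trivIsetP : tF => /(_ _ _ _ _ ij) ->//; rewrite preimage_set0.
- by rewrite -preimage_bigcup; exact: mpre.
Qed.

HB.instance Definition _ := isMeasure.Build _ _ _ (lebesgue_snoc mu)
  lebesgue_snoc0 lebesgue_snoc_ge0 lebesgue_snoc_sigma_additive.

End lebesgue_snoc.

Fixpoint lebesgue_rV n : {measure set 'rV[measurableTypeR R]_n -> \bar R} :=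
  if n is m.+1 then lebesgue_snoc (lebesgue_rV m)
  else @dirac _ 'rV[measurableTypeR R]_0 (0 : 'rV[R]_0) R.

End lebesgue_rV.

(* The Lebesgue sigma-algebra and Lebesgue measure on R^n x R: Caratheodory's
   completion of the product Borel measure, so that [measurable] below means
   Lebesgue measurable and not only Borel. *)
Definition spacetime (R : realType) (n : nat) : measurableType _ :=
  caratheodory_type
    ((@lebesgue_rV R n \x @lebesgue_measure R)%E : {measure set _ -> \bar R})^*%mu.

Definition lebesgue_spacetime (R : realType) (n : nat) :
    set (spacetime R n) -> \bar R :=
  @completed_measure_extension _ _ _ (@lebesgue_rV R n \x @lebesgue_measure R)%E.

HB.instance Definition _ (R : realType) (n : nat) :=
  Measure.on (@lebesgue_spacetime R n).

Section parabolic.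
Context {R : realType} {n : nat}.
Implicit Types (p gamma q t L : R) (x : 'rV[R]_n) (w : spacetime R n -> R).

Local Notation mu := (@lebesgue_spacetime R n).

Definition cube x L : set 'rV[R]_n :=
  [set y | forall i, `|y ord0 i - x ord0 i| <= L].

(* The parts R^+(gamma) and R^-(gamma) of the parabolic rectangle R(x, t, L) *)
Definition upper_part p gamma x t L : set (spacetime R n) :=
  cube x L `*` `]t + gamma * L `^ p, t + L `^ p[.

Definition lower_part p gamma x t L : set (spacetime R n) :=
  cube x L `*` `]t - L `^ p, t - gamma * L `^ p[.

Local Open Scope ereal_scope.

Definition weight w :=
  [/\ measurable_fun setT w, forall z, (0 <= w z)%R &
      forall K : set ('rV[R]_n * R), compact K ->
        \int[mu]_(z in (K : set (spacetime R n))) (w z)%:E < +oo].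

Definition wmeas w (A : set (spacetime R n)) : \bar R :=
  \int[mu]_(z in A) (w z)%:E.

Definition avg (A : set (spacetime R n)) (f : spacetime R n -> \bar R) :
    \bar R :=
  (\int[mu]_(z in A) f z) / mu A.

Definition wavg w A : \bar R := avg A (fun z => (w z)%:E).

(* w^(1/(1-q)) is written (1/w)^(1/(q-1)) in the extended reals, so that it is
   +oo where w vanishes (the library sets 0 `^ r = 0 for every r != 0). When
   w vanishes a.e. on R^-(gamma) the product is 0, since 0 * +oo = 0. *)
Definition Aq_const p gamma q w : \bar R :=
  ereal_sup [set C | exists x t L, (0 < L)%R /\
    C = wavg w (lower_part p gamma x t L) *
        avg (upper_part p gamma x t L)
            (fun z => (w z)%:E^-1 `^ (q - 1)^-1) `^ (q - 1)].

Definition Aq_plus p gamma q w := weight w /\ Aq_const p gamma q w < +oo.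

End parabolic.

(* Main.v *)
Require Import Defs.
From mathcomp Require Import all_boot all_order all_algebra.
From mathcomp Require Import all_classical all_reals all_analysis.
From mathcomp Require Import measurable_realfun.
From mathcomp Require Import ring lra.

(** Write box for a set of the shape of the lower or the upper part of a
    parabolic rectangle; the upper part is the lower part moved by [time_lag] in
    time. The implications from (i) down to (vi) are short, and the way back
    from (vi) to (i) is the substance of the theorem.

    From (i) to (ii): put s = 1 / (q - 1), let a be the average of w over the
    lower part, and cut a subset E of the upper part along {w < a u}. Where
    w >= a u, Chebyshev bounds the measure by w(E) / (a u); where w < a u, the
    weight w^(-s) is at least (a u)^(-s), so the A_q condition bounds the
    proportion by a multiple of u^s ([sublevel_split_bound]). The best choice
    of u gives a power of w(E) / w(R^-) ([optimal_power]). From (ii) to (iii),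
    (iv) and (v) one specialises to small sets, to one proportion, and to
    sublevel sets. From (v) to (vi): the negative part of w - a is at most a on
    {w < beta a} and at most (1 - beta) a off it.

    From (vi) to (i): Chebyshev turns (vi) into a statement [sublevel_decay
    beta alpha] with alpha < 1: whenever the average of w over a lower part is
    at least lam, the set {w < beta lam} fills at most the proportion alpha of
    the upper part. The aim is [geometric_decay]: the proportion of
    {w < h^m lam} is at most 2^(-m). Summing over the layers of w then bounds
    the integral of w^(-s) when s is so small that h^(-s) = 3/2
    ([invpow_integral_le]). Geometric decay follows by iterating
    [decay_improve], which passes from (h, th) to (h h0, th / 2) with a fixed
    h0. Its proof has three parts.

    Chains. As alpha < 1, a box of large average forces a large average on
    every slight perturbation of its upper part ([chain_step]), and iteration
    reaches every box that lies late enough, and near enough in space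
    ([reach_same]); passing to smaller boxes costs a pigeonhole argument. A box
    of side L / k has duration (L / k)^p, so within the time gap 2 gamma L^p
    between the two parts a chain of such boxes takes about gamma k^p steps of
    length about L / k. As p > 1 this exceeds L for large k, so the mass of the
    lower part enters all small boxes just below the upper part
    ([enters_exists]).

    Stopping. A parabolic dyadic grid is put on the upper part. A cell is good
    at level lam if w has average at least lam on a test box in its past. The
    top cells are good, and the first bad cell around a point is stopped. A good
    cell has a fixed proportion on which w is not small compared with lam;
    hence {w < t} is null outside the stopped cells, for small t, by a density
    argument that approximates Borel sets by unions of cells ([density_null]).
    A stopped cell has a good parent, so the hypothesis (h, th) applies to it
    and bounds its part of the sublevel set by a multiple of th times its
    volume ([stopped_sublevel]). Finally the parent is good and the cell is
    bad: in between there is a witness box a fixed proportion of which lies in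
    the annulus {c lam <= w < C lam} ([stopped_annulus]). A Vitali selection
    among the witness boxes bounds the total volume of the stopped cells by a
    multiple of the volume of the annulus ([upper_sublevel]).

    Levels. The previous bound holds for each of the levels eta^j lam, j < J,
    and for suitable eta their annuli are disjoint. Adding up, J times the
    measure of the sublevel set is at most C th |R|, and J >= 2 C halves th. *)

Set Implicit Arguments.
Unset Strict Implicit.
Unset Printing Implicit Defensive.

Import Order.TTheory GRing.Theory Num.Theory.
Import numFieldNormedType.Exports.
Local Open Scope classical_set_scope.
Local Open Scope ring_scope.

(** * Prisms in space-time *)

Section Prisms.
Context {R : realType}.

Lemma measurable_coord n (i : 'I_n) :
  measurable_fun setT (fun y : 'rV[measurableTypeR R]_n => y ord0 i).
Proof.
move=> _ Y mY; rewrite setTI; apply: sub_sigma_algebra => /=.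
rewrite -bigcup_seq/=; exists i => /=; first by rewrite mem_index_enum.
by exists Y => //; rewrite setTI.
Qed.

Lemma measurable_cube n (x : 'rV[R]_n) (L : R) :
  measurable (cube x L : set 'rV[measurableTypeR R]_n).
Proof.
rewrite (_ : cube x L = \bigcap_(i in [set: 'I_n])
  ((fun y : 'rV[measurableTypeR R]_n => y ord0 i) @^-1`
     `[x ord0 i - L, x ord0 i + L]%classic)).
  apply: fin_bigcap_measurable => [|i _]; first exact: finite_finset.
  by rewrite -[X in measurable X]setTI; exact: measurable_coord.
apply/seteqP; split => [y Hy i _|y Hy i] /=.
  by have := Hy i; rewrite ler_distl in_itv.
by have := Hy i Logic.I; rewrite /= in_itv/= ler_distl.
Qed.

(** The measure of R^(n+1) is defined by splitting off the last coordinate,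
    and a cube splits accordingly into a cube and an interval. *)
Lemma lebesgue_rV_cube n (x : 'rV[R]_n) (L : R) : 0 <= L ->
  lebesgue_rV n (cube x L) = ((2 * L) ^+ n)%:E.
Proof.
move=> L0; elim: n x => [|n IH] x.
  by rewrite /= /dirac indicE mem_set// => -[].
rewrite /= /lebesgue_snoc /pushforward.
pose x' : 'rV[R]_n := \row_i x ord0 (lift ord_max i).
set c := x ord0 ord_max.
rewrite (_ : snoc_rV (n:=n) @^-1` _ = cube x' L `*` `[c - L, c + L]).
  rewrite product_measure1E; [|exact: measurable_cube|exact: measurable_itv].
  rewrite IH exprSr EFinM; congr (_ * _)%E.
  rewrite [LHS]lebesgue_measure_itv/= lte_fin.
  case: ifPn => [_|]; first by rewrite -EFinB; congr EFin; ring.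
  by rewrite -leNgt => cL; congr EFin; lra.
apply/seteqP; split => -[y t]/=.
  move=> Hy; split => [i|].
    have := Hy (lift ord_max i); rewrite !mxE liftK//=.
  by have := Hy ord_max; rewrite /snoc_rV !mxE unlift_none/= in_itv/= -ler_distl.
case=> Hy; rewrite in_itv/= -ler_distl => Ht i; rewrite /snoc_rV !mxE.
case: unliftP => [j ->|->] //=.
by have := Hy j; rewrite !mxE.
Qed.

Section spacetime_prisms.
Context {n : nat}.
Local Notation ST := (spacetime R n).
Local Notation mu := (@lebesgue_spacetime R n).

Definition prism (x : 'rV[R]_n) (L a b : R) : set ST := cube x L `*` `]a, b[.

Lemma borel_spacetime (A : set ('rV[measurableTypeR R]_n * measurableTypeR R)) :
  measurable A -> measurable (A : set ST).
Proof. by move=> mA; exact: caratheodory_measurable_mu_ext. Qed.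

Lemma lebesgue_spacetime_borel
    (A : set ('rV[measurableTypeR R]_n * measurableTypeR R)) :
  measurable A -> mu A = (lebesgue_rV n \x lebesgue_measure)%E A.
Proof.
move=> mA.
by rewrite /lebesgue_spacetime /completed_measure_extension measurable_mu_extE.
Qed.

Lemma measurable_prism x L a b : measurable (prism x L a b).
Proof.
apply: borel_spacetime; apply: measurableX; last exact: measurable_itv.
exact: measurable_cube.
Qed.

Lemma mu_prism x L a b : 0 <= L -> a <= b ->
  mu (prism x L a b) = ((2 * L) ^+ n * (b - a))%:E.
Proof.
move=> L0 ab; rewrite lebesgue_spacetime_borel; last first.
  by apply: measurableX; [exact: measurable_cube|exact: measurable_itv].
rewrite [LHS]product_measure1E; [|exact: measurable_cube|exact: measurable_itv].
rewrite lebesgue_rV_cube// EFinM; congr (_ * _)%E.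
rewrite [LHS]lebesgue_measure_itv/= lte_fin.
case: ifPn => [_|]; first by rewrite -EFinB.
by rewrite -leNgt => cL; congr EFin; lra.
Qed.

Lemma prism_subset (x : 'rV[R]_n) L a b (x' : 'rV[R]_n) L' a' b' :
  (forall i, `|x ord0 i - x' ord0 i| + L <= L') -> a' <= a -> b <= b' ->
  prism x L a b `<=` prism x' L' a' b'.
Proof.
move=> H aa bb [y t] [Hy] /=; rewrite in_itv/= => /andP[a1 b1]; split => /=.
  move=> i; have := H i; have := Hy i.
  by have := ler_distD (x ord0 i) (y ord0 i) (x' ord0 i); lra.
by rewrite in_itv/= (le_lt_trans aa)//= (lt_le_trans b1).
Qed.

End spacetime_prisms.
End Prisms.

(** * Volume and mass as real numbers *)

Section RealValued.
Context {R : realType} {n : nat}.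
Local Notation ST := (spacetime R n).
Local Notation mu := (@lebesgue_spacetime R n).
Implicit Types A B : set ST.

(** Measurable sets inside a prism have finite volume, and a weight gives them
    finite mass; on these sets both can be handled as real numbers. *)
Definition bmeas A := measurable A /\ exists x L a b, A `<=` prism x L a b.

Definition vol A : R := fine (mu A).

Lemma bmeas_prism (x : 'rV[R]_n) (L a b : R) : bmeas (prism x L a b).
Proof. by split; [exact: measurable_prism|exists x, L, a, b]. Qed.

Lemma bmeas_sub A B : measurable A -> A `<=` B -> bmeas B -> bmeas A.
Proof.
move=> mA AB [_ [x [L [a [b BQ]]]]]; split => //; exists x, L, a, b.
exact: subset_trans BQ.
Qed.

Lemma bmeasI A B : bmeas A -> measurable B -> bmeas (A `&` B).
Proof.
move=> bA mB; apply: (bmeas_sub _ _ bA); last exact: subIsetl.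
by apply: measurableI => //; case: bA.
Qed.

Lemma bmeasD A B : bmeas A -> measurable B -> bmeas (A `\` B).
Proof. by move=> bA mB; apply: bmeasI => //; exact: measurableC. Qed.

Lemma prism_widen (x : 'rV[R]_n) (L a b : R) :
  exists L' a' b', [/\ 0 <= L', a' <= b' & prism x L a b `<=` prism x L' a' b'].
Proof.
exists `|L|, a, (Num.max a b); split; rewrite ?normr_ge0 ?le_max ?lexx//.
by apply: prism_subset; rewrite ?le_max ?lexx ?orbT// => i;
  rewrite subrr normr0 add0r ler_norm.
Qed.

Lemma bmeas_mu A : bmeas A -> mu A = (vol A)%:E.
Proof.
move=> [mA [x [L [a [b AQ]]]]]; rewrite /vol fineK// ge0_fin_numE//.
have [L' [a' [b' [L0 ab QQ]]]] := prism_widen x L a b.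
apply: (@le_lt_trans _ _ (mu (prism x L' a' b'))); last by rewrite mu_prism// ltry.
apply: le_measure; rewrite ?inE//; first exact: measurable_prism.
exact: subset_trans QQ.
Qed.

Lemma vol_ge0 A : 0 <= vol A.
Proof. by rewrite /vol fine_ge0. Qed.

Lemma vol_set0 : vol set0 = 0.
Proof. by rewrite /vol measure0. Qed.

Lemma le_vol A B : bmeas A -> bmeas B -> A `<=` B -> vol A <= vol B.
Proof.
move=> bA bB AB; rewrite -lee_fin -!bmeas_mu//.
by apply: le_measure; rewrite ?inE//; [case: bA|case: bB].
Qed.

Lemma vol_setID A B : bmeas A -> measurable B ->
  vol A = vol (A `&` B) + vol (A `\` B).
Proof.
move=> bA mB; apply: EFin_inj; rewrite EFinD -!bmeas_mu//; last 2 first.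
- exact: bmeasD.
- exact: bmeasI.
have mA : measurable A by case: bA.
by rewrite addeC; exact: (measureDI mu mA mB).
Qed.

Lemma vol_prism (x : 'rV[R]_n) (L a b : R) : 0 <= L -> a <= b ->
  vol (prism x L a b) = (2 * L) ^+ n * (b - a).
Proof. by move=> L0 ab; rewrite /vol mu_prism. Qed.

(** Volume and mass have monotonicity and additivity in common, whence the
    abstract set function. *)
Lemma cover_le (f : set ST -> R) (I : eqType) (s : seq I) (B : I -> set ST) A :
  f set0 = 0 ->
  (forall A B, bmeas A -> bmeas B -> A `<=` B -> f A <= f B) ->
  (forall A B, bmeas A -> measurable B -> f A = f (A `&` B) + f (A `\` B)) ->
  bmeas A -> (forall i, i \in s -> bmeas (B i)) ->
  A `<=` [set z | exists2 i, i \in s & B i z] ->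
  f A <= \sum_(i <- s) f (B i).
Proof.
move=> f0 fle fID; elim: s A => [|i s IH] A bA bB AB.
  rewrite big_nil (_ : A = set0) ?f0// -subset0 => z /AB[i].
  by rewrite in_nil.
have bBi : bmeas (B i) by apply: bB; rewrite mem_head.
have mBi : measurable (B i) by case: bBi.
rewrite big_cons (fID A (B i) bA mBi); apply: lerD.
  by apply: fle => //; exact: bmeasI.
apply: IH => [|j js|z [Az Biz]].
- exact: bmeasD.
- by apply: bB; rewrite in_cons js orbT.
- have [j + Bjz] := AB _ Az; rewrite in_cons => /orP[/eqP ji|js]; last by exists j.
  by move: Biz; rewrite -ji.
Qed.

Lemma vol_cover (I : eqType) (s : seq I) (B : I -> set ST) A :
  bmeas A -> (forall i, i \in s -> bmeas (B i)) ->
  A `<=` [set z | exists2 i, i \in s & B i z] ->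
  vol A <= \sum_(i <- s) vol (B i).
Proof. by apply: cover_le; [exact: vol_set0|exact: le_vol|exact: vol_setID]. Qed.

Lemma sum_vol_le (I : eqType) (s : seq I) (B : I -> set ST) A :
  bmeas A -> uniq s -> (forall i, i \in s -> measurable (B i)) ->
  (forall i, i \in s -> B i `<=` A) ->
  (forall i j z, i \in s -> j \in s -> B i z -> B j z -> i = j) ->
  \sum_(i <- s) vol (B i) <= vol A.
Proof.
move=> + + ; elim: s A => [|i s IH] A bA us mB BA tB.
  by rewrite big_nil vol_ge0.
have mBi : measurable (B i) by apply: mB; exact: mem_head.
rewrite big_cons (vol_setID bA mBi); apply: lerD.
  apply: le_vol.
  - by apply: (bmeas_sub mBi _ bA); apply: BA; exact: mem_head.
  - exact: bmeasI.
  - by move=> z Biz; split=> //; apply: (BA i) => //; exact: mem_head.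
move: us => /= /andP[is_ us].
apply: IH => //.
- exact: bmeasD.
- by move=> j js; apply: mB; rewrite in_cons js orbT.
- move=> j js z Bjz; split; first by apply: (BA j) => //; rewrite in_cons js orbT.
  move=> Biz; move/negP: is_; apply.
  by rewrite (tB i j z)// ?mem_head// in_cons js orbT.
- by move=> j k z js ks; apply: tB; rewrite in_cons ?js ?ks orbT.
Qed.

(** Local integrability of a weight is an assumption on compact sets, so a
    prism has to be put into a compact one. *)
Lemma compact_prism (x : 'rV[R]_n) (L a b : R) :
  compact (cube x L `*` `[a, b] : set ('rV[R]_n * R)).
Proof.
apply: compact_setX; last exact: segment_compact.
rewrite (_ : cube x L = [set y : 'rV[R]_n | forall i,
   `[x ord0 i - L, x ord0 i + L]%classic (y ord0 i)]).
  apply: (@rV_compact R n (fun i => `[x ord0 i - L, x ord0 i + L]%classic)) => i.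
  exact: segment_compact.
by apply/seteqP; split => y Hy i; have := Hy i; rewrite /= ?in_itv/= ler_distl//.
Qed.

Section mass.
Context (w : ST -> R) (hw : weight w).

Definition mass A : R := fine (wmeas w A).

Let mw : measurable_fun setT (fun z => (w z)%:E).
Proof. by apply/measurable_EFinP; case: hw. Qed.

Let w0 z : (0 <= (w z)%:E)%E.
Proof. by rewrite lee_fin; case: hw. Qed.

Let mw_on A : measurable_fun A (fun z => (w z)%:E).
Proof. exact: (measurable_funS measurableT (@subsetT _ A) mw). Qed.

Lemma wmeas_ge0 A : (0 <= wmeas w A)%E.
Proof. by apply: integral_ge0 => z _; exact: w0. Qed.

Lemma le_wmeas A B : measurable A -> measurable B -> A `<=` B ->
  (wmeas w A <= wmeas w B)%E.
Proof.
move=> mA mB AB.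
exact: (ge0_subset_integral mu mA mB (@mw_on B) (fun z _ => w0 z) AB).
Qed.

Lemma bmeas_wmeas A : bmeas A -> wmeas w A = (mass A)%:E.
Proof.
move=> [mA [x [L [a [b AQ]]]]].
rewrite /mass fineK// ge0_fin_numE; last exact: wmeas_ge0.
have [_ _ /(_ _ (@compact_prism x L a b))] := hw.
apply: le_lt_trans; apply: le_wmeas => //.
  apply: borel_spacetime; apply: measurableX; last exact: measurable_itv.
  exact: measurable_cube.
apply: (subset_trans AQ) => -[y t] [Hy Ht]; split => //; move: Ht.
by rewrite /= !in_itv/= => /andP[at_ tb]; rewrite !ltW.
Qed.

Lemma mass_ge0 A : 0 <= mass A.
Proof. by rewrite /mass fine_ge0// wmeas_ge0. Qed.

Lemma mass_set0 : mass set0 = 0.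
Proof. by rewrite /mass /wmeas integral_set0. Qed.

Lemma le_mass A B : bmeas A -> bmeas B -> A `<=` B -> mass A <= mass B.
Proof.
move=> bA bB AB; rewrite -lee_fin -!bmeas_wmeas//.
by apply: le_wmeas; [case: bA|case: bB|].
Qed.

Lemma mass_setID A B : bmeas A -> measurable B ->
  mass A = mass (A `&` B) + mass (A `\` B).
Proof.
move=> bA mB; have mA : measurable A by case: bA.
apply: EFin_inj; rewrite EFinD -!bmeas_wmeas//; last 2 first.
- exact: bmeasD.
- exact: bmeasI.
have dAB : [disjoint A `&` B & A `\` B].
  by apply/disj_setPS => z [[_ Bz] [_]].
have := ge0_integral_setU mu (measurableI _ _ mA mB) (measurableD mA mB)
  (@mw_on _) (fun z _ => w0 z) dAB.
by rewrite setUIDK.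
Qed.

Lemma mass_cover (I : eqType) (s : seq I) (B : I -> set ST) A :
  bmeas A -> (forall i, i \in s -> bmeas (B i)) ->
  A `<=` [set z | exists2 i, i \in s & B i z] ->
  mass A <= \sum_(i <- s) mass (B i).
Proof. by apply: cover_le; [exact: mass_set0|exact: le_mass|exact: mass_setID]. Qed.

Lemma le_mass_vol A c : bmeas A -> (forall z, A z -> w z <= c) ->
  mass A <= c * vol A.
Proof.
move=> bA wc; have mA : measurable A by case: bA.
have wc' z : A z -> ((w z)%:E <= c%:E)%E by rewrite lee_fin; exact: wc.
rewrite -lee_fin EFinM -bmeas_wmeas// -bmeas_mu// -integral_cst//.
exact: (ge0_le_integral mu mA (fun z _ => w0 z) (@mw_on A) (measurable_cst _) wc').
Qed.

Lemma ge_mass_vol A c : bmeas A -> 0 <= c -> (forall z, A z -> c <= w z) ->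
  c * vol A <= mass A.
Proof.
move=> bA c0 wc; have mA : measurable A by case: bA.
have c0' : (0 <= c%:E)%E by rewrite lee_fin.
have wc' z : A z -> (c%:E <= (w z)%:E)%E by rewrite lee_fin; exact: wc.
rewrite -lee_fin EFinM -bmeas_wmeas// -bmeas_mu// -integral_cst//.
exact: (ge0_le_integral mu mA (fun _ _ => c0') (measurable_cst _) (@mw_on A) wc').
Qed.

Lemma measurable_lt c : measurable [set z | w z < c].
Proof.
rewrite -[X in measurable X]setTI.
have -> : [set z | w z < c] = w @^-1` `]-oo, c[%classic.
  by apply/seteqP; split => z; rewrite /= in_itv.
by case: hw => + _ _; apply; [exact: measurableT|exact: measurable_itv].
Qed.

End mass.
End RealValued.

(** * A density theorem for refining partitions *)

Lemma absorb_small (R : realFieldType) (c e f : R) : c * e <= e ->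
  f <= c * (f + e + e) + e -> f * (1 - c) <= 3 * e.
Proof. by move=> ce fe; lra. Qed.

Section Density.
Context {R : realType} {n : nat}.
Local Notation ST := (spacetime R n).
Local Notation mu := (@lebesgue_spacetime R n).
Implicit Types A B D F X : set ST.

Lemma vol_exhaust (A : nat -> set ST) B (C : R) :
  (forall m, measurable (A m)) -> (forall m, A m `<=` A m.+1) ->
  bmeas B -> B `<=` \bigcup_m A m ->
  (forall m, vol (B `&` A m) <= C) -> vol B <= C.
Proof.
move=> mA ndA bB BA AC; have mB : measurable B by case: bB.
have BE : \bigcup_m (B `&` A m) = B.
  by rewrite -setI_bigcupr; apply/seteqP; split => [z []//|z Bz]; split => //; exact: BA.
have mBA m : measurable (B `&` A m) by exact: measurableI.
have ndBA : nondecreasing_seq (fun m => B `&` A m).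
  by apply/nondecreasing_seqP => m; rewrite subsetEset; exact: setIS.
have mBA' : measurable (\bigcup_m (B `&` A m)) by rewrite BE.
have := nondecreasing_cvg_mu (mu := mu) mBA mBA' ndBA.
rewrite BE -lee_fin -bmeas_mu// => /cvg_lim <-//.
apply: lime_le; first by apply: ereal_nondecreasing_is_cvgn => a b ab;
  apply: le_measure; rewrite ?inE//; exact/subsetPset/ndBA.
by apply: nearW => m; rewrite /= bmeas_mu ?lee_fin//; exact: bmeasI.
Qed.

Lemma vol_exhaust_diff (A : nat -> set ST) B (e : R) :
  (forall m, measurable (A m)) -> (forall m, A m `<=` A m.+1) ->
  bmeas B -> B `<=` \bigcup_m A m -> 0 < e ->
  exists m, vol (B `\` A m) <= e.
Proof.
move=> mA ndA bB BA e0; apply: contrapT => /forallNP H.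
suff : vol B <= vol B - e by lra.
apply: vol_exhaust ndA _ _ _ => // m.
have /negP := H m; rewrite -ltNge.
by have := vol_setID bB (mA m); lra.
Qed.

(** Measurable sets are Lebesgue measurable, while the grid generates the
    Borel sets only; the outer measure that defines Lebesgue measure provides a
    Borel hull of almost the same measure. *)
Lemma borel_outer F (e : R) : bmeas F -> 0 < e ->
  exists A : set ('rV[measurableTypeR R]_n * measurableTypeR R),
    [/\ measurable A, F `<=` A & forall X, bmeas X -> vol (X `&` A) <= vol F + e].
Proof.
move=> bF e0.
have : ereal_inf [set (\sum_(0 <= k <oo)
    (lebesgue_rV n \x lebesgue_measure)%E (A k))%E |
    A in measurable_cover (F : set ('rV[measurableTypeR R]_n * measurableTypeR R))]
    \is a fin_num.
  by have := bmeas_mu bF; rewrite /lebesgue_spacetime /completed_measure_extension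
    /mu_ext => ->.
move/lb_ereal_inf_adherent => /(_ _ e0)[_ [A [mA FA] <-]].
have -> : (ereal_inf [set (\sum_(0 <= k <oo)
    (lebesgue_rV n \x lebesgue_measure)%E (A k))%E |
    A in measurable_cover (F : set ('rV[measurableTypeR R]_n * measurableTypeR R))]
    = (vol F)%:E)%E by rewrite -bmeas_mu.
move=> sumA; exists (\bigcup_k A k); split => //; first exact: bigcup_measurable.
move=> X bX.
have mUA : measurable (\bigcup_k A k : set ST).
  by apply: borel_spacetime; exact: bigcup_measurable.
rewrite -lee_fin -bmeas_mu; last exact: bmeasI.
apply: (@le_trans _ _ (mu (\bigcup_k A k))).
  by apply: le_measure; rewrite ?inE//; apply: measurableI => //; case: bX.
rewrite EFinD (le_trans _ (ltW sumA))//.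
apply: (le_trans (measure_sigma_subadditive mu _ mUA _)) => //.
  by move=> k; exact: borel_spacetime.
  exact: subset_refl.
rewrite le_eqVlt; apply/orP; left; apply/eqP; apply: eq_eseriesr => k _.
exact: lebesgue_spacetime_borel.
Qed.

(** Any countable family is exhausted by these finite lists, which turns
    countable unions of cells into limits of finite ones. *)
Definition enum_upto (Q : countType) (P : Q -> Prop) (m : nat) : seq Q :=
  [seq q <- pmap pickle_inv (iota 0 m) | `[< P q >]].

Lemma enum_upto_uniq (Q : countType) (P : Q -> Prop) m : uniq (enum_upto P m).
Proof.
by rewrite filter_uniq// (pmap_uniq (@pickle_invK Q))// iota_uniq.
Qed.

Lemma mem_enum_upto (Q : countType) (P : Q -> Prop) m q :
  q \in enum_upto P m <-> P q /\ (pickle q < m)%N.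
Proof.
rewrite mem_filter mem_pmap; split.
  move=> /andP[/asboolP Pq /mapP[k]]; rewrite mem_iota add0n /= => km qk.
  by split => //; move: (@pickle_invK Q k); rewrite -qk /= => ->.
move=> [Pq qm]; apply/andP; split; first exact/asboolP.
by apply/mapP; exists (pickle q); rewrite ?mem_iota// pickleK_inv.
Qed.

Section partitions.
Context {K : countType} (idx : nat -> ST -> K).
Hypothesis idx_refine : forall i j z z', (i <= j)%N ->
  idx j z = idx j z' -> idx i z = idx i z'.
Hypothesis measurable_cell : forall i k, measurable [set z | idx i z = k].

Definition cell i k : set ST := [set z | idx i z = k].

(** The unions of cells of generation i. *)
Definition saturated i D := forall z z', idx i z = idx i z' -> D z -> D z'.

Lemma saturated_refine i j D : (i <= j)%N -> saturated i D -> saturated j D.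
Proof. by move=> ij sD z z' zz'; apply: sD; exact: idx_refine zz'. Qed.

Definition cells_upto i D m : seq K :=
  enum_upto (fun k => exists2 z, D z & idx i z = k) m.

Definition upto i D m : set ST := [set z | D z /\ idx i z \in cells_upto i D m].

Lemma upto_bigcup i D : D `<=` \bigcup_m upto i D m.
Proof.
move=> z Dz; exists (pickle (idx i z)).+1 => //; split => //.
by apply/mem_enum_upto; split => //; exists z.
Qed.

Lemma upto_nd i D m : upto i D m `<=` upto i D m.+1.
Proof.
by move=> z [Dz /mem_enum_upto[? ?]]; split => //; apply/mem_enum_upto; split => //; exact: ltnW.
Qed.

Lemma uptoE i D m : saturated i D ->
  upto i D m = \big[setU/set0]_(k <- cells_upto i D m) cell i k.
Proof.
move=> sD; rewrite -bigcup_seq; apply/seteqP; split => z.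
  by move=> [Dz kz]; exists (idx i z).
move=> [k /= km izk]; rewrite /cell/= in izk; subst k; split; last by [].
by case/mem_enum_upto: km => -[z' Dz' zz'] _; exact: sD Dz'.
Qed.

Lemma measurable_upto i D m : saturated i D -> measurable (upto i D m).
Proof.
by move=> sD; rewrite uptoE//; apply: bigsetU_measurable => k _; exact: measurable_cell.
Qed.

Lemma measurable_saturated i D : saturated i D -> measurable D.
Proof.
move=> sD; rewrite (_ : D = \bigcup_m upto i D m).
  by apply: bigcup_measurable => m _; exact: measurable_upto.
by apply/seteqP; split; [exact: upto_bigcup|move=> z [m _ []]].
Qed.

(** A saturated set is a countable union of cells, on each of which the
    density bound is assumed: the bound is summed over finitely many cells and
    passes to the limit. *)
Lemma density_saturated i F X D c : bmeas X -> bmeas F -> F `<=` X ->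
  saturated i D -> 0 <= c ->
  (forall k, vol (F `&` cell i k) <= c * vol (X `&` cell i k)) ->
  vol (F `&` D) <= c * vol (X `&` D).
Proof.
move=> bX bF FX sD c0 H.
have mD := measurable_saturated sD.
have mU m := measurable_upto m sD.
apply: (vol_exhaust mU (@upto_nd i D)).
- exact: bmeasI.
- by apply: subset_trans (@upto_bigcup i D); exact: subIsetr.
move=> m; set s := cells_upto i D m.
apply: (@le_trans _ _ (\sum_(k <- s) vol (F `&` cell i k))).
  apply: vol_cover.
  - by apply: bmeasI => //; exact: bmeasI.
  - by move=> k _; apply: bmeasI => //; exact: measurable_cell.
  - by move=> z [[Fz Dz] [_ km]]; exists (idx i z).
apply: (@le_trans _ _ (\sum_(k <- s) c * vol (X `&` cell i k))).
  by apply: ler_sum => k _; exact: H.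
rewrite -mulr_sumr ler_wpM2l//.
apply: sum_vol_le.
- exact: bmeasI.
- exact: enum_upto_uniq.
- by move=> k _; apply: measurableI; [case: bX|exact: measurable_cell].
- move=> k /mem_enum_upto[[z' Dz' zz'] _] z [Xz iz].
  by split => //; apply: sD Dz'; rewrite iz.
- by move=> j k z _ _ [_ <-] [_ <-].
Qed.

(** The sets that unions of cells approximate, in measure on X; these form a
    sigma-algebra. *)
Definition approx X A := measurable A /\ forall e : R, 0 < e -> exists i D,
  [/\ saturated i D, vol (X `&` (A `\` D)) <= e & vol (X `&` (D `\` A)) <= e].

(** Replaces Lebesgue's density theorem. A Borel hull of F is almost a union D
    of cells of one generation; then D is almost F, and the density bound on the
    cells of D gives |F| <= c |F| up to a small error, with c < 1. *)
Lemma density_null F X c : bmeas X -> bmeas F -> F `<=` X -> saturated 0%N X ->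
  0 <= c < 1 ->
  (forall A : set ('rV[measurableTypeR R]_n * measurableTypeR R),
     measurable A -> approx X A) ->
  (forall i k, vol (F `&` cell i k) <= c * vol (X `&` cell i k)) ->
  vol F = 0.
Proof.
move=> bX bF FX sX /andP[c0 c1] appX H.
apply/eqP; rewrite eq_le vol_ge0 andbT; apply/ler_addgt0Pr => e' e'0.
rewrite add0r; set e := e' * (1 - c) / 3.
have e0 : 0 < e by rewrite divr_gt0// mulr_gt0// subr_gt0.
have [A [mA FA volA]] := borel_outer bF e0.
have [_ /(_ _ e0)[i [D [sD AD DA]]]] := appX _ mA.
have mD := measurable_saturated sD.
have mA' : measurable (A : set ST) by exact: borel_spacetime.
have mF : measurable F by case: bF.
have FDc : vol (F `\` D) <= e.
  apply: le_trans AD; apply: le_vol.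
  - exact: bmeasD.
  - by apply: bmeasI => //; exact: measurableD.
  - by move=> z [Fz nDz]; split; [exact: FX|split => //; exact: FA].
have FD := density_saturated bX bF FX sD c0 (H i).
have XD : vol (X `&` D) <= vol F + e + e.
  have bXD : bmeas (X `&` D) by exact: bmeasI.
  rewrite (vol_setID bXD mA') lerD//.
    apply: le_trans (volA _ bX); apply: le_vol; [exact: bmeasI|exact: bmeasI|].
    by move=> z [[]].
  apply: le_trans DA; apply: le_vol; [exact: bmeasD| |].
    by apply: bmeasI => //; exact: measurableD.
  by move=> z [[]].
have FE : vol F <= c * (vol F + e + e) + e.
  by rewrite (vol_setID bF mD) lerD// (le_trans FD)// ler_wpM2l// -vol_setID.
have c10 : 0 < 1 - c by rewrite subr_gt0.
have e3 : e' * (1 - c) = 3 * e by rewrite /e mulrCA divff ?mulr1 ?pnatr_eq0.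
rewrite -(ler_pM2r c10) e3.
by apply: absorb_small FE; rewrite ler_piMl// ltW.
Qed.

Section approx_sigma_algebra.
Context (X : set ST) (bX : bmeas X).

Lemma approx_saturated i D : saturated i D -> approx X D.
Proof.
move=> sD; split; first exact: measurable_saturated sD.
by move=> e e0; exists i, D; split => //; rewrite setDv setI0 vol_set0 ltW.
Qed.

Lemma approxC A : approx X A -> approx X (~` A).
Proof.
move=> [mA aA]; split; first exact: measurableC.
move=> e e0; have [i [D [sD AD DA]]] := aA _ e0.
exists i, (~` D); split; first by move=> z z' zz' nDz Dz'; apply/nDz/sD/Dz'.
  by rewrite setDE setCK [_ `&` D]setIC -setDE.
by rewrite setDE setCK [_ `&` A]setIC -setDE.
Qed.

(** The two error sets are covered by those of the two sets, at half the
    tolerance each; the finer of the two generations serves for both. *)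
Lemma approxU A B : approx X A -> approx X B -> approx X (A `|` B).
Proof.
move=> [mA aA] [mB aB]; split; first exact: measurableU.
move=> e e0; have e20 : 0 < e / 2 by rewrite divr_gt0.
have [i [D [sD AD DA]]] := aA _ e20.
have [j [D' [sD' AD' DA']]] := aB _ e20.
have mD := measurable_saturated sD; have mD' := measurable_saturated sD'.
exists (maxn i j), (D `|` D'); split.
- move=> z z' zz' [Dz|Dz]; [left|right].
    by apply: (saturated_refine (leq_maxl i j) sD) zz' Dz.
  by apply: (saturated_refine (leq_maxr i j) sD') zz' Dz.
- have -> : e = e / 2 + (e / 2 + 0) by field.
  apply: (le_trans _ (lerD AD (lerD AD' (lexx 0)))).
  have := @vol_cover _ _ bool [:: true; false]
    (fun b => X `&` (if b then A `\` D else B `\` D')) (X `&` ((A `|` B) `\` (D `|` D'))).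
  rewrite !big_cons big_nil; apply.
  + by apply: bmeasI => //; apply: measurableD; exact: measurableU.
  + by case=> _; apply: bmeasI => //; exact: measurableD.
  + by move=> z [Xz [[Az|Bz] nD]]; [exists true|exists false];
      rewrite ?inE//=; split => //; split => // ?; apply: nD; [left|right].
- have -> : e = e / 2 + (e / 2 + 0) by field.
  apply: (le_trans _ (lerD DA (lerD DA' (lexx 0)))).
  have := @vol_cover _ _ bool [:: true; false]
    (fun b => X `&` (if b then D `\` A else D' `\` B)) (X `&` ((D `|` D') `\` (A `|` B))).
  rewrite !big_cons big_nil; apply.
  + by apply: bmeasI => //; apply: measurableD; exact: measurableU.
  + by case=> _; apply: bmeasI => //; exact: measurableD.
  + by move=> z [Xz [[Az|Bz] nD]]; [exists true|exists false];
      rewrite ?inE//=; split => //; split => // ?; apply: nD; [left|right].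
Qed.

Lemma approxI A B : approx X A -> approx X B -> approx X (A `&` B).
Proof.
by move=> aA aB; rewrite -[_ `&` _]setCK setCI; apply/approxC/approxU; exact: approxC.
Qed.

(** On the finite-volume set X a countable union is nearly a finite one. *)
Lemma approx_bigcup (A : nat -> set ST) : (forall k, approx X (A k)) ->
  approx X (\bigcup_k A k).
Proof.
move=> aA; have mA k : measurable (A k) by case: (aA k).
have mUA : measurable (\bigcup_k A k) by exact: bigcup_measurable.
split => // e e0; have e20 : 0 < e / 2 by rewrite divr_gt0.
pose B m := \big[setU/set0]_(k < m) A k.
have aB m : approx X (B m).
  rewrite /B; elim: m => [|m IH].
    by rewrite big_ord0; apply: (@approx_saturated 0%N).
  by rewrite big_ord_recr; exact: approxU.
have mB m : measurable (B m) by case: (aB m).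
have [m Hm] : exists m, vol ((X `&` \bigcup_k A k) `\` B m) <= e / 2.
  apply: vol_exhaust_diff => //.
  - by move=> m; rewrite /B big_ord_recr; exact: subsetUl.
  - exact: bmeasI.
  - move=> z [_ [k _ Akz]]; exists k.+1 => //.
    by rewrite /B big_ord_recr/=; right.
have [_ /(_ _ e20)[i [D [sD BD DB]]]] := aB m.
have mD := measurable_saturated sD.
have BA : B m `<=` \bigcup_k A k.
  by rewrite /B -bigcup_mkord => z [k _ Akz]; exists k.
exists i, D; split => //.
  have -> : e = e / 2 + (e / 2 + 0) by field.
  apply: (le_trans _ (lerD Hm (lerD BD (lexx 0)))).
  have := @vol_cover _ _ bool [:: true; false]
    (fun b => if b then (X `&` \bigcup_k A k) `\` B m else X `&` (B m `\` D))
    (X `&` (\bigcup_k A k `\` D)).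
  rewrite !big_cons big_nil; apply.
  + by apply: bmeasI => //; exact: measurableD.
  + by case=> _; [apply: bmeasD => //; exact: bmeasI|
      apply: bmeasI => //; exact: measurableD].
  + move=> z [Xz [Az nD]].
    by have [Bz|nBz] := pselect (B m z); [exists false|exists true]; rewrite ?inE.
apply: (@le_trans _ _ (e / 2)); last by rewrite ler_pdivrMr// ler_peMr ?ler1n// ltW.
apply: le_trans DB.
apply: le_vol; [by apply: bmeasI => //; exact: measurableD..|].
by move=> z [Xz [Dz nAz]]; split=> //; split=> // /BA.
Qed.

(** The half-line ]x, +oo[ is the union over i of the mesh intervals of
    length [h i] to the right of the one that contains x; each of these unions
    of intervals pulls back to a saturated set. *)
Lemma approx_preimage (g : ST -> R) (h : nat -> R) :
  (forall i, 0 < h i) -> (forall e, 0 < e -> exists i, h i < e) ->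
  (forall i z z', idx i z = idx i z' ->
    Num.floor (g z / h i) = Num.floor (g z' / h i)) ->
  forall B : set (measurableTypeR R), measurable B -> approx X (g @^-1` B).
Proof.
move=> h0 h_small gh.
pose C := [set B : set R | approx X (g @^-1` B)].
suff : @measurable _ (measurableTypeR R) `<=` C by move=> H B /H.
rewrite [X in X `<=` _](RGenOInfty.measurableE R).
apply: smallest_sub => /=.
  split => [|B aB|F aF].
  - by rewrite /C/= preimage_set0; exact: (@approx_saturated 0%N).
  - by rewrite /C/= setTD preimage_setC; exact: approxC.
  - by rewrite /C/= preimage_bigcup; exact: approx_bigcup.
move=> _ [x ->]; rewrite /C/=.
rewrite (_ : _ @^-1` _ = \bigcup_i
    [set z | Num.floor (x / h i) < Num.floor (g z / h i)]).
  apply: approx_bigcup => i; apply: (@approx_saturated i) => z z' zz' /=.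
  by rewrite (gh _ _ _ zz').
apply/seteqP; split => z; rewrite /= in_itv/= andbT.
  move=> xgz; have [|i hi] := h_small (g z - x); first by rewrite subr_gt0.
  exists i => //=; rewrite -lezD1 floor_ge_int.
  rewrite ler_pdivlMr//; have := floor_le (x / h i); rewrite ler_pdivlMr// intrD.
  by move=> ?; lra.
move=> [i _] /=; rewrite -lezD1 floor_ge_int ler_pdivlMr//; apply: lt_le_trans.
by rewrite -ltr_pdivrMr// floorD1_gt.
Qed.

(** The Borel sets of R^n x R are generated by the coordinates. *)
Lemma approx_borel :
  (forall (a : 'I_n) (B : set (measurableTypeR R)), measurable B ->
     approx X [set z : ST | B (z.1 ord0 a)]) ->
  (forall B : set (measurableTypeR R), measurable B ->
     approx X [set z : ST | B z.2]) ->
  forall A : set ('rV[measurableTypeR R]_n * measurableTypeR R),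
  measurable A -> approx X A.
Proof.
move=> H1 H2.
have sigma (T : Type) (f : ST -> T) :
    sigma_algebra setT [set B : set T | approx X (f @^-1` B)].
  split => [|B aB|F aF].
  - by rewrite /= preimage_set0; exact: (@approx_saturated 0%N).
  - by rewrite /= setTD preimage_setC; exact: approxC.
  - by rewrite /= preimage_bigcup; exact: approx_bigcup.
have H3 (B : set 'rV[measurableTypeR R]_n) : measurable B ->
    approx X [set z : ST | B z.1].
  move: B; apply: smallest_sub; first exact: (sigma _ (fun z : ST => z.1)).
  rewrite -bigcup_seq; apply: bigcup_sub => a _ A [B mB <-].
  by rewrite setTI; exact: H1.
rewrite measurable_prod_measurableType.
apply: smallest_sub; first exact: (sigma _ (fun z : ST => z)).
move=> _ [A mA [B mB <-]] /=; apply: (@approxI [set z : ST | A z.1]).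
  exact: H3.
exact: H2.
Qed.

End approx_sigma_algebra.
End partitions.
End Density.

(** * A parabolic dyadic grid *)

(** Halving a mesh refines it; here for a mesh divided by any N. *)
Lemma floor_refine (R : realType) (N : nat) (u v : R) : (0 < N)%N ->
  Num.floor (N%:R * u) = Num.floor (N%:R * v) -> Num.floor u = Num.floor v.
Proof.
move=> N0; have N0' : 0 < N%:R :> R by rewrite ltr0n.
wlog suff : u v / Num.floor (N%:R * u) = Num.floor (N%:R * v) ->
    Num.floor u <= Num.floor v.
  by move=> H uv; apply/eqP; rewrite eq_le !H.
move=> uv; rewrite floor_ge_int -(ler_pM2l N0').
have -> : N%:R * (Num.floor u)%:~R = (N%:Z * Num.floor u)%:~R :> R by rewrite intrM.
by rewrite -floor_ge_int -uv floor_ge_int intrM ler_pM2l// floor_le.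
Qed.

Section Grid.
Context {R : realType} {n : nat}.
Local Notation ST := (spacetime R n).
Context (l0 tau0 : R) (e : nat -> nat).
Hypotheses (l0_gt0 : 0 < l0) (tau0_gt0 : 0 < tau0).
Hypotheses (e_mono : forall i j, (i <= j)%N -> (e i <= e j)%N).
Hypothesis (e_ge : forall i, (i <= e i)%N).

Definition halfside (i : nat) : R := l0 / 2 ^+ i.
(** Parabolic scaling asks for time steps proportional to 2^(- i p), which are
    not nested. The steps 2^(- e i) with integral exponents are nested, and
    stay comparable when e i is the integral part of i p. *)
Definition tick (i : nat) : R := tau0 / 2 ^+ (e i).

Lemma halfside_gt0 i : 0 < halfside i.
Proof. by rewrite divr_gt0// exprn_gt0. Qed.

Lemma tick_gt0 i : 0 < tick i.
Proof. by rewrite divr_gt0// exprn_gt0. Qed.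

Definition address (i : nat) (z : ST) : 'rV[int]_n * int :=
  (\row_a Num.floor (z.1 ord0 a / (2 * halfside i)), Num.floor (z.2 / tick i)).

Definition center (i : nat) (k : 'rV[int]_n * int) : 'rV[R]_n :=
  \row_a (((k.1 ord0 a)%:~R * 2 + 1) * halfside i).
Definition start (i : nat) (k : 'rV[int]_n * int) : R := k.2%:~R * tick i.

Lemma address_refine i j z z' : (i <= j)%N ->
  address j z = address j z' -> address i z = address i z'.
Proof.
move=> ij [zz1 zz2]; rewrite /address; congr pair.
  apply/rowP => a; rewrite !mxE; move/rowP/(_ a): zz1; rewrite !mxE => zz1.
  apply: (@floor_refine _ (2 ^ (j - i))); first by rewrite expn_gt0.
  have E (u : R) : (2 ^ (j - i))%:R * (u / (2 * halfside i)) = u / (2 * halfside j).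
    have -> : halfside j = halfside i / 2 ^+ (j - i).
      by rewrite /halfside -{1}(subnK ij) addnC exprD invfM mulrA.
    rewrite natrX; field.
    by rewrite !expf_neq0// gt_eqF// halfside_gt0.
  by rewrite !E.
apply: (@floor_refine _ (2 ^ (e j - e i))); first by rewrite expn_gt0.
have E (u : R) : (2 ^ (e j - e i))%:R * (u / tick i) = u / tick j.
  have -> : tick j = tick i / 2 ^+ (e j - e i).
    by rewrite /tick -{1}(subnK (e_mono ij)) addnC exprD invfM mulrA.
  rewrite natrX; field.
  by rewrite !expf_neq0// gt_eqF// tick_gt0.
by rewrite !E.
Qed.

Lemma addressP i k z : address i z = k <->
  (forall a, center i k ord0 a - halfside i <= z.1 ord0 a < center i k ord0 a + halfside i)
  /\ start i k <= z.2 < start i k + tick i.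
Proof.
have h0 := halfside_gt0 i; have t0 := tick_gt0 i.
have F (u d : R) (m : int) : 0 < d ->
    (Num.floor (u / d) == m) = (m%:~R * d <= u < m%:~R * d + d).
  move=> d0; rewrite floor_eq ler_pdivlMr// ltr_pdivrMr// intrD.
  by rewrite mulrDl mul1r.
split.
  move=> <-; split.
    move=> a; rewrite !mxE /=.
    have := F (z.1 ord0 a) (2 * halfside i) (Num.floor (z.1 ord0 a / (2 * halfside i))).
    rewrite eqxx mulr_gt0// => /(_ isT)/esym/andP[? ?].
    by apply/andP; split; lra.
  by rewrite /start /= -F.
case: k => k m [H1]; rewrite /start/= -F// => /eqP H2.
rewrite /address H2; congr pair; apply/rowP => a; rewrite !mxE; apply/eqP.
rewrite F ?mulr_gt0//; have := H1 a; rewrite !mxE /= => /andP[? ?].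
by apply/andP; split; lra.
Qed.

Lemma address_center i (z : ST) a :
  `|z.1 ord0 a - center i (address i z) ord0 a| <= halfside i.
Proof.
have [/(_ a)/andP[? ?] _] := (addressP i (address i z) z).1 erefl.
by rewrite ler_distl; apply/andP; split; lra.
Qed.

Lemma address_start i (z : ST) :
  start i (address i z) <= z.2 < start i (address i z) + tick i.
Proof. by have [_] := (addressP i (address i z) z).1 erefl. Qed.

Lemma measurable_address i k : measurable [set z : ST | address i z = k].
Proof.
rewrite (_ : [set _ | _] = (\bigcap_(a in [set: 'I_n])
    ((fun y : 'rV[measurableTypeR R]_n => y ord0 a) @^-1`
     `[center i k ord0 a - halfside i, center i k ord0 a + halfside i[%classic)) `*`
    `[start i k, start i k + tick i[%classic).
  apply: (@borel_spacetime R n); apply: measurableX; last exact: measurable_itv.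
  apply: fin_bigcap_measurable => [|a _]; first exact: finite_finset.
  by rewrite -[X in measurable X]setTI; exact: measurable_coord.
apply/seteqP; split => z /=.
  move/addressP => [H1 H2]; split; last by rewrite /= in_itv.
  by move=> a _; rewrite /= in_itv/=; exact: H1.
move=> [H1 H2]; apply/addressP; split; last by move: H2; rewrite /= in_itv.
by move=> a; have := H1 a Logic.I; rewrite /= in_itv.
Qed.

Lemma cell_subset_prism i k :
  cell address i k `<=` prism (center i k) (halfside i) (start i k - tick i) (start i k + tick i).
Proof.
move=> z <-; split; first exact: address_center.
have /andP[? ?] := address_start i z; have := tick_gt0 i.
by rewrite /= in_itv/= => ?; apply/andP; split; lra.
Qed.

Lemma prism_subset_cell i k r a b : r < halfside i -> start i k <= a -> b <= start i k + tick i ->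
  prism (center i k) r a b `<=` cell address i k.
Proof.
move=> ri ka kb z [Hz]; rewrite /= in_itv/= => /andP[za zb].
apply/addressP; split; last by apply/andP; split; lra.
by move=> c; have := Hz c; rewrite ler_distl => /andP[? ?]; apply/andP; split; lra.
Qed.

Lemma bmeas_cell i k : bmeas (cell address i k).
Proof.
apply: (bmeas_sub _ (@cell_subset_prism i k)); first exact: measurable_address.
exact: bmeas_prism.
Qed.

Lemma exp2_unbounded (r : R) : exists i : nat, r < 2 ^+ i.
Proof.
exists (Num.truncn r).+1; have := truncnS_gt r => H; apply: (lt_trans H).
by rewrite -natrX ltr_nat ltn_expl.
Qed.

Lemma grid_approx_borel X : bmeas X ->
  forall A : set ('rV[measurableTypeR R]_n * measurableTypeR R),
  measurable A -> approx address X A.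
Proof.
move=> bX; apply: approx_borel => //.
- exact: address_refine.
- exact: measurable_address.
- move=> a; apply: (@approx_preimage _ _ _ address _ _ _ bX
    (fun z : ST => z.1 ord0 a) (fun i => 2 * halfside i)) => //.
  + exact: address_refine.
  + exact: measurable_address.
  + by move=> i; rewrite mulr_gt0// halfside_gt0.
  + move=> d d0; have [i Hi] := exp2_unbounded (2 * l0 / d); exists i.
    rewrite /halfside mulrA ltr_pdivrMr ?exprn_gt0//.
    by move: Hi; rewrite ltr_pdivrMr// [_ ^+ i * _]mulrC.
  + by move=> i z z' [/rowP/(_ a) + _]; rewrite !mxE.
- apply: (@approx_preimage _ _ _ address _ _ _ bX (fun z : ST => z.2) tick) => //.
  + exact: address_refine.
  + exact: measurable_address.
  + exact: tick_gt0.
  + move=> d d0; have [i Hi] := exp2_unbounded (tau0 / d); exists i.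
    rewrite /tick ltr_pdivrMr ?exprn_gt0//.
    move: Hi; rewrite ltr_pdivrMr// [_ ^+ i * _]mulrC => Hi; apply: (lt_le_trans Hi).
    by rewrite ler_pM2l// ler_eXn2l// ltr1n.
  + by move=> i z z' /(congr1 snd).
Qed.

End Grid.

(** * Moving mass forward in time *)

Lemma norm_center_le (R : realFieldType) (u v : R) :
  0 <= u -> u + 1 <= v -> `|u * 2 + 1 - v| <= v.
Proof. by move=> u0 uv; rewrite ler_norml; apply/andP; split; lra. Qed.

Lemma start_range (R : realFieldType) (s q d r a b : R) : 0 < d -> d <= r ->
  0 <= q * d -> a <= b -> q * d <= 2 * a ->
  s - r <= s + (q - 1) * d / 2 <= s + b.
Proof. by move=> *; apply/andP; split; lra. Qed.

Lemma elapsed_time_bounds (R : realFieldType) (s t s' a D M r : R) :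
  s + a + D * r <= s' <= s + M * r -> s - r <= t <= s + a ->
  D * r <= s' - t <= (M + 1) * r.
Proof. by move=> /andP[? ?] /andP[? ?]; apply/andP; split; lra. Qed.

Lemma leftover_volume (R : realFieldType) (V v v1 v2 al : R) : v = v1 + v2 ->
  (1 + al) / 2 * V <= v -> v1 <= al * V -> (1 - al) / 2 * V <= v2.
Proof. by lra. Qed.

Lemma bernoulli (R : realFieldType) m (x : R) : 0 <= x <= 1 -> 1 - m%:R * x <= (1 - x) ^+ m.
Proof.
move=> /andP[x0 x1]; elim: m => [|m IH]; first by rewrite mul0r subr0 expr0.
rewrite exprS; apply: (@le_trans _ _ ((1 - x) * (1 - m%:R * x))).
  rewrite -natr1; have : 0 <= m%:R * x * x by rewrite !mulr_ge0.
  by lra.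
by rewrite ler_wpM2l// subr_ge0.
Qed.

Section Chain.
Context {R : realType} {n : nat}.
Local Notation ST := (spacetime R n).
Context (p g : R) (hp : 1 < p) (hg : 0 < g < 1).
Context (w : ST -> R) (hw : weight w).

Implicit Types (x : 'rV[R]_n) (s L lam : R).

Let p0 : 0 < p. Proof. exact: lt_trans hp. Qed.

(** A lower part with bottom time s: the common shape of R^- and R^+. *)
Definition box (x : 'rV[R]_n) (s L : R) : set ST :=
  prism x L s (s + (1 - g) * L `^ p).

Definition boxvol (L : R) : R := (2 * L) ^+ n * ((1 - g) * L `^ p).

Lemma boxvol_gt0 L : 0 < L -> 0 < boxvol L.
Proof.
move=> L0; rewrite mulr_gt0 ?exprn_gt0 ?mulr_gt0 ?powR_gt0//.
by rewrite subr_gt0; case/andP: hg.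
Qed.

Lemma vol_box x s L : 0 < L -> vol (box x s L) = boxvol L.
Proof.
move=> L0; rewrite vol_prism ?ltW//.
  by rewrite /boxvol addrAC subrr add0r.
by rewrite ltrDl mulr_gt0 ?powR_gt0// subr_gt0; case/andP: hg.
Qed.

Lemma bmeas_box x s L : bmeas (box x s L).
Proof. exact: bmeas_prism. Qed.

(** From the bottom of R^- to the bottom of R^+. *)
Definition time_lag (L : R) : R := (1 + g) * L `^ p.

(** The form in which (vi) is used. As lam need only be a lower bound for the
    average, one rectangle can be treated at many levels. *)
Definition sublevel_decay (h th : R) := forall x s L lam, 0 < L -> 0 < lam ->
  lam * boxvol L <= mass w (box x s L) ->
  vol (box x (s + time_lag L) L `&` [set z | w z < h * lam]) <= th * boxvol L.

Section chain.
Context (beta alpha : R).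
Hypotheses (beta0 : 0 < beta) (beta1 : beta <= 1) (alpha01 : 0 <= alpha < 1).
Hypothesis decay : sublevel_decay beta alpha.

Let dimc : R := n%:R + 2 / (1 - g).
Let eps : R := (1 - alpha) / 2 / dimc.
Let c0 : R := beta * ((1 - alpha) / 2).

Let dimc_gt0 : 0 < dimc.
Proof. by rewrite ltr_wpDl// divr_gt0// subr_gt0; case/andP: hg. Qed.

Let eps_gt0 : 0 < eps.
Proof. by rewrite !divr_gt0// subr_gt0; case/andP: alpha01. Qed.

Let eps_g : 2 * eps <= 1 - g.
Proof.
have g1 : 0 < 1 - g by rewrite subr_gt0; case/andP: hg.
have H : 2 / (1 - g) <= dimc by rewrite lerDr.
have: eps * dimc = (1 - alpha) / 2 by rewrite /eps; field; rewrite gt_eqF.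
have: eps * (2 / (1 - g)) <= eps * dimc by rewrite ler_pM2l.
move: H; case/andP: alpha01 => a0 a1 _ H1 H2.
have : eps * (2 / (1 - g)) <= 1 by lra.
by rewrite mulrA ler_pdivrMr// mul1r mulrC.
Qed.

Let c0_gt0 : 0 < c0.
Proof. by case/andP: alpha01 => a0 a1; rewrite mulr_gt0// divr_gt0// subr_gt0. Qed.

(** The proportion alpha < 1 leaves room: on the intersection of the upper
    box with a perturbation of it of relative size eps, the set {w >= beta lam}
    still has proportion (1 - alpha) / 2. *)
Lemma chain_step x s x' s' L lam : 0 < L -> 0 < lam ->
  lam * boxvol L <= mass w (box x s L) ->
  (forall a, `|x' ord0 a - x ord0 a| <= eps * L) ->
  `|s' - s - time_lag L| <= eps * L `^ p ->
  c0 * lam * boxvol L <= mass w (box x' s' L).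
Proof.
move=> L0 lam0 big xx ss.
have Lp0 : 0 < L `^ p by rewrite powR_gt0.
have V0 := boxvol_gt0 L0.
have [a0 a1] := andP alpha01; have [g0 g1] := andP hg.
have e1 : eps <= 1 by have := eps_g; lra.
pose s1 := s + time_lag L.
(* contained in the upper box and in every admissible perturbation of it *)
pose I := prism x ((1 - eps) * L) (s1 + eps * L `^ p) (s1 + (1 - g) * L `^ p - eps * L `^ p).
have bI : bmeas I by exact: bmeas_prism.
have mlt c := measurable_lt hw c.
(* Bernoulli's inequality; eps is (1 - alpha) / 2 divided by the total
   number n + 2 / (1 - g) of relative losses of size eps *)
have volI : (1 + alpha) / 2 * boxvol L <= vol I.
  rewrite vol_prism; last 2 first.
  - by rewrite mulr_ge0 ?subr_ge0// ltW.
  - have : 2 * eps * L `^ p <= (1 - g) * L `^ p by rewrite ler_pM2r.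
    by lra.
  have -> : (2 * ((1 - eps) * L)) ^+ n * (s1 + (1 - g) * L `^ p - eps * L `^ p - (s1 + eps * L `^ p))
     = (1 - eps) ^+ n * (1 - 2 * eps / (1 - g)) * boxvol L.
    have -> : 2 * ((1 - eps) * L) = (1 - eps) * (2 * L) by ring.
    by rewrite exprMn /boxvol; field; lra.
  rewrite ler_pM2r//.
  have g1' : 0 < 1 - g by lra.
  have H2 : 0 <= 1 - 2 * eps / (1 - g) <= 1.
    rewrite subr_ge0 ler_pdivrMr// mul1r eps_g/= gerBl divr_ge0// ?ltW//.
    by rewrite mulr_gt0.
  have B : 1 - n%:R * eps <= (1 - eps) ^+ n by apply: bernoulli; rewrite (ltW eps_gt0).
  have [H20 H21] := andP H2.
  have : (1 - n%:R * eps) * (1 - 2 * eps / (1 - g)) <= (1 - eps) ^+ n * (1 - 2 * eps / (1 - g)).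
    by rewrite ler_wpM2r.
  apply: le_trans.
  have : eps * dimc = (1 - alpha) / 2 by rewrite /eps; field; rewrite gt_eqF.
  have -> : 2 * eps / (1 - g) = eps * (2 / (1 - g)) by ring.
  rewrite /dimc; set u := 2 / (1 - g).
  have : 0 <= n%:R * eps * (eps * u).
    have u0 : 0 <= u by rewrite ltW// /u divr_gt0.
    have ez : 0 <= eps := ltW eps_gt0.
    by apply: mulr_ge0; apply: mulr_ge0.
  by lra.
have sub1 : I `<=` box x' s' L.
  apply: prism_subset.
  - by move=> a; have := xx a; rewrite distrC; lra.
  - by move: ss; rewrite ler_distl /s1 => /andP[]; lra.
  - by move: ss; rewrite ler_distl /s1 => /andP[]; lra.
have sub2 : I `<=` box x s1 L.
  apply: prism_subset.
  - by move=> a; rewrite subrr normr0 add0r ler_piMl ?ltW// ?gtrBl.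
  - by rewrite lerDl mulr_ge0// ltW.
  - by rewrite gerBl mulr_ge0// ltW.
have low := decay L0 lam0 big.
have lowI : vol (I `&` [set z | w z < beta * lam]) <= alpha * boxvol L.
  apply: le_trans low; apply: le_vol; [exact: bmeasI|exact/bmeasI/mlt/bmeas_box|].
  by move=> z [/sub2].
have high : (1 - alpha) / 2 * boxvol L <= vol (I `\` [set z | w z < beta * lam]).
  exact: leftover_volume (vol_setID bI (mlt (beta * lam))) volI lowI.
have bID : bmeas (I `\` [set z | w z < beta * lam]) by exact: bmeasD.
apply: (@le_trans _ _ (mass w (I `\` [set z | w z < beta * lam]))).
  have bl0 : 0 <= beta * lam by rewrite mulr_ge0// ltW.
  apply: le_trans (ge_mass_vol hw bID bl0 _); last first.
    by move=> z [_] /=; move/negP; rewrite -leNgt.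
  rewrite /c0; have : beta * lam * ((1 - alpha) / 2 * boxvol L) <=
    beta * lam * vol (I `\` [set z | w z < beta * lam]) by rewrite ler_wpM2l.
  by apply: le_trans; rewrite le_eqVlt; apply/orP; left; apply/eqP; ring.
apply: le_mass => //; first exact: bmeas_box.
by move=> z [/sub1].
Qed.

Lemma chain_iter N x s (v : 'rV[R]_n) (tau : R) L lam : 0 < L -> 0 < lam ->
  lam * boxvol L <= mass w (box x s L) ->
  (forall a, `|v ord0 a| <= eps * L) ->
  `|tau - time_lag L| <= eps * L `^ p ->
  c0 ^+ N * lam * boxvol L <= mass w (box (x + N%:R *: v) (s + N%:R * tau) L).
Proof.
move=> L0 lam0 big vv tt; elim: N => [|N IH].
  by rewrite expr0 mul1r scale0r mul0r !addr0.
have lN0 : 0 < c0 ^+ N * lam by rewrite mulr_gt0// exprn_gt0.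
have -> : c0 ^+ N.+1 * lam = c0 * (c0 ^+ N * lam) by rewrite exprS mulrA.
apply: (chain_step L0 lN0 IH).
- move=> a; rewrite !mxE -natr1.
  have -> : x ord0 a + (N%:R + 1) * v ord0 a - (x ord0 a + N%:R * v ord0 a) = v ord0 a by ring.
  exact: vv.
- rewrite -natr1.
  by have -> : s + (N%:R + 1) * tau - (s + N%:R * tau) - time_lag L = tau - time_lag L by ring.
Qed.

(** Equal steps lead from s to s + D L^p and from x to x'. Each step may
    deviate from the [time_lag] by eps L^p in time and by eps L in space; so
    D large makes the time difference a sum of admissible steps, and after D
    units of time a distance proportional to D is available. *)
Lemma reach_same : exists D0 kappa : R, [/\ 0 < D0, 0 < kappa & forall M : R,
  exists2 c : R, 0 < c <= 1 & forall x s x' L lam D, 0 < L -> 0 < lam ->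
  lam * boxvol L <= mass w (box x s L) -> D0 <= D <= M ->
  (forall a, `|x' ord0 a - x ord0 a| <= kappa * D * L) ->
  c * lam * boxvol L <= mass w (box x' (s + D * L `^ p) L)].
Proof.
have [g0 g1] := andP hg; have [a0 a1] := andP alpha01.
have ep := eps_gt0.
have c01 : c0 <= 1.
  by rewrite /c0 mulr_ile1// ?(ltW beta0)//; lra.
exists ((1 + g) * (2 / eps + 1)), (eps / 4); split.
- by rewrite mulr_gt0 ?addr_gt0 ?divr_gt0//; lra.
- by rewrite divr_gt0.
move=> M; exists (c0 ^+ (Num.truncn M)).
  by rewrite exprn_gt0 ?exprn_ile1// ltW.
move=> x s x' L lam D L0 lam0 big /andP[D0 DM] xx.
have Lp0 : 0 < L `^ p by rewrite powR_gt0.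
have V0 := boxvol_gt0 L0.
(* the number of steps of a duration slightly above the time lag *)
pose N := Num.truncn (D / (1 + g)).
have Dg : 2 / eps + 1 <= D / (1 + g).
  by rewrite ler_pdivlMr; [rewrite [_ * (1 + g)]mulrC|lra].
have e2 : 0 < 2 / eps by rewrite divr_gt0.
have Dg0 : 0 <= D / (1 + g) by lra.
have /andP[ND DN] := truncn_itv Dg0.
rewrite -/N in ND DN.
have NR : 2 / eps <= N%:R by move: DN; rewrite -natr1; lra.
have N0 : 0 < N%:R :> R by lra.
have D_gt0 : 0 < D by move: Dg0 Dg; rewrite ler_pdivlMr; nra.
have H1 : N%:R * (1 + g) <= D by rewrite -ler_pdivlMr; lra.
have H2 : D <= (N%:R + 1) * (1 + g).
  by rewrite -ler_pdivrMr ?natr1 ?ltW//; lra.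
have H3 : 2 <= N%:R * eps by rewrite -ler_pdivrMr.
have N1 : 1 <= N%:R :> R by rewrite ler1n -(ltr0n R).
pose v : 'rV[R]_n := N%:R^-1 *: (x' - x).
have vv a : `|v ord0 a| <= eps * L.
  rewrite !mxE normrM gtr0_norm ?invr_gt0// mulrC ler_pdivrMr//.
  apply: (le_trans (xx a)).
  have -> : eps * L * N%:R = eps / 4 * (4 * N%:R) * L by field.
  rewrite ler_pM2r// ler_pM2l; last by apply: divr_gt0.
  by apply: (le_trans H2); nra.
have tt : `|D / N%:R * L `^ p - time_lag L| <= eps * L `^ p.
  rewrite /time_lag -mulrBl normrM (gtr0_norm Lp0) ler_pM2r//.
  rewrite ger0_norm; last by rewrite subr_ge0 ler_pdivlMr//; lra.
  rewrite lerBlDl ler_pdivrMr// mulrDl.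
  by apply: (le_trans H2); nra.
have := @chain_iter N x s v _ L lam L0 lam0 big vv tt.
rewrite /v scalerA divff ?gt_eqF// scale1r addrC subrK.
have -> : s + N%:R * (D / N%:R * L `^ p) = s + D * L `^ p.
  by congr (s + _); field; rewrite gt_eqF.
apply: le_trans; rewrite ler_pM2r// ler_pM2r//.
apply: ler_wiXn2l => //; first exact: ltW.
apply: le_truncn; apply: le_trans DM; rewrite ler_pdivrMr; last by lra.
by rewrite mulrDr mulr1 lerDl mulr_ge0// ltW.
Qed.

(** A box of side L is covered by boundedly many boxes of side L / k, so one of
    them has an average not much smaller. The boxes overlap in time, by half of
    their duration, because they are open in time. *)
Lemma pigeonhole (k : nat) : (0 < k)%N -> exists2 c : R, 0 < c <= 1 &
  forall x s L lam, 0 < L -> 0 < lam -> lam * boxvol L <= mass w (box x s L) ->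
  exists x1 s1, [/\ forall a, `|x1 ord0 a - x ord0 a| <= L,
    s - (L / k%:R) `^ p <= s1 <= s + L `^ p &
    c * lam * boxvol (L / k%:R) <= mass w (box x1 s1 (L / k%:R))].
Proof.
move=> k0; have k0' : 0 < k%:R :> R by rewrite ltr0n.
have k1 : 1 <= k%:R :> R by rewrite ler1n.
have [g0 g1] := andP hg.
(* number of half-overlapping time intervals *)
pose M := (Num.truncn (2 * k%:R `^ p)).+1.
pose I : finType := ({ffun 'I_n -> 'I_k} * 'I_M)%type.
have I0 : (0 < #|I|)%N.
  rewrite card_prod card_ffun !card_ord muln_gt0 expn_gt0 k0 /=; exact: ltn0Sn.
have I0' : 0 < #|I|%:R :> R by rewrite ltr0n.
exists (#|I|%:R^-1).
  by rewrite invr_gt0 I0' invf_le1// ler1n.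
move=> x s L lam L0 lam0 big.
pose r := L / k%:R; rewrite -/r.
have r0 : 0 < r by rewrite divr_gt0.
have Lr : L = k%:R * r by rewrite /r; field; rewrite gt_eqF.
clearbody r.
have rp0 : 0 < r `^ p by rewrite powR_gt0.
have Lp0 : 0 < L `^ p by rewrite powR_gt0.
have Lpr : L `^ p = k%:R `^ p * r `^ p by rewrite Lr powRM// ltW.
pose d := (1 - g) * r `^ p.
have d0 : 0 < d by rewrite mulr_gt0// subr_gt0.
have dr : d <= r `^ p by rewrite /d ler_piMl ?ltW//; lra.
pose ctr (q : I) : 'rV[R]_n := \row_a (x ord0 a + ((q.1 a)%:R * 2 + 1 - k%:R) * r).
pose st (q : I) : R := s + (q.2%:R - 1) * d / 2.
have cover : box x s L `<=` [set z | exists2 q, q \in enum I & box (ctr q) (st q) r z].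
  move=> [y t] [Hy Ht]; move: Hy Ht; rewrite /= in_itv/= => Hy /andP[t1 t2].
  have jP (a : 'I_n) : exists j : 'I_k, `|y ord0 a - (x ord0 a + (j%:R * 2 + 1 - k%:R) * r)| <= r.
    have := Hy a; rewrite ler_distl Lr => /andP[y1 y2].
    move: (y ord0 a) (x ord0 a) y1 y2 => u c y1 y2.
    (* at the right end point of a side the floor would be k, one too many *)
    have [uk|uk] := ltP u (c + k%:R * r).
      have u0 : 0 <= (u - c + k%:R * r) / (2 * r).
        by rewrite divr_ge0 ?mulr_ge0 ?(ltW r0)//; lra.
      have /andP[j1 j2] := truncn_itv u0.
      have jk : (Num.truncn ((u - c + k%:R * r) / (2 * r)) < k)%N.
        rewrite -(ltr_nat R); apply: (le_lt_trans j1).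
        by rewrite ltr_pdivrMr ?mulr_gt0//; lra.
      exists (Ordinal jk) => /=; move: j1 j2; set j := Num.truncn _.
      rewrite ler_pdivlMr ?mulr_gt0// ltr_pdivrMr ?mulr_gt0// -natr1.
      by move=> j1 j2; rewrite ler_distl; apply/andP; split; lra.
    have jk : (k.-1 < k)%N by rewrite prednK.
    exists (Ordinal jk) => /=; rewrite ler_distl.
    have -> : k.-1%:R = k%:R - 1 :> R by rewrite -[in RHS](prednK k0) -natr1 addrK.
    by apply/andP; split; lra.
  pose f := [ffun a => sval (cid (jP a))].
  pose u := 2 * (t - s) / d.
  have u0 : 0 <= u by rewrite divr_ge0 ?mulr_ge0 ?(ltW d0)//; lra.
  have /andP[m1 m2] := truncn_itv u0.
  have mM : (Num.truncn u < M)%N.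
    rewrite ltnS; apply: le_truncn; rewrite ler_pdivrMr// /d.
    have : (1 - g) * L `^ p = k%:R `^ p * ((1 - g) * r `^ p) by rewrite Lpr; ring.
    by lra.
  exists (f, Ordinal mM); first by rewrite mem_enum.
  split => /=.
    by move=> a; rewrite !mxE ffunE/=; case: (cid (jP a)).
  rewrite in_itv/= /st/= -/d.
  move: m1 m2; rewrite /u ler_pdivlMr// ltr_pdivrMr// -[(Num.truncn _).+1%:R]natr1.
  move: (Num.truncn _)%:R => m m1 m2.
  by apply/andP; split; lra.
have V0 := boxvol_gt0 L0; have v0 := boxvol_gt0 r0.
have vV : boxvol r <= boxvol L.
  have rL : r <= L by rewrite Lr ler_peMl// ltW.
  rewrite /boxvol ler_pM ?exprn_ge0 ?mulr_ge0 ?powR_ge0 ?(ltW r0)//; first by lra.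
    by apply: lerXn2r; rewrite ?nnegrE ?mulr_ge0 ?(ltW r0) ?(ltW L0)// ler_pM2l.
  rewrite ler_pM2l; last by lra.
  by apply: ge0_ler_powR; rewrite ?nnegrE// ltW.
have [q Hq] : exists q : I, #|I|%:R^-1 * lam * boxvol r <= mass w (box (ctr q) (st q) r).
  apply: contrapT => /forallNP H.
  have := mass_cover hw (bmeas_box x s L) (fun q _ => bmeas_box (ctr q) (st q) r) cover.
  apply/negP; rewrite -ltNge.
  have [q0 _] : exists q0 : I, q0 \in I by apply/card_gt0P.
  have : \sum_(q <- enum I) mass w (box (ctr q) (st q) r) <
      \sum_(q <- enum I) #|I|%:R^-1 * lam * boxvol r.
    rewrite !big_enum/=; apply: ltr_sum.
      by apply/hasP; exists q0 => //; rewrite mem_index_enum.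
    by move=> q _; have /negP := H q; rewrite -ltNge.
  move=> /lt_le_trans; apply.
  rewrite big_enum/= sumr_const -mulr_natl [X in X <= _](_ : _ = lam * boxvol r).
    by rewrite (le_trans _ big)// ler_pM2l.
  by field; rewrite gt_eqF.
exists (ctr q), (st q); split => //.
  move=> a; rewrite !mxE addrAC subrr add0r normrM (gtr0_norm r0) Lr ler_pM2r//.
  have : (q.1 a)%:R + 1 <= k%:R :> R by rewrite natr1 ler_nat ltn_ord.
  by apply: norm_center_le.
have q2 : (q.2%:R : R) <= 2 * k%:R `^ p.
  have : (q.2 <= Num.truncn (2 * k%:R `^ p))%N by rewrite -ltnS ltn_ord.
  rewrite -(ler_nat R) => /le_trans; apply.
  have kp0 : 0 <= 2 * k%:R `^ p by rewrite mulr_ge0// powR_ge0.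
  by have /andP[] := truncn_itv kp0.
have q20 : 0 <= (q.2%:R : R) by [].
have : (q.2%:R : R) * d <= 2 * k%:R `^ p * d by rewrite ler_pM2r.
have : k%:R `^ p * d <= k%:R `^ p * r `^ p by rewrite ler_wpM2l// powR_ge0.
have : 0 <= (q.2%:R : R) * d by rewrite mulr_ge0// ltW.
rewrite /st Lpr -(mulrA 2); move=> A1 A2 A3; exact: start_range A1 A2 A3.
Qed.

End chain.
End Chain.

Lemma descent_times (R : realFieldType) (A s s' a b : R) :
  0 <= A / 2 - 4 -> 0 < b <= a / 2 ->
  s - (A / 2 + 3) * a <= s' <= s + 2 * a ->
  s - A * a + a + (A / 2 - 4) * b <= s' <= s - A * a + (A + 2) * a.
Proof.
move=> A0 /andP[b0 ba] /andP[s1 s2].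
have : (A / 2 - 4) * b <= (A / 2 - 4) * a by rewrite ler_wpM2l//; lra.
by move=> H; apply/andP; split; lra.
Qed.

Lemma descent_space (R : realFieldType) (K l v : R) : 0 < l ->
  6 <= K -> v <= 2 * l -> v + l <= K * (l / 2).
Proof.
move=> l0 K6 vl.
have : 6 * (l / 2) <= K * (l / 2) by rewrite ler_pM2r// divr_gt0.
by lra.
Qed.

Lemma entrance_space (R : realFieldType) (k L v kappa g K : R) : 0 < k -> 0 < L ->
  k * 6 <= K * (kappa * g) -> v <= 2 * L -> v + L <= kappa * (g / 2 * K) * (L / k).
Proof.
move=> k0 L0 H vL.
have : k * 6 * (L / k) <= K * (kappa * g) * (L / k) by rewrite ler_pM2r// divr_gt0.
have -> : k * 6 * (L / k) = 6 * L by field; rewrite gt_eqF.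
by lra.
Qed.

Section Descend.
Context {R : realType} {n : nat}.
Local Notation ST := (spacetime R n).
Context (p g : R) (hp : 1 < p) (hg : 0 < g < 1).
Context (w : ST -> R) (hw : weight w).
Context (beta alpha : R).
Hypotheses (beta0 : 0 < beta) (beta1 : beta <= 1) (alpha01 : 0 <= alpha < 1).
Hypothesis decay : sublevel_decay p g w beta alpha.
Local Notation box := (@box R n p g).
Local Notation boxvol := (@boxvol R n p g).
Local Notation mass := (mass w).
Implicit Types (x : 'rV[R]_n) (s L lam l : R).

Lemma reach : exists D0 kappa : R, [/\ 0 < D0, 0 < kappa &
  forall (k : nat) (M : R), (0 < k)%N -> exists2 c : R, 0 < c <= 1 &
  forall x s L lam x' s' D1, 0 < L -> 0 < lam ->
  lam * boxvol L <= mass (box x s L) -> D0 <= D1 ->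
  s + L `^ p + D1 * (L / k%:R) `^ p <= s' <= s + M * (L / k%:R) `^ p ->
  (forall a, `|x' ord0 a - x ord0 a| + L <= kappa * D1 * (L / k%:R)) ->
  c * lam * boxvol (L / k%:R) <= mass (box x' s' (L / k%:R))].
Proof.
have [D0 [kappa [D00 kappa0 H]]] := reach_same hg hw beta0 beta1 alpha01 decay.
exists D0, kappa; split => // k M k0.
have [c1 /andP[c10 c11] H1] := pigeonhole (n := n) hp hg hw k0.
have [c2 /andP[c20 c21] H2] := H (M + 1).
exists (c2 * c1); first by rewrite mulr_gt0// mulr_ile1// ltW.
move=> x s L lam x' s' D1 L0 lam0 big DD /andP[s1 s2] xx.
have [x1 [t1 [xx1 /andP[tt1 tt2] big1]]] := H1 _ _ _ _ L0 lam0 big.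
set r := L / k%:R in s1 s2 xx tt1 big1 *.
have r0 : 0 < r by rewrite divr_gt0// ltr0n.
have rp0 : 0 < r `^ p by rewrite powR_gt0.
pose D := (s' - t1) / r `^ p.
have sD : s' = t1 + D * r `^ p by rewrite /D; field; rewrite gt_eqF.
have /andP[DD1 DM] : D1 <= D <= M + 1.
  rewrite /D ler_pdivlMr// ler_pdivrMr//.
  by apply: (elapsed_time_bounds (s := s) (a := L `^ p)); apply/andP.
rewrite sD -(mulrA c2).
apply: (H2 x1 t1 x' r (c1 * lam) D r0 _ big1); [by rewrite mulr_gt0|by rewrite (le_trans DD)|].
move=> a; apply: le_trans (ler_distD (x ord0 a) _ _) _.
rewrite [X in _ + X]distrC; apply: le_trans (_ : kappa * D1 * r <= _); last first.
  by rewrite ler_pM2r// ler_pM2l.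
by apply: le_trans (xx a); rewrite lerD2l.
Qed.

(** A box of side l in the past, at distance A l^p, passes its average on to
    all boxes of half the side near x that are not too far in the past. *)
Definition descends (A c : R) := forall x s l lam x' s', 0 < l -> 0 < lam ->
  lam * boxvol l <= mass (box x (s - A * l `^ p) l) ->
  (forall a, `|x' ord0 a - x ord0 a| <= 2 * l) ->
  s - (A / 2 + 3) * l `^ p <= s' <= s + 2 * l `^ p ->
  c * lam * boxvol (l / 2) <= mass (box x' s' (l / 2)).

(** The lower part of a rectangle passes its average on to all boxes of side
    L / k near the upper part, from the time g L^p / 2 after the centre on. *)
Definition enters (k : nat) (c : R) := forall x s L lam x' s', 0 < L -> 0 < lam ->
  lam * boxvol L <= mass (box x s L) ->
  (forall a, `|x' ord0 a - x ord0 a| <= 2 * L) ->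
  s + L `^ p + g / 2 * L `^ p <= s' <= s + 3 * L `^ p ->
  c * lam * boxvol (L / k%:R) <= mass (box x' s' (L / k%:R)).

Lemma half_powR l : 0 < l -> 0 < (l / 2) `^ p <= l `^ p / 2.
Proof.
move=> l0; rewrite powR_gt0 ?divr_gt0//=.
rewrite powRM ?invr_ge0 ?(ltW l0)// ler_pM2l ?powR_gt0//.
rewrite -powR_inv1// -powRrM mulN1r.
by rewrite ler_powR ?ler1n// lerN2 ltW.
Qed.

(** The larger A is, the more time there is to reach the neighbours, while the
    distance to them stays comparable to l. *)
Lemma descends_exists : exists A0 : R, forall A, A0 <= A ->
  exists2 c : R, 0 < c <= 1 & descends A c.
Proof.
have [D0 [kappa [D00 kappa0 H]]] := reach.
exists (2 * (4 + D0 + 6 / kappa)) => A AA.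
have k6 : 0 < 6 / kappa by rewrite divr_gt0.
have D0A : D0 <= A / 2 - 4 by lra.
have A4 : 6 / kappa <= A / 2 - 4 by lra.
have [c c01 {}H] := H 2 ((A + 2) * 2 `^ p) isT.
exists c; first exact: c01.
move=> x s l lam x' s' l0 lam0 big xx ss.
have hr := half_powR l0; have /andP[r0 _] := hr.
have lr : l `^ p = 2 `^ p * (l / 2) `^ p.
  by rewrite -powRM// ?divr_ge0 ?(ltW l0)//; congr (_ `^ _); field.
apply: (H x (s - A * l `^ p) l lam x' s' (A / 2 - 4)) => //.
  rewrite -mulrA -lr.
  exact: (descent_times (ltW (lt_le_trans D00 D0A)) hr).
move=> a; have : 6 <= kappa * (A / 2 - 4) by rewrite mulrC -ler_pdivrMr.
by move=> K; exact: (descent_space l0 K (xx a)).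
Qed.

(** In the time g L^p / 2 a chain of boxes of side L / k has about g k^p steps
    and covers a distance about g k^p (L / k). This is a multiple of L when
    g k^(p - 1) is large, which is possible as p > 1. *)
Lemma enters_exists (C : R) : exists2 k : nat, [/\ (2 <= k)%N & C <= k%:R `^ p] &
  exists2 c : R, 0 < c <= 1 & enters k c.
Proof.
have [D0 [kappa [D00 kappa0 H]]] := reach.
have [g0 g1] := andP hg.
have p1 : 0 < p - 1 by rewrite subr_gt0.
(* exceeds each of the thresholds below, and is positive *)
pose C' := 1 + `|C| + 2 * D0 / g + 6 / (kappa * g).
have h1 : 0 < 2 * D0 / g by rewrite !divr_gt0// mulr_gt0.
have h2 : 0 < 6 / (kappa * g) by rewrite divr_gt0// mulr_gt0.
have nC := normr_ge0 C; have CC := ler_norm C.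
have [C'0 C'1 C'2 C'3] : [/\ 0 < C', C <= C', 2 * D0 / g <= C' & 6 / (kappa * g) <= C'].
  by rewrite /C'; move: (2 * D0 / g) (6 / (kappa * g)) h1 h2 => *; split; lra.
clearbody C'.
pose k := (Num.truncn (C' `^ (p - 1)^-1)).+2.
have k0 : 0 < k%:R :> R by rewrite ltr0n.
have kC : C' <= k%:R `^ (p - 1).
  have : C' `^ (p - 1)^-1 <= k%:R.
    apply: ltW; apply: (lt_trans (truncnS_gt _)); rewrite ltr_nat.
    exact: ltnSn.
  have CE : (C' `^ (p - 1)^-1) `^ (p - 1) = C'.
    by rewrite -powRrM mulVf ?gt_eqF// powRr1// ltW.
  move=> kC; rewrite -[X in X <= _]CE.
  by apply: ge0_ler_powR; rewrite ?nnegrE ?powR_ge0 ?ler0n// ltW.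
have kp : k%:R `^ p = k%:R * k%:R `^ (p - 1).
  rewrite -[X in X * _]powRr1 ?ltW// -powRD; last by apply/implyP => _; rewrite gt_eqF.
  by congr (_ `^ _); ring.
have k1 : 1 <= k%:R :> R by rewrite ler1n.
have kpC : k%:R * C' <= k%:R `^ p by rewrite kp ler_pM2l.
have C'k : C' <= k%:R `^ p by rewrite (le_trans _ kpC)// ler_peMl// ltW.
exists k; first by split => //; rewrite (le_trans _ C'k).
have [c c01 {}H] := H k (3 * k%:R `^ p) isT.
exists c; first exact: c01.
move=> x s L lam x' s' L0 lam0 big xx ss.
have r0 : 0 < L / k%:R by rewrite divr_gt0.
have Lp : L `^ p = k%:R `^ p * (L / k%:R) `^ p.
  by rewrite -powRM ?(ltW r0)//; congr (_ `^ _); field; rewrite gt_eqF.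
apply: (H x s L lam x' s' (g / 2 * k%:R `^ p)) => //.
- have : 2 * D0 / g <= k%:R `^ p by rewrite (le_trans _ C'k).
  by rewrite ler_pdivrMr//; move: (k%:R `^ p) => K HK; lra.
- by rewrite -(mulrA (g / 2)) -(mulrA 3) -Lp.
move=> a; apply: (@entrance_space _ k%:R) => //.
have : k%:R * (6 / (kappa * g)) <= k%:R `^ p by rewrite (le_trans _ kpC)// ler_pM2l.
by rewrite mulrA ler_pdivrMr ?mulr_gt0.
Qed.

End Descend.

(** * A Vitali selection *)

Section Vitali.
Context {R : realType} {n : nat}.
Local Notation ST := (spacetime R n).

(** Select a largest Q (least rank). The S of all sets Q that meet it lie in
    its dilation W and are disjoint, hence their total volume is at most
    C |Q|; the remaining Q avoid it, and the argument is repeated in the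
    complement. *)
Lemma vitali_sum (I : eqType) (rank : I -> nat) (S Q W : I -> set ST) (C : R)
  (s : seq I) (A : set ST) : 0 <= C -> uniq s ->
  (forall i, i \in s -> bmeas (S i)) -> (forall i, i \in s -> bmeas (Q i)) ->
  (forall i, i \in s -> bmeas (W i)) -> bmeas A ->
  (forall i j z, i \in s -> j \in s -> S i z -> S j z -> i = j) ->
  (forall i, i \in s -> Q i `<=` A) ->
  (forall i, i \in s -> S i `<=` W i) ->
  (forall i j, i \in s -> j \in s -> (rank i <= rank j)%N ->
     Q i `&` Q j !=set0 -> S j `<=` W i) ->
  (forall i, i \in s -> vol (W i) <= C * vol (Q i)) ->
  \sum_(i <- s) vol (S i) <= C * vol A.
Proof.
move=> C0; have [m] := ubnP (size s); elim: m s A => // m IH s A sm us.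
move=> bS bQ bW bA tS QA SW QW WC.
have [->|s0] := eqVneq s [::]; first by rewrite big_nil mulr_ge0// vol_ge0.
have [i0 i0s i0min] : exists2 i0, i0 \in s & forall j, j \in s -> (rank i0 <= rank j)%N.
  have ex : exists r, r \in map rank s.
    by case: (s) s0 => // a l _; exists (rank a); rewrite mem_head.
  case: (ex_minnP ex) => r /mapP[i0 i0s ->] rmin.
  by exists i0 => // j js; apply: rmin; apply: map_f.
(* j = i0 is listed apart since Q i0 may be empty *)
pose near_i0 j := (j == i0) || `[< Q i0 `&` Q j !=set0 >].
rewrite (bigID near_i0)/= -big_filter -[X in _ + X]big_filter.
have bQ0 := bQ _ i0s; have mQ0 : measurable (Q i0) by case: bQ0.
have mf (P : pred I) j : j \in [seq k <- s | P k] -> j \in s by rewrite mem_filter => /andP[].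
have first_part : \sum_(i <- [seq i <- s | near_i0 i]) vol (S i) <= C * vol (Q i0).
  apply: le_trans (WC _ i0s); apply: sum_vol_le.
  - exact: bW.
  - exact: filter_uniq.
  - by move=> j /mf /bS[].
  - move=> j; rewrite mem_filter => /andP[/orP[/eqP->|/asboolP ne] js]; first exact: SW.
    by apply: QW => //; exact: i0min.
  - by move=> i j z /mf iss /mf js; exact: tS.
have AE : A `&` Q i0 = Q i0 by apply/setIidPr; exact: QA.
rewrite (vol_setID bA mQ0) AE mulrDr lerD//.
apply: IH.
- rewrite size_filter -ltnS; apply: leq_trans sm; rewrite ltnS.
  rewrite -(count_predC near_i0 s) -add1n leq_add2r -has_count.
  by apply/hasP; exists i0 => //; rewrite /near_i0 eqxx.
- exact: filter_uniq.
- by move=> i /mf; exact: bS.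
- by move=> i /mf; exact: bQ.
- by move=> i /mf; exact: bW.
- exact: bmeasD.
- by move=> i j z /mf iss /mf js; exact: tS.
- move=> j; rewrite mem_filter => /andP[nj js] z Qz; split; first exact: QA Qz.
  move=> Q0z; move: nj; rewrite /near_i0 negb_or => /andP[_ /asboolP]; apply.
  by exists z.
- by move=> i /mf; exact: SW.
- by move=> i j /mf iss /mf js; exact: QW.
- by move=> i /mf; exact: WC.
Qed.

End Vitali.

(** * The stopping-time argument *)

Section StoppingArithmetic.
Context {R : realFieldType}.
Implicit Types (A a b g s t z : R).

Lemma child_times A b s s1 z a a1 tk tk1 : 0 <= b <= A + 4 -> 0 < a1 <= a / 2 ->
  s <= z < s + tk -> s1 <= z < s1 + tk1 -> tk <= 2 * a -> tk1 <= 2 * a1 ->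
  s - (A / 2 + 3) * a <= s1 - b * a1 <= s + 2 * a.
Proof.
move=> /andP[b0 bA] /andP[a10 a1a] /andP[sz zs] /andP[s1z zs1] tka tka1.
have H1 : b * a1 <= (A + 4) * (a / 2) by rewrite ler_pM// ltW.
have H2 : 0 <= b * a1 by rewrite mulr_ge0// ltW.
by apply/andP; split; lra.
Qed.

Lemma top_times A g s0 Lp lp st z tk : 0 < g < 1 -> 0 < lp -> 0 <= A -> 0 < Lp ->
  (A + 6) * lp <= g / 2 * Lp ->
  s0 + (1 + g) * Lp < z < s0 + (1 + g) * Lp + (1 - g) * Lp ->
  st <= z < st + tk -> tk <= 2 * lp ->
  s0 + Lp + g / 2 * Lp <= st - A * lp <= s0 + 3 * Lp.
Proof.
move=> /andP[g0 g1] lp0 A0 Lp0 AL /andP[z1 z2] /andP[z3 z4] tl.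
have : 0 <= A * lp by rewrite mulr_ge0// ltW.
by move=> *; apply/andP; split; lra.
Qed.

Lemma inner_times A g a b s : 0 < g < 1 -> 0 <= A -> 0 < a <= b / 2 ->
  s - (A / 2 + 3) * b <= s - (1 + g) * a <= s + 2 * b.
Proof.
move=> /andP[g0 g1] A0 /andP[a0 ab].
have H1 : 0 < g * a by rewrite mulr_gt0.
have H2 : g * a <= a by rewrite ler_piMl// ltW.
have H3 : 0 <= A * b by rewrite mulr_ge0//; lra.
by apply/andP; split; lra.
Qed.

Lemma density_combine (x x1 x2 y y2 v al c : R) : x = x1 + x2 -> y = v + y2 ->
  x1 <= al * v -> x2 <= y2 -> c * y <= (1 - al) * v -> x <= (1 - c) * y.
Proof. by lra. Qed.

Lemma annulus_combine (V x x1 x2 y al : R) : V = x + y -> x = x1 + x2 ->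
  x1 <= al * V -> y <= (1 - al) / 2 * V -> (1 - al) / 2 * V <= x2.
Proof. by lra. Qed.

Lemma cover_box_range A g c : 0 < g < 1 -> 0 <= c -> 1 + 2 * c <= A ->
  0 <= 1 + (1 + g) * c <= A + 4.
Proof.
move=> /andP[g0 g1] c0 cA; have : 0 <= g * c by rewrite mulr_ge0// ltW.
have : g * c <= c by rewrite ler_piMl// ltW.
by move=> *; apply/andP; split; lra.
Qed.

Lemma mem_wider_time (a c d t k : R) : 0 < d -> a <= t < a + k -> k <= 2 * d ->
  4 <= c -> a - d < t < a - d + c * d.
Proof.
move=> d0 /andP[a1 a2] kd c4; have : 4 * d <= c * d by rewrite ler_pM2r.
by move=> *; apply/andP; split; lra.
Qed.

Lemma prism_time_in_range A g a s z s0 Lp k : 0 < g < 1 -> 0 <= A -> 0 < a ->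
  (A + 6) * a <= g / 2 * Lp -> s <= z < s + k -> k <= 2 * a -> 0 < Lp ->
  s0 + (1 + g) * Lp < z < s0 + (1 + g) * Lp + (1 - g) * Lp ->
  s0 <= s - (A + (1 + g)) * a /\ s - (A + (1 + g)) * a + (1 - g) * a <= s0 + 2 * Lp.
Proof.
move=> /andP[g0 g1] A0 a0 H /andP[s1 s2] k2 Lp0 /andP[z1 z2].
have H1 : 0 < g * a by rewrite mulr_gt0.
have H2 : 0 <= A * a by rewrite mulr_ge0// ltW.
have H3 : g * a <= a by rewrite ler_piMl// ltW.
have H4 : 0 < g * Lp by rewrite mulr_gt0.
by split; lra.
Qed.

Lemma overlap_times A g a b s t z y k : 0 < g < 1 -> 0 <= A -> 0 < b <= a ->
  s - (A + (1 + g)) * a < z < s - (A + (1 + g)) * a + (1 - g) * a ->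
  t - (A + (1 + g)) * b < z < t - (A + (1 + g)) * b + (1 - g) * b ->
  t <= y < t + k -> k <= 2 * b ->
  s - (A + 3) * a < y < s + (A + 4) * a.
Proof.
move=> /andP[g0 g1] A0 /andP[b0 ba] /andP[z1 z2] /andP[z3 z4] /andP[y1 y2] kb.
have a0 : 0 < a by lra.
have H1 : g * a <= a by rewrite ler_piMl// ltW.
have H2 : 0 <= A * a by rewrite mulr_ge0// ltW.
have H3 : A * b <= A * a by rewrite ler_wpM2l.
have H4 : g * b <= b by rewrite ler_piMl// ltW.
have H5 : 0 <= A * b by rewrite mulr_ge0// ltW.
have H6 : 0 < g * b by rewrite mulr_gt0.
have H7 : 0 < g * a by rewrite mulr_gt0.
by apply/andP; split; lra.
Qed.

Lemma own_times A a s y k : 0 <= A -> 0 < a -> s <= y < s + k -> k <= 2 * a ->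
  s - (A + 3) * a < y < s + (A + 4) * a.
Proof.
move=> A0 a0 /andP[y1 y2] ka; have : 0 <= A * a by rewrite mulr_ge0// ltW.
by move=> *; apply/andP; split; lra.
Qed.

Lemma two_steps (x c z a L : R) : `|z - c| <= a -> `|z - x| <= L -> a <= L / 2 ->
  `|c - x| + a <= 2 * L.
Proof.
by move=> H1 H2 H3; have := ler_distD z c x; rewrite (distrC c z); lra.
Qed.

Lemma three_steps (y c z d a b : R) : `|y - c| <= b -> `|z - c| <= b ->
  `|z - d| <= a -> b <= a -> `|y - d| <= 4 * a.
Proof.
move=> H1 H2 H3 H4; have := ler_distD c y d; have := ler_distD z c d.
by rewrite (distrC c z); have := normr_ge0 (z - d); lra.
Qed.

Lemma detour (z c y x a L : R) : `|z - c| <= a -> `|y - c| <= a ->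
  `|y - x| <= L -> `|z - x| <= L + 2 * a.
Proof.
move=> H1 H2 H3; have := ler_distD c z x; have := ler_distD y c x.
by rewrite (distrC c y); lra.
Qed.

Lemma detour_time (c k y z u v : R) : c <= y < c + k -> c <= z < c + k ->
  u < y < v -> u - 2 * k < z < v + 2 * k.
Proof.
by move=> /andP[? ?] /andP[? ?] /andP[? ?]; apply/andP; split; lra.
Qed.

End StoppingArithmetic.

Section Stopping.
Context {R : realType} {n : nat}.
Local Notation ST := (spacetime R n).
Context (p g : R) (hp : 1 < p) (hg : 0 < g < 1).
Context (w : ST -> R) (hw : weight w).
Context (beta alpha : R).
Hypotheses (beta0 : 0 < beta) (alpha01 : 0 <= alpha < 1).
Hypothesis decay : sublevel_decay p g w beta alpha.
Local Notation box := (@box R n p g).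
Local Notation boxvol := (@boxvol R n p g).
Local Notation lag := (time_lag p g).
Local Notation mass := (mass w).

Let p0 : 0 < p. Proof. exact: lt_trans hp. Qed.

(** The contrapositive turns small mass on an upper box into small mass on the
    lower one: it is used for a bad cell, whose past then has an upper bound. *)
Lemma upper_mass (x : 'rV[R]_n) (s L lam : R) : 0 < L -> 0 < lam ->
  lam * boxvol L <= mass (box x s L) ->
  beta * (1 - alpha) * lam * boxvol L <= mass (box x (s + lag L) L).
Proof.
move=> L0 lam0 big; have low := decay L0 lam0 big.
have mlt := measurable_lt hw (beta * lam).
have bU := bmeas_box p g x (s + lag L) L.
have := vol_setID bU mlt; rewrite (vol_box p hg x _ L0) => volD.
have bl0 : 0 <= beta * lam by rewrite mulr_ge0 ?ltW.
have bD := bmeasD bU mlt.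
apply: (@le_trans _ _ (mass (box x (s + lag L) L `\` [set z | w z < beta * lam]))); last first.
  by apply: le_mass => // z [].
apply: (@le_trans _ _ (beta * lam * vol (box x (s + lag L) L `\` [set z | w z < beta * lam]))).
  have -> : beta * (1 - alpha) * lam * boxvol L = beta * lam * ((1 - alpha) * boxvol L) by ring.
  by apply: ler_wpM2l => //; rewrite mulrBl mul1r {1}volD lerBlDl lerD2r.
by apply: ge_mass_vol => // z [_] /= /negP; rewrite -leNgt.
Qed.

Context (A cG cT : R) (k K : nat).
Hypotheses (A0 : 0 <= A) (AK : 1 + 2 * K%:R `^ p <= A) (K1 : (1 <= K)%N)
  (Kg : 4 <= (1 - g) * K%:R `^ p).
Hypotheses (cG01 : 0 < cG <= 1) (hG : descends p g w A cG).
Hypothesis hT : enters p g w k cT.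
Hypotheses (k2 : (2 <= k)%N) (kA : A + 6 <= g / 2 * k%:R `^ p).
Context (x0 : 'rV[R]_n) (s0 L lam0 : R) (L0 : 0 < L) (lam0_gt0 : 0 < lam0).
Hypothesis big0 : lam0 * boxvol L <= mass (box x0 s0 L).

Let l0 : R := L / k%:R.
Let tau0 : R := l0 `^ p.
Let e (i : nat) : nat := Num.truncn (i%:R * p).
Local Notation side := (halfside l0).
Local Notation tik := (tick tau0 e).
Local Notation adr := (@address R n l0 tau0 e).
Local Notation ctr := (@center R n l0).
Local Notation st := (@start R n tau0 e).
Local Notation cel := (cell adr).

Let k0 : 0 < k%:R :> R.
Proof. by rewrite ltr0n (leq_trans _ k2). Qed.

Let l0_gt0 : 0 < l0.
Proof. by rewrite divr_gt0. Qed.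

Let tau0_gt0 : 0 < tau0.
Proof. by rewrite powR_gt0. Qed.

Let e_mono i j : (i <= j)%N -> (e i <= e j)%N.
Proof. by move=> ij; apply: le_truncn; rewrite ler_pM2r// ler_nat. Qed.

Let e_ge i : (i <= e i)%N.
Proof.
rewrite /e -[X in (X <= _)%N](@natrK R); apply: le_truncn.
by rewrite ler_peMr// ltW.
Qed.

Let side_gt0 i : 0 < side i. Proof. exact: halfside_gt0. Qed.

Let sidep_gt0 i : 0 < side i `^ p. Proof. by rewrite powR_gt0. Qed.

Let sideS i : side i.+1 = side i / 2.
Proof. by rewrite /halfside exprSr invfM mulrA. Qed.

Let side_half i : 0 < side i.+1 `^ p <= side i `^ p / 2.
Proof. by rewrite sideS; exact: half_powR. Qed.

Let side_le i : side i <= l0.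
Proof. by rewrite /halfside ler_pdivrMr ?exprn_gt0// ler_peMr ?(ltW l0_gt0)// exprn_ege1// ler1n. Qed.

Let side_nonincr i j : (i <= j)%N -> side j <= side i.
Proof.
move=> ij; rewrite /halfside ler_pM2l// lef_pV2 ?posrE ?exprn_gt0//.
by apply: ler_weXn2l => //; rewrite ler1n.
Qed.

Let tick_bounds i : side i `^ p <= tik i <= 2 * side i `^ p.
Proof.
have E : side i `^ p = tau0 / 2 `^ (i%:R * p).
  rewrite /halfside powRM ?invr_ge0 ?exprn_ge0 ?(ltW l0_gt0)//.
  by rewrite -powR_inv1 ?exprn_ge0// -powR_mulrn// -!powRrM mulN1r mulrN powRN.
have ip0 : 0 <= i%:R * p by rewrite mulr_ge0// ltW.
have /andP[e1 e2] := truncn_itv ip0.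
rewrite E /tick -!powR_mulrn//; apply/andP; split.
  rewrite ler_pM2l// lef_pV2 ?posrE ?powR_gt0//.
  by apply: ler_powR => //; rewrite ler1n.
rewrite mulrCA ler_pM2l// -[X in _ <= X * _]invrK -invfM lef_pV2 ?posrE ?mulr_gt0 ?powR_gt0//.
rewrite -powR_inv1// -powRD; last by rewrite pnatr_eq0 implybT.
apply: ler_powR; first by rewrite ler1n.
by rewrite addrC lerBlDr natr1 ltW.
Qed.

(** The distance A in time lets the mass of the parent's test box descend to
    the test box of the cell and to the boxes around it. *)
Definition test_box (q : nat * ('rV[int]_n * int)) : set ST :=
  box (ctr q.1 q.2) (st q.1 q.2 - A * side q.1 `^ p) (side q.1).

Definition good (lam : R) (q : nat * ('rV[int]_n * int)) : Prop :=
  lam * boxvol (side q.1) <= mass (test_box q).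

Let dist_ctr i (z : ST) a : `|ctr i.+1 (adr i.+1 z) ord0 a - ctr i (adr i z) ord0 a| <= 2 * side i.
Proof.
apply: le_trans (ler_distD (z.1 ord0 a) _ _) _.
have -> : 2 * side i = side i + side i by ring.
apply: lerD; last exact: address_center.
rewrite distrC; apply: (@le_trans _ _ (side i.+1)); first exact: address_center.
exact: side_nonincr.
Qed.

Lemma child_mass lam i (z : ST) b : 0 < lam -> good lam (i, adr i z) -> 0 <= b <= A + 4 ->
  cG * lam * boxvol (side i.+1) <=
  mass (box (ctr i.+1 (adr i.+1 z)) (st i.+1 (adr i.+1 z) - b * side i.+1 `^ p) (side i.+1)).
Proof.
move=> lam_gt0 gd bA; rewrite [X in boxvol X]sideS [X in box _ _ X]sideS.
apply: (hG (side_gt0 i) lam_gt0 gd); first exact: dist_ctr.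
have /andP[_ t1] := tick_bounds i; have /andP[_ t2] := tick_bounds i.+1.
exact: (child_times bA (side_half i) (address_start e l0_gt0 tau0_gt0 i z)
  (address_start e l0_gt0 tau0_gt0 i.+1 z) t1 t2).
Qed.

Lemma top_good lam (z : ST) : 0 < lam <= cT * lam0 ->
  box x0 (s0 + lag L) L z -> good lam (0%N, adr 0 z).
Proof.
move=> /andP[lam_gt0 lamT] [Hz]; rewrite /= in_itv/= => zt.
rewrite /good /test_box /=.
have s00 : side 0 = L / k%:R by rewrite /halfside expr0 divr1.
rewrite s00; apply: (@le_trans _ _ (cT * lam0 * boxvol (L / k%:R))).
  by rewrite ler_pM2r// boxvol_gt0.
apply: (hT L0 lam0_gt0 big0).
  move=> a; apply: le_trans (ler_distD (z.1 ord0 a) _ _) _.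
  have -> : 2 * L = L + L by ring.
  apply: lerD; last exact: Hz.
  rewrite distrC; apply: (@le_trans _ _ (side 0)); first exact: address_center.
  rewrite s00 ler_pdivrMr// ler_peMr ?(ltW L0)// ler1n.
  exact: ltnW.
have /andP[_ t1] := tick_bounds 0; rewrite s00 in t1.
have Lp : L `^ p = k%:R `^ p * (L / k%:R) `^ p.
  by rewrite -powRM ?(ltW l0_gt0) ?(ltW k0)//; congr (_ `^ _); field; rewrite gt_eqF.
apply: (top_times hg _ A0 _ _ zt (address_start e l0_gt0 tau0_gt0 0 z) t1); rewrite ?powR_gt0//.
by rewrite Lp mulrA ler_pM2r// powR_gt0.
Qed.

Let scale : R := 2 ^+ n * 2 `^ p.

Let scale_gt0 : 0 < scale.
Proof. by rewrite mulr_gt0 ?exprn_gt0 ?powR_gt0. Qed.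

Let g1 : 0 < 1 - g. Proof. by rewrite subr_gt0; case/andP: hg. Qed.

Lemma boxvol_scale (c l : R) : 0 <= c -> 0 <= l ->
  boxvol (c * l) = c ^+ n * c `^ p * boxvol l.
Proof.
move=> c0 l0'; rewrite /boxvol powRM//.
have -> : 2 * (c * l) = c * (2 * l) by ring.
by rewrite exprMn; ring.
Qed.

Let boxvol_side i : boxvol (side i) = scale * boxvol (side i.+1).
Proof.
have -> : side i = 2 * side i.+1 by rewrite sideS; field.
by rewrite boxvol_scale// ltW.
Qed.

Let inner i q := box (ctr i q) (st i q) (side i.+1).

Let inner_subset i q : inner i q `<=` cel i q.
Proof.
apply: prism_subset_cell => //.
- by rewrite sideS ltr_pdivrMr// ltr_pMr// ltr1n.
- have /andP[_ h1] := side_half i; have /andP[h2 _] := tick_bounds i.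
  have h3 : (1 - g) * side i.+1 `^ p <= side i.+1 `^ p.
    by rewrite ler_piMl ?ltW//; case/andP: hg => ? ?; rewrite gtrBl.
  rewrite lerD2l (le_trans h3)// (le_trans h1)// (le_trans _ h2)//.
  by rewrite ler_pdivrMr// ler_peMr ?ler1n// ltW.
Qed.

Let cell_bmeas i q : bmeas (cel i q).
Proof. exact: bmeas_cell. Qed.

Let boxvol_le_cell i q : boxvol (side i.+1) <= vol (cel i q).
Proof.
rewrite -(vol_box p hg (ctr i q) (st i q) (side_gt0 i.+1)).
by apply: le_vol; [exact: bmeas_box|exact: cell_bmeas|exact: inner_subset].
Qed.

Let cell_le_boxvol i q : vol (cel i q) <= 4 / (1 - g) * boxvol (side i).
Proof.
have /andP[t1 t2] := tick_bounds i.
have t0 : 0 < tik i by exact: tick_gt0.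
apply: (@le_trans _ _ (vol (prism (ctr i q) (side i) (st i q - tik i) (st i q + tik i)))).
  apply: le_vol; [exact: cell_bmeas|exact: bmeas_prism|].
  exact: cell_subset_prism.
rewrite vol_prism; [|exact: ltW|]; last first.
  by rewrite ltW// ltrBlDr -addrA ltrDl addr_gt0.
have -> : 4 / (1 - g) * boxvol (side i) = (2 * side i) ^+ n * (4 * side i `^ p).
  by rewrite /boxvol; field; rewrite gt_eqF.
apply: ler_wpM2l; first by rewrite exprn_ge0// mulr_ge0// ltW.
have -> : st i q + tik i - (st i q - tik i) = 2 * tik i by ring.
have -> : 4 * side i `^ p = 2 * (2 * side i `^ p) by ring.
by rewrite ler_pM2l.
Qed.

Let c1 : R := (1 - alpha) * (1 - g) / (4 * scale).

Let alpha1 : 0 < 1 - alpha.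
Proof. by rewrite subr_gt0; case/andP: alpha01. Qed.

Let c1_range : 0 <= 1 - c1 < 1.
Proof.
have s1 : 1 <= scale.
  rewrite /scale -[leLHS]mulr1 ler_pM// ?exprn_ege1 ?ler1n//.
  rewrite -[leLHS](powRr0 2); apply: ler_powR; [exact: ler1n|exact: ltW].
have c10 : 0 < c1 by rewrite /c1 divr_gt0// mulr_gt0.
rewrite gtrBl c10 andbT subr_ge0 /c1 ler_pdivrMr ?mulr_gt0// mul1r.
apply: (@le_trans _ _ (1 * 1)).
  apply: ler_pM; rewrite ?(ltW alpha1) ?(ltW g1)// gerBl; first by case/andP: alpha01.
  by case/andP: hg => /ltW.
by rewrite mulr1 (le_trans s1)// ler_peMl ?(ltW scale_gt0)// ler1n.
Qed.

(** The box [inner] is a fixed proportion of the cell. Its lower companion gets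
    mass from the test box, so by decay w is at least beta cG lam on a fixed
    proportion of [inner]. *)
Lemma good_cell lam i q t : 0 < lam -> good lam (i, q) -> t <= beta * cG * lam ->
  vol (cel i q `&` [set z | w z < t]) <= (1 - c1) * vol (cel i q).
Proof.
move=> lam_gt0 gd tl.
have cG0 : 0 < cG by case/andP: cG01.
have low : vol (inner i q `&` [set z | w z < t]) <= alpha * boxvol (side i.+1).
  have big1 : cG * lam * boxvol (side i.+1) <=
      mass (box (ctr i q) (st i q - lag (side i.+1)) (side i.+1)).
    rewrite [X in boxvol X]sideS [X in box _ _ X]sideS.
    apply: (hG (side_gt0 i) lam_gt0 gd).
      by move=> a; rewrite subrr normr0 mulr_ge0// ltW.
    rewrite /=; exact: (inner_times (st i q) hg A0 (side_half i)).
  have := decay (side_gt0 i.+1) (mulr_gt0 cG0 lam_gt0) big1.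
  rewrite subrK; apply: le_trans; apply: le_vol.
  - apply: bmeasI; [exact: bmeas_box|exact: measurable_lt].
  - apply: bmeasI; [exact: bmeas_box|exact: measurable_lt].
  - move=> z [Iz] /= wt; split => //=; apply: (lt_le_trans wt).
    by rewrite mulrA.
have bC := cell_bmeas i q.
have bI : bmeas (inner i q) by exact: bmeas_box.
have mI : measurable (inner i q) by case: bI.
have bCt : bmeas (cel i q `&` [set z | w z < t]) by apply: bmeasI => //; exact: measurable_lt.
have E1 := vol_setID bCt mI.
have E2 := vol_setID bC mI.
have E3 : cel i q `&` inner i q = inner i q by apply/setIidPr; exact: inner_subset.
rewrite E3 vol_box// in E2.
have H1 : vol (cel i q `&` [set z | w z < t] `&` inner i q) <= alpha * boxvol (side i.+1).
  apply: le_trans low; apply: le_vol.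
  - exact: bmeasI.
  - by apply: bmeasI => //; exact: measurable_lt.
  - by move=> z [[_ ?] ?].
have H2 : vol (cel i q `&` [set z | w z < t] `\` inner i q) <= vol (cel i q `\` inner i q).
  apply: le_vol; [exact: bmeasD|exact: bmeasD|].
  by move=> z [[? _] ?].
have H3 := cell_le_boxvol i q; rewrite boxvol_side in H3.
have H4 : c1 * vol (cel i q) <= (1 - alpha) * boxvol (side i.+1).
  have -> : (1 - alpha) * boxvol (side i.+1) = c1 * (4 / (1 - g) * (scale * boxvol (side i.+1))).
    by rewrite /c1; field; rewrite !gt_eqF.
  by apply: ler_wpM2l => //; rewrite /c1 ltW// divr_gt0// mulr_gt0.
clearbody c1.
exact: (density_combine E1 E2 H1 H2 H4).
Qed.

(** The first bad cell on the way down to some point of the upper part. *)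
Definition stopped (lam : R) (q : nat * ('rV[int]_n * int)) : Prop :=
  exists z : ST, [/\ box x0 (s0 + lag L) L z, adr q.1 z = q.2, ~ good lam q &
    forall j, (j < q.1)%N -> good lam (j, adr j z)].

Definition cell_of (q : nat * ('rV[int]_n * int)) : set ST := cel q.1 q.2.

Lemma stopped_inj lam q q' z : stopped lam q -> stopped lam q' ->
  cell_of q z -> cell_of q' z -> q = q'.
Proof.
move=> [y [_ yq ngq gy]] [y' [_ yq' ngq' gy']] qz qz'.
have [lt_qq|lt_qq|eq_qq] := ltngtP q.1 q'.1.
- exfalso; apply: ngq; rewrite (surjective_pairing q).
  have <- : adr q.1 y' = q.2.
    rewrite -qz; apply: (address_refine l0_gt0 tau0_gt0 e_mono (ltnW lt_qq)).
    by rewrite yq'.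
  exact: gy'.
- exfalso; apply: ngq'; rewrite (surjective_pairing q').
  have <- : adr q'.1 y = q'.2.
    rewrite -qz'; apply: (address_refine l0_gt0 tau0_gt0 e_mono (ltnW lt_qq)).
    by rewrite yq.
  exact: gy.
- rewrite (surjective_pairing q) (surjective_pairing q') -qz -qz'.
  by rewrite eq_qq.
Qed.

(** Otherwise the first bad cell that contains z would be stopped. *)
Lemma stopped_or_good lam z : box x0 (s0 + lag L) L z ->
  ~ (exists i, stopped lam (i, adr i z)) -> forall i, good lam (i, adr i z).
Proof.
move=> Rz nstop; elim/ltn_ind => i IH.
apply: contrapT => bad; apply: nstop; exists i, z; split => //.
Qed.

Lemma stopped_parent lam q : 0 < lam <= cT * lam0 -> stopped lam q ->
  exists i (z : ST), [/\ box x0 (s0 + lag L) L z, q = (i.+1, adr i.+1 z) &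
    good lam (i, adr i z)].
Proof.
move=> lam_cT [z [Rz zq bad gz]]; case: q zq bad gz => -[|i] q /= zq bad gz.
  by exfalso; apply: bad; rewrite -zq; exact: top_good.
by exists i, z; split; [exact: Rz|rewrite -zq|exact: gz].
Qed.

(** One [time_lag] before the test box of the cell, hence the test box is its
    upper companion. *)
Definition witness_box (q : nat * ('rV[int]_n * int)) : set ST :=
  box (ctr q.1 q.2) (st q.1 q.2 - (A + (1 + g)) * side q.1 `^ p) (side q.1).

Let c4 : R := 2 / (beta * (1 - alpha) ^+ 2).

Definition annulus (lam : R) : set ST :=
  [set z | w z < c4 * lam] `\` [set z | w z < beta * cG * lam].

Lemma measurable_annulus lam : measurable (annulus lam).
Proof. by apply: measurableD; exact: measurable_lt. Qed.

(** The box one [time_lag] before the witness box gets mass from the parent, so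
    w < beta cG lam on at most the proportion alpha of the witness box. The
    test box comes one [time_lag] after it and has mass less than lam, so the
    witness box has mass at most lam / (beta (1 - alpha)), and Chebyshev bounds
    {w >= c4 lam} by the proportion (1 - alpha) / 2. *)
Lemma stopped_annulus lam q : 0 < lam <= cT * lam0 -> stopped lam q ->
  (1 - alpha) / 2 * boxvol (side q.1) <= vol (witness_box q `&` annulus lam).
Proof.
move=> lam_cT sq; have [i [z [Rz qE gz]]] := stopped_parent lam_cT sq.
have lam_gt0 : 0 < lam by case/andP: lam_cT.
have cG0 : 0 < cG by case/andP: cG01.
have V0 := boxvol_gt0 p hg (n := n) (side_gt0 q.1).
have bP : bmeas (witness_box q) by exact: bmeas_box.
have Ub : 0 <= A + 2 * (1 + g) <= A + 4.
  by case/andP: hg => ? ?; apply/andP; split; [rewrite addr_ge0// mulr_ge0|]; lra.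
have Ubig := child_mass lam_gt0 gz Ub.
have low : vol (witness_box q `&` [set z | w z < beta * cG * lam]) <= alpha * boxvol (side q.1).
  have := decay (side_gt0 i.+1) (mulr_gt0 cG0 lam_gt0) Ubig.
  rewrite qE /= mulrA /witness_box/=.
  have -> // : st i.+1 (adr i.+1 z) - (A + 2 * (1 + g)) * side i.+1 `^ p + lag (side i.+1)
    = st i.+1 (adr i.+1 z) - (A + (1 + g)) * side i.+1 `^ p.
  by rewrite /time_lag; ring.
have Pm : mass (witness_box q) < lam / (beta * (1 - alpha)) * boxvol (side q.1).
  rewrite ltNge; apply/negP => big1.
  have ba0 : 0 < lam / (beta * (1 - alpha)) by rewrite divr_gt0// mulr_gt0.
  have := upper_mass (side_gt0 q.1) ba0 big1.
  have -> : beta * (1 - alpha) * (lam / (beta * (1 - alpha))) = lam.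
    by field; rewrite !gt_eqF.
  have -> : st q.1 q.2 - (A + (1 + g)) * side q.1 `^ p + lag (side q.1) =
     st q.1 q.2 - A * side q.1 `^ p by rewrite /time_lag; ring.
  by case: sq => ? [].
have c40 : 0 < c4 * lam by rewrite mulr_gt0// divr_gt0// mulr_gt0// exprn_gt0.
have mC4 := measurable_lt hw (c4 * lam).
have mbG := measurable_lt hw (beta * cG * lam).
have high : vol (witness_box q `\` [set z | w z < c4 * lam]) <= (1 - alpha) / 2 * boxvol (side q.1).
  rewrite -(ler_pM2l c40).
  have bD := bmeasD bP mC4.
  have : c4 * lam * vol (witness_box q `\` [set z | w z < c4 * lam]) <= mass (witness_box q).
    apply: (le_trans (ge_mass_vol hw bD (ltW c40) _)).
      by move=> y [_] /= /negP; rewrite -leNgt.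
    by apply: le_mass => // y [].
  move/le_trans; apply; apply: (le_trans (ltW Pm)); rewrite le_eqVlt; apply/orP; left.
  by apply/eqP; rewrite /c4; field; rewrite !gt_eqF.
have volP : vol (witness_box q) = boxvol (side q.1) by exact: vol_box.
have E1 := vol_setID bP mC4.
have bPC : bmeas (witness_box q `&` [set z | w z < c4 * lam]) by exact: bmeasI.
have E2 := vol_setID bPC mbG.
have H1 : vol (witness_box q `&` [set z | w z < c4 * lam] `&` [set z | w z < beta * cG * lam]) <=
    vol (witness_box q `&` [set z | w z < beta * cG * lam]).
  by apply: le_vol; [exact: bmeasI|exact: bmeasI|move=> y [[? _] ?]].
have E3 : witness_box q `&` annulus lam =
   witness_box q `&` [set z | w z < c4 * lam] `\` [set z | w z < beta * cG * lam].
  by rewrite /annulus setIDA.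
rewrite E3; rewrite volP in E1.
exact: annulus_combine E1 E2 (le_trans H1 low) high.
Qed.

Let cY : R := cG / (K%:R ^+ n * K%:R `^ p).

Let K0 : 0 < K%:R :> R. Proof. by rewrite ltr0n. Qed.

Let Kscale_gt0 : 0 < K%:R ^+ n * K%:R `^ p.
Proof. by rewrite mulr_gt0 ?exprn_gt0 ?powR_gt0. Qed.

(** A box K times as large as the cell has an upper companion that contains the
    cell; the mass that it gets from the parent, divided by the dilation factor
    of the volume, is the level for the hypothesis. *)
Lemma stopped_sublevel h th lam t q : 0 < h -> sublevel_decay p g w h th ->
  0 < lam <= cT * lam0 -> t <= h * cY * lam -> stopped lam q ->
  vol (cell_of q `&` [set z | w z < t]) <=
    th * (K%:R ^+ n * K%:R `^ p * boxvol (side q.1)).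
Proof.
move=> h0 dec lam_cT tl sq; have [i [z [Rz qE gz]]] := stopped_parent lam_cT sq.
have lam_gt0 : 0 < lam by case/andP: lam_cT.
have cG0 : 0 < cG by case/andP: cG01.
pose l := side q.1; have l_gt0 : 0 < l by exact: side_gt0.
have Kl0 : 0 < K%:R * l by rewrite mulr_gt0.
have Kp0 : 0 < K%:R `^ p by rewrite powR_gt0.
have b_range : 0 <= 1 + (1 + g) * K%:R `^ p <= A + 4.
  exact: (cover_box_range hg (ltW Kp0) AK).
pose s1 := st q.1 q.2 - (1 + (1 + g) * K%:R `^ p) * l `^ p.
have big1 : cY * lam * boxvol (K%:R * l) <= mass (box (ctr q.1 q.2) s1 (K%:R * l)).
  have := child_mass lam_gt0 gz b_range; rewrite -/l => big2.
  rewrite boxvol_scale; [|exact: ltW|exact: ltW].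
  have -> : cY * lam * (K%:R ^+ n * K%:R `^ p * boxvol l) = cG * lam * boxvol l.
    by rewrite /cY; field; rewrite gt_eqF ?powR_gt0//= gt_eqF// exprn_gt0.
  rewrite {1}/l /s1 /l qE /=; apply: (le_trans big2); apply: le_mass => //.
  - exact: bmeas_box.
  - exact: bmeas_box.
  have l1 : side i.+1 <= K%:R * side i.+1 by rewrite ler_peMl ?ler1n// ltW.
  apply: prism_subset => //.
    by move=> a; rewrite subrr normr0 add0r.
  rewrite lerD2l ler_pM2l//; apply: ge0_ler_powR => //; rewrite ?nnegrE ?ltW//.
  by rewrite mulr_gt0.
have cYl : 0 < cY * lam by rewrite mulr_gt0// divr_gt0.
have := dec _ _ _ _ Kl0 cYl big1.
rewrite boxvol_scale; [|exact: ltW|exact: ltW].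
apply: le_trans; apply: le_vol.
- by apply: bmeasI; [exact: cell_bmeas|exact: measurable_lt].
- by apply: bmeasI; [exact: bmeas_box|exact: measurable_lt].
move=> y [cy] /= wy; split; last by rewrite /= (lt_le_trans wy)// mulrA.
split.
  move=> a; rewrite -cy; apply: (le_trans (address_center e l0_gt0 tau0_gt0 _ _ _)).
  by rewrite /= ler_peMl ?ler1n// ltW.
have lagE : lag (K%:R * l) = (1 + g) * K%:R `^ p * l `^ p.
  by rewrite /time_lag powRM ?(ltW K0) ?(ltW l_gt0)// mulrA.
have -> : s1 + lag (K%:R * l) = st q.1 q.2 - l `^ p by rewrite lagE /s1; ring.
rewrite /= in_itv/= powRM ?(ltW K0) ?(ltW l_gt0)// mulrA.
have := address_start e l0_gt0 tau0_gt0 q.1 y; rewrite cy => yt.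
have /andP[_ t2] := tick_bounds q.1.
exact: (mem_wider_time (sidep_gt0 q.1) yt t2 Kg).
Qed.

(** Contains all witness boxes. *)
Definition reservoir : set ST := prism x0 (2 * L) s0 (s0 + 2 * L `^ p).

Lemma vol_reservoir : vol reservoir = 2 ^+ n * (2 / (1 - g)) * boxvol L.
Proof.
rewrite vol_prism; [|by rewrite mulr_ge0// ltW|].
  rewrite addrAC subrr add0r [in LHS]exprMn /boxvol; field.
  by rewrite gt_eqF.
by rewrite lerDl mulr_ge0// powR_ge0.
Qed.

Let upper_time (z : ST) : box x0 (s0 + lag L) L z ->
  s0 + (1 + g) * L `^ p < z.2 < s0 + (1 + g) * L `^ p + (1 - g) * L `^ p.
Proof. by case=> _; rewrite /= in_itv. Qed.

Let Lp_l0 : L `^ p = k%:R `^ p * l0 `^ p.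
Proof.
by rewrite -powRM ?(ltW l0_gt0) ?(ltW k0)//; congr (_ `^ _); rewrite /l0; field; rewrite gt_eqF.
Qed.

Lemma witness_box_reservoir lam q : stopped lam q -> witness_box q `<=` reservoir.
Proof.
move=> [z [Rz zq _ _]].
have zt := address_start e l0_gt0 tau0_gt0 q.1 z; rewrite zq in zt.
have /andP[_ t2] := tick_bounds q.1.
have kside : (A + 6) * side q.1 `^ p <= g / 2 * L `^ p.
  apply: (@le_trans _ _ ((A + 6) * l0 `^ p)).
    apply: ler_wpM2l; first by rewrite addr_ge0.
    by apply: ge0_ler_powR; rewrite ?nnegrE ?side_le// ltW.
  by rewrite Lp_l0 mulrA ler_pM2r// powR_gt0.
have [r1 r2] := prism_time_in_range hg A0 (sidep_gt0 q.1) kside zt t2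
  (powR_gt0 _ L0) (upper_time Rz).
apply: prism_subset => //.
move=> a; have zc := address_center e l0_gt0 tau0_gt0 q.1 z a; rewrite zq in zc.
have l2 : side q.1 <= L / 2.
  apply: (le_trans (side_le q.1)); rewrite /l0 ler_pM2l// lef_pV2 ?posrE//.
  by rewrite ler_nat.
case: Rz => Hz _.
exact: (two_steps zc (Hz a) l2).
Qed.

Definition dilated_box (q : nat * ('rV[int]_n * int)) : set ST :=
  prism (ctr q.1 q.2) (4 * side q.1) (st q.1 q.2 - (A + 3) * side q.1 `^ p)
    (st q.1 q.2 + (A + 4) * side q.1 `^ p).

Lemma cell_of_dilated q : cell_of q `<=` dilated_box q.
Proof.
move=> y cy; split => /=.
  move=> a; rewrite -cy; apply: (le_trans (address_center e l0_gt0 tau0_gt0 _ _ _)).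
  by rewrite ler_peMl ?(ltW (side_gt0 _))// ler1n.
rewrite in_itv/=; have yt := address_start e l0_gt0 tau0_gt0 q.1 y; rewrite cy in yt.
have /andP[_ t2] := tick_bounds q.1.
exact: (own_times A0 (sidep_gt0 q.1) yt t2).
Qed.

Lemma cell_of_dilated_overlap q q' : (q.1 <= q'.1)%N -> witness_box q `&` witness_box q' !=set0 ->
  cell_of q' `<=` dilated_box q.
Proof.
move=> qq [z [[z1 z2] [z3 z4]]] y cy.
have ss := side_nonincr qq.
split => /=.
  move=> a; have := address_center e l0_gt0 tau0_gt0 q'.1 y a; rewrite cy => ya.
  exact: (three_steps ya (z3 a) (z1 a) ss).
move: z2 z4; rewrite /= !in_itv/= => z2 z4.
have yt := address_start e l0_gt0 tau0_gt0 q'.1 y; rewrite cy in yt.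
have /andP[_ t2] := tick_bounds q'.1.
apply: (overlap_times hg A0 _ z2 z4 yt t2).
rewrite powR_gt0//=; apply: ge0_ler_powR; rewrite ?nnegrE// ltW//; exact: side_gt0.
Qed.

Let cW : R := 4 ^+ n * ((2 * A + 7) / (1 - g)) * (2 / (1 - alpha)).

Let cW_ge0 : 0 <= cW.
Proof.
by rewrite ltW// mulr_gt0 ?divr_gt0// mulr_gt0 ?exprn_gt0// divr_gt0// ltr_wpDl// mulr_ge0.
Qed.

Lemma vol_dilated_box lam q : 0 < lam <= cT * lam0 -> stopped lam q ->
  vol (dilated_box q) <= cW * vol (witness_box q `&` annulus lam).
Proof.
move=> lam_cT sq; have := stopped_annulus lam_cT sq => H.
have E : vol (dilated_box q) = cW * ((1 - alpha) / 2 * boxvol (side q.1)).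
  rewrite vol_prism; [|by rewrite mulr_ge0// ltW|].
    have -> : 2 * (4 * side q.1) = 4 * (2 * side q.1) by ring.
    rewrite [in LHS]exprMn /cW /boxvol; field.
    by rewrite !gt_eqF.
  rewrite lerD2l -subr_ge0 -mulNr -mulrBl.
  by rewrite mulr_ge0 ?powR_ge0// opprK addr_ge0// addr_ge0.
by rewrite E; apply: ler_wpM2l.
Qed.

(** The cells are disjoint but the witness boxes are not, whence the Vitali
    selection. Generations decrease the sides, so they serve as ranks. *)
Lemma stopped_sum lam (s : seq (nat * ('rV[int]_n * int))) :
  0 < lam <= cT * lam0 -> uniq s -> (forall q, q \in s -> stopped lam q) ->
  \sum_(q <- s) boxvol (side q.1) <= scale * (cW * vol (reservoir `&` annulus lam)).
Proof.
move=> lam_cT us ss.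
have mA := measurable_annulus lam.
apply: (@le_trans _ _ (\sum_(q <- s) scale * vol (cell_of q))).
  apply: ler_sum => q _; rewrite boxvol_side ler_pM2l//.
  exact: boxvol_le_cell.
rewrite -mulr_sumr ler_pM2l//.
apply: (@vitali_sum R n _ (fun q => q.1) cell_of (fun q => witness_box q `&` annulus lam) dilated_box).
- exact: cW_ge0.
- exact: us.
- by move=> q _; exact: cell_bmeas.
- by move=> q _; apply: bmeasI => //; exact: bmeas_box.
- by move=> q _; exact: bmeas_prism.
- by apply: bmeasI => //; exact: bmeas_prism.
- by move=> q q' z qs qs' qz qz'; apply: (stopped_inj (ss _ qs) (ss _ qs') qz qz').
- by move=> q qs z [Pz Az]; split => //; exact: (witness_box_reservoir (ss _ qs) Pz).
- by move=> q _; exact: cell_of_dilated.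
- move=> q q' qs qs' qq [z [[Pz _] [Pz' _]]].
  by apply: (cell_of_dilated_overlap qq); exists z.
- by move=> q qs; apply: vol_dilated_box => //; exact: ss.
Qed.

(** Outside the stopped cells every cell is good, so {w < t} has small density
    in all cells and is null; inside, the hypothesis is applied on each stopped
    cell and the volumes are summed. *)
Lemma upper_sublevel h th lam t : 0 < h -> 0 <= th -> sublevel_decay p g w h th ->
  0 < lam <= cT * lam0 -> t <= beta * cG * lam -> t <= h * cY * lam ->
  vol (box x0 (s0 + lag L) L `&` [set z | w z < t]) <=
  th * (K%:R ^+ n * K%:R `^ p * scale * cW) * vol (reservoir `&` annulus lam).
Proof.
move=> h0 th0 dec lam_cT tG tY.
have lam_gt0 : 0 < lam by case/andP: lam_cT.
have mt := measurable_lt hw t.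
set E := _ `&` [set z | w z < t].
have bE : bmeas E by apply: bmeasI => //; exact: bmeas_box.
pose stp i : set ST := [set z | stopped lam (i, adr i z)].
have sat_stp i : saturated adr i (stp i) by move=> z z' zz'; rewrite /stp/= zz'.
have ref := @address_refine R n l0 tau0 e l0_gt0 tau0_gt0 e_mono.
have mcell := @measurable_address R n l0 tau0 e l0_gt0 tau0_gt0.
have mstp i : measurable (stp i) := measurable_saturated mcell (sat_stp i).
pose Om : set ST := \bigcup_i stp i.
have mOm : measurable Om by exact: bigcup_measurable.
have outside : vol (E `\` Om) = 0.
  (* the union of the top cells that meet the upper part *)
  pose X : set ST := [set z | exists2 y, box x0 (s0 + lag L) L y & adr 0 y = adr 0 z].
  have sX : saturated adr 0 X by move=> z z' zz' [y Ry yz]; exists y => //; rewrite yz.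
  have mX := measurable_saturated mcell sX.
  have bX : bmeas X.
    apply: (bmeas_sub mX _ (bmeas_prism x0 (L + 2 * side 0)
      (s0 + lag L - 2 * tik 0) (s0 + lag L + (1 - g) * L `^ p + 2 * tik 0))).
    move=> z [y [Ry1 Ry2] yz]; split => /=.
      move=> a; have := address_center e l0_gt0 tau0_gt0 0 z a.
      have := address_center e l0_gt0 tau0_gt0 0 y a; rewrite yz => H1 H2.
      exact: (detour H2 H1 (Ry1 a)).
    move: Ry2; rewrite /= !in_itv/=.
    have := address_start e l0_gt0 tau0_gt0 0 z.
    have := address_start e l0_gt0 tau0_gt0 0 y; rewrite yz => H1 H2 H3.
    exact: (detour_time H1 H2 H3).
  have bF : bmeas (E `\` Om) by exact: bmeasD.
  have FX : E `\` Om `<=` X by move=> z [[Rz _] _]; exists z.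
  have c101 : 0 <= 1 - c1 < 1 by exact: c1_range.
  apply: (@density_null R n _ adr mcell _ X (1 - c1) bX bF FX sX c101).
    exact: (grid_approx_borel l0_gt0 tau0_gt0 e_mono e_ge bX).
  move=> i q.
  have [[z [[[Rz wz] nOz] zq]]|empty] := pselect ((E `\` Om) `&` cell adr i q !=set0); last first.
    have -> : (E `\` Om) `&` cell adr i q = set0.
      by apply/seteqP; split => // z Hz; apply: empty; exists z.
    rewrite vol_set0 mulr_ge0 ?vol_ge0//.
    by case/andP: c101.
  have gz : good lam (i, q).
    rewrite -zq; apply: (stopped_or_good Rz) => -[j sj]; apply: nOz.
    by exists j.
  have cX : cell adr i q `<=` X.
    by move=> y yq; exists z => //; apply: (ref 0%N i) => //; rewrite yq.
  have -> : X `&` cell adr i q = cell adr i q by apply/setIidPr.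
  apply: le_trans (good_cell lam_gt0 gz tG); apply: le_vol.
  - by apply: bmeasI => //; case: (cell_bmeas i q).
  - by apply: bmeasI => //; exact: cell_bmeas.
  - by move=> y [[[_ wy] _] cy].
rewrite (vol_setID bE mOm) outside addr0.
pose fst_cells m := enum_upto (stopped lam) m.
pose Um m : set ST := \big[setU/set0]_(q <- fst_cells m) cell_of q.
have UmE m z : Um m z <-> exists2 q, q \in fst_cells m & cell_of q z.
  by rewrite /Um -bigcup_seq; split => [[q]|[q]]; exists q.
have EUm m : vol (E `&` Om `&` Um m) <=
    th * (K%:R ^+ n * K%:R `^ p * scale * cW) * vol (reservoir `&` annulus lam).
  apply: (@le_trans _ _ (\sum_(q <- fst_cells m) vol (cell_of q `&` [set z | w z < t]))).
    apply: vol_cover.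
    - apply: bmeasI; first exact: bmeasI.
      by apply: bigsetU_measurable => q _; case: (cell_bmeas q.1 q.2).
    - by move=> q _; apply: bmeasI => //; exact: cell_bmeas.
    - move=> z [[[_ wz] _] /UmE[q qm qz]]; exists q => //.
  apply: (@le_trans _ _ (\sum_(q <- fst_cells m)
      th * (K%:R ^+ n * K%:R `^ p) * boxvol (side q.1))).
    rewrite big_seq [X in _ <= X]big_seq; apply: ler_sum => q /mem_enum_upto[sq _].
    by rewrite -mulrA; apply: (stopped_sublevel h0 dec lam_cT tY sq).
  rewrite -mulr_sumr.
  have -> : th * (K%:R ^+ n * K%:R `^ p * scale * cW) * vol (reservoir `&` annulus lam) =
    th * (K%:R ^+ n * K%:R `^ p) * (scale * (cW * vol (reservoir `&` annulus lam))) by ring.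
  apply: ler_wpM2l; first by rewrite mulr_ge0// ltW.
  apply: stopped_sum => //; first exact: enum_upto_uniq.
  by move=> q /mem_enum_upto[].
apply: (vol_exhaust _ _ _ _ EUm).
- by move=> m; apply: bigsetU_measurable => q _; case: (cell_bmeas q.1 q.2).
- move=> m z /UmE[q /mem_enum_upto[sq qm] qz]; apply/UmE; exists q => //.
  by apply/mem_enum_upto; split => //; exact: ltnW.
- exact: bmeasI.
- move=> z [_ [i _ si]]; exists (pickle (i, adr i z)).+1 => //.
  by apply/UmE; exists (i, adr i z) => //; apply/mem_enum_upto.
Qed.

End Stopping.

(** * Geometric decay of sublevel sets *)

Section Improvement.
Context {R : realType} {n : nat}.
Local Notation ST := (spacetime R n).
Context (p g : R) (hp : 1 < p) (hg : 0 < g < 1).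
Context (w : ST -> R) (hw : weight w).
Context (beta alpha : R).
Hypotheses (beta0 : 0 < beta) (beta1 : beta <= 1) (alpha01 : 0 <= alpha < 1).
Hypothesis decay : sublevel_decay p g w beta alpha.

(** Each annulus has ratio c4 / (beta cG) between its bounds, and eta is the
    inverse of this ratio. *)
Lemma annuli_disjoint (cG eta : R) (lam : nat -> R) i j (z : ST) :
  (forall i, 0 < lam i) -> (forall i, lam i.+1 = eta * lam i) -> 0 < eta <= 1 ->
  2 / (beta * (1 - alpha) ^+ 2) * eta = beta * cG ->
  annulus w beta alpha cG (lam i) z -> annulus w beta alpha cG (lam j) z -> i = j.
Proof.
move=> lam0 lamS /andP[e0 e1] etaE.
have c40 : 0 < 2 / (beta * (1 - alpha) ^+ 2).
  by rewrite divr_gt0// mulr_gt0// exprn_gt0// subr_gt0; case/andP: alpha01.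
wlog ij : i j / (i < j)%N => [H zi zj|[zi nzi] [zj nzj]].
  by have [?|?|//] := ltngtP i j; [exact: H|apply/esym; exact: H].
exfalso; apply: nzi => /=; apply: (lt_le_trans zj); rewrite -etaE -(mulrA _ eta).
rewrite ler_pM2l// -lamS; elim: j ij {zj nzj} => // j IH.
rewrite ltnS leq_eqVlt => /orP[/eqP->//|/IH]; apply: le_trans.
by rewrite lamS ler_piMl// ltW.
Qed.

Lemma decay_improve : exists2 h0 : R, 0 < h0 < 1 & forall h th : R,
  0 < h <= 1 -> 0 <= th -> sublevel_decay p g w h th ->
  sublevel_decay p g w (h * h0) (th / 2).
Proof.
have [g0 g1] := andP hg; have [a0 a1] := andP alpha01.
have g1' : 0 < 1 - g by rewrite subr_gt0.
have a1' : 0 < 1 - alpha by rewrite subr_gt0.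
have p0 : 0 < p by exact: lt_trans hp.
pose K := (Num.truncn (4 / (1 - g))).+1.
have K1 : 1 <= K%:R :> R by rewrite ler1n.
have K0 : 0 < K%:R :> R by rewrite ltr0n.
have Kg : 4 <= (1 - g) * K%:R `^ p.
  rewrite mulrC -ler_pdivrMr// (le_trans (ltW (truncnS_gt _)))//.
  by rewrite le1r_powR// ltW.
have [A0 HA] := descends_exists hp hg hw beta0 beta1 alpha01 decay.
have Kp0 : 0 <= K%:R `^ p by exact: powR_ge0.
pose A := Num.max A0 (1 + 2 * K%:R `^ p).
have AK : 1 + 2 * K%:R `^ p <= A by rewrite le_max lexx orbT.
have A_ge0 : 0 <= A by apply: le_trans AK; rewrite addr_ge0// mulr_ge0.
have [cG cG01 hG] : exists2 c : R, 0 < c <= 1 & descends p g w A c.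
  by apply: HA; rewrite le_max lexx.
have [k [k2 kA] [cT cT01 hT]] :=
  enters_exists hp hg hw beta0 beta1 alpha01 decay (2 / g * (A + 6)).
have kA' : A + 6 <= g / 2 * k%:R `^ p.
  have -> : A + 6 = g / 2 * (2 / g * (A + 6)) by field; rewrite gt_eqF.
  by rewrite ler_pM2l// divr_gt0.
have [cG0 cG1] := andP cG01; have [cT0 cT1] := andP cT01.
pose c4 : R := 2 / (beta * (1 - alpha) ^+ 2).
have ba0 : 0 < beta * (1 - alpha) ^+ 2 by rewrite mulr_gt0// exprn_gt0.
have c40 : 0 < c4 by rewrite divr_gt0.
have c41 : 1 <= c4.
  rewrite /c4 ler_pdivlMr// mul1r (@le_trans _ _ (1 * 1))//; last by rewrite mulr1 ler1n.
  apply: ler_pM; [exact: ltW|by rewrite exprn_ge0// ltW|exact: beta1|].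
  by rewrite exprn_ile1// ?(ltW a1')// gerBl.
(* quotient of two levels with disjoint annuli *)
pose eta := beta * cG / c4.
have eta0 : 0 < eta by rewrite divr_gt0// mulr_gt0.
have eta1 : eta <= 1.
  rewrite /eta ler_pdivrMr// mul1r (le_trans _ c41)//.
  by rewrite mulr_ile1// ltW.
have etaE : c4 * eta = beta * cG by rewrite /eta; field; rewrite !gt_eqF.
pose cY := cG / (K%:R ^+ n * K%:R `^ p).
have Kn0 : 0 < K%:R ^+ n * K%:R `^ p by rewrite mulr_gt0 ?exprn_gt0 ?powR_gt0.
have cY0 : 0 < cY by rewrite divr_gt0.
pose C5 := K%:R ^+ n * K%:R `^ p * (2 ^+ n * 2 `^ p) *
  (4 ^+ n * ((2 * A + 7) / (1 - g)) * (2 / (1 - alpha))).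
pose Cres : R := 2 ^+ n * (2 / (1 - g)).
have C50 : 0 < C5.
  rewrite /C5 !mulr_gt0 ?exprn_gt0 ?powR_gt0 ?divr_gt0 ?invr_gt0//.
  by rewrite ltr_wpDl// mulr_ge0.
have Cres0 : 0 < Cres by rewrite mulr_gt0 ?exprn_gt0 ?divr_gt0.
(* enough levels to turn the constant C5 Cres into 1/2 *)
pose J := (Num.truncn (2 * C5 * Cres)).+1.
have JC : 2 * C5 * Cres <= J%:R by exact/ltW/truncnS_gt.
have J0 : 0 < J%:R :> R by rewrite ltr0n.
clearbody eta J.
pose m := Num.min (beta * cG) cY.
have m0 : 0 < m by rewrite lt_min cY0 mulr_gt0.
have mG : m <= beta * cG by rewrite ge_min lexx.
have mY : m <= cY by rewrite ge_min lexx orbT.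
clearbody m.
(* the factor 1/2 makes h0 < 1; the rest serves the lowest of the levels *)
pose h0 := cT * eta ^+ J * m / 2.
have etaJ : 0 < eta ^+ J by rewrite exprn_gt0.
have h00 : 0 < h0 by rewrite divr_gt0// !mulr_gt0.
have h01 : h0 < 1.
  rewrite /h0 ltr_pdivrMr// mul1r (@le_lt_trans _ _ 1)//; last by rewrite ltr1n.
  rewrite !mulr_ile1 ?mulr_ge0 ?exprn_ile1 ?(ltW cT0) ?(ltW etaJ) ?(ltW m0) ?(ltW eta0)//.
  by rewrite (le_trans mG)// mulr_ile1 ?(ltW beta0) ?(ltW cG0).
exists h0; first by rewrite h00.
move=> h th /andP[h_gt0 h1] th0 dec x s L lam L0 lam_gt0 big.
(* the factor cT makes the top cells good at all levels *)
pose lamj j := cT * eta ^+ j * lam.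
have lamj0 j : 0 < lamj j by rewrite !mulr_gt0// exprn_gt0.
have lamj_cT j : 0 < lamj j <= cT * lam.
  rewrite lamj0 ler_pM2r// ler_piMr ?(ltW cT0)// exprn_ile1 ?(ltW eta0)//.
have lamjS j : lamj j.+1 = eta * lamj j by rewrite /lamj exprS; ring.
have hm j : (j < J)%N -> forall c, m <= c -> h * h0 * lam <= h * c * lamj j.
  move=> jJ c mc; rewrite -(mulrA h h0) -(mulrA h c) ler_pM2l// /h0 /lamj.
  have -> : cT * eta ^+ J * m / 2 * lam = (cT * lam) * (eta ^+ J * m / 2) by ring.
  have -> : c * (cT * eta ^+ j * lam) = (cT * lam) * (eta ^+ j * c) by ring.
  rewrite ler_pM2l ?mulr_gt0//.
  apply: (@le_trans _ _ (eta ^+ J * m)).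
    rewrite ler_pdivrMr// ler_peMr ?ler1n// mulr_ge0// ltW//.
  apply: ler_pM => //; [exact: ltW|exact: ltW|].
  by apply: ler_wiXn2l => //; [exact: ltW|exact: ltnW].
have key j : (j < J)%N -> vol (box p g x (s + time_lag p g L) L `&` [set z | w z < h * h0 * lam]) <=
    th * C5 * vol (reservoir p x s L `&` annulus w beta alpha cG (lamj j)).
  move=> jJ; have := upper_sublevel hp hg hw beta0 alpha01 decay A_ge0 AK
    (isT : (1 <= K)%N) Kg cG01 hG hT k2 kA' L0 lam_gt0 big h_gt0 th0 dec (lamj_cT j).
  apply.
    apply: (le_trans (hm j jJ (beta * cG) mG)).
    by rewrite ler_pM2r// ler_piMl// mulr_ge0// ltW.
  exact: (hm j jJ cY mY).
set E := vol _ in key *.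
clearbody C5 E.
have disj (i j : 'I_J) z : (reservoir p x s L `&` annulus w beta alpha cG (lamj i)) z ->
    (reservoir p x s L `&` annulus w beta alpha cG (lamj j)) z -> i = j.
  move=> [_ zi] [_ zj]; apply: val_inj => /=.
  by apply: (annuli_disjoint lamj0 lamjS _ etaE zi zj); rewrite eta0.
have bR : bmeas (reservoir p x s L : set ST) by exact: bmeas_prism.
have mAn j : measurable (annulus w beta alpha cG (lamj j)) by exact: measurable_annulus.
have sumE : J%:R * E <= th * C5 * vol (reservoir p x s L : set ST).
  apply: (@le_trans _ _ (\sum_(j <- enum 'I_J)
      th * C5 * vol (reservoir p x s L `&` annulus w beta alpha cG (lamj j)))).
    have -> : J%:R * E = \sum_(j <- enum 'I_J) E.
      by rewrite big_enum/= sumr_const card_ord mulr_natl.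
    by apply: ler_sum => j _; exact: key.
  rewrite -mulr_sumr; apply: ler_wpM2l; first by rewrite mulr_ge0// ltW.
  apply: sum_vol_le => //.
  - exact: enum_uniq.
  - by move=> j _; apply: measurableI => //; case: bR.
  - by move=> i j z iJ jJ; exact: disj.
have volR : vol (reservoir p x s L : set ST) = Cres * @boxvol R n p g L by exact: (vol_reservoir p hg x s L0).
rewrite volR in sumE; have V0 := boxvol_gt0 p hg (n := n) L0.
rewrite -(ler_pM2l J0); apply: (le_trans sumE).
have -> : th * C5 * (Cres * @boxvol R n p g L) = 2 * C5 * Cres * (th / 2 * @boxvol R n p g L) by field.
by apply: ler_wpM2r => //; rewrite mulr_ge0 ?divr_ge0// ltW.
Qed.

Lemma decay_trivial : sublevel_decay p g w 1 1.
Proof.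
move=> x s L lam L0 lam0 big; rewrite -(vol_box p hg x (s + time_lag p g L) L0) [leRHS]mul1r.
apply: le_vol; [|exact: bmeas_box|by move=> z []].
by apply: bmeasI; [exact: bmeas_box|exact: measurable_lt].
Qed.

Lemma geometric_decay : exists2 h0 : R, 0 < h0 < 1 &
  forall m, sublevel_decay p g w (h0 ^+ m) (2^-1 ^+ m).
Proof.
have [h0 h01 H] := decay_improve; have [h00 h0_lt1] := andP h01.
exists h0 => //; elim=> [|m IH]; first by rewrite !expr0; exact: decay_trivial.
rewrite !exprSr; apply: H => //.
  by rewrite exprn_gt0// exprn_ile1// ltW.
Qed.

End Improvement.

(** * Averages over the parts of a parabolic rectangle *)

Lemma split_average (R : realFieldType) (a be al u v V : R) : 0 <= a -> 0 <= be ->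
  u <= al * V -> V = u + v -> a * u + (1 - be) * a * v <= (1 - be * (1 - al)) * a * V.
Proof.
move=> a0 b0 low VE; have : be * a * u <= be * a * (al * V).
  by rewrite ler_wpM2l// mulr_ge0.
have -> : v = V - u by lra.
by lra.
Qed.

Section Averages.
Context {R : realType} {n : nat}.
Local Notation ST := (spacetime R n).
Local Notation mu := (@lebesgue_spacetime R n).
Context (p g : R) (hg : 0 < g < 1).
Context (w : ST -> R) (hw : weight w).
Local Notation mass := (mass w).
Implicit Types (x : 'rV[R]_n) (t L : R).

Lemma lower_partE x t L : lower_part p g x t L = box p g x (t - L `^ p) L.
Proof.
rewrite /lower_part /box /prism.
by have -> : t - g * L `^ p = t - L `^ p + (1 - g) * L `^ p by ring.
Qed.

Lemma upper_partE x t L :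
  upper_part p g x t L = box p g x (t - L `^ p + time_lag p g L) L.
Proof.
rewrite /upper_part /box /prism /time_lag.
have -> : t - L `^ p + (1 + g) * L `^ p = t + g * L `^ p by ring.
by have -> : t + L `^ p = t + g * L `^ p + (1 - g) * L `^ p by ring.
Qed.

Lemma bmeas_lower x t L : bmeas (lower_part p g x t L : set ST).
Proof. by rewrite lower_partE; exact: bmeas_box. Qed.

Lemma bmeas_upper x t L : bmeas (upper_part p g x t L : set ST).
Proof. by rewrite upper_partE; exact: bmeas_box. Qed.

Lemma vol_lower x t L : 0 < L -> vol (lower_part p g x t L : set ST) = @boxvol R n p g L.
Proof. by move=> L0; rewrite lower_partE vol_box. Qed.

Lemma vol_upper x t L : 0 < L -> vol (upper_part p g x t L : set ST) = @boxvol R n p g L.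
Proof. by move=> L0; rewrite upper_partE vol_box. Qed.

Lemma mu_upper x t L : 0 < L -> mu (upper_part p g x t L) = (@boxvol R n p g L)%:E.
Proof. by move=> L0; rewrite bmeas_mu ?vol_upper//; exact: bmeas_upper. Qed.

Lemma EFin_div (a b : R) : b != 0 -> (a%:E / b%:E)%E = (a / b)%:E.
Proof. by move=> b0; rewrite inver (negbTE b0). Qed.

Lemma wavg_lower x t L : 0 < L ->
  wavg w (lower_part p g x t L) = (mass (lower_part p g x t L) / @boxvol R n p g L)%:E.
Proof.
move=> L0; rewrite /wavg /avg -/(wmeas w (lower_part p g x t L)).
rewrite bmeas_mu ?vol_lower//; last exact: bmeas_lower.
rewrite (bmeas_wmeas hw (bmeas_lower x t L)) EFin_div//.
by rewrite gt_eqF// boxvol_gt0.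
Qed.

Section integral_bounds.
Context (f : ST -> \bar R) (mf : measurable_fun setT f) (f0 : forall z, (0 <= f z)%E).

Lemma integral_le_cst (A : set ST) (c : R) : bmeas A -> 0 <= c ->
  (forall z, A z -> (f z <= c%:E)%E) -> (\int[mu]_(z in A) f z <= (c * vol A)%:E)%E.
Proof.
move=> bA c0 fc; have mA : measurable A by case: bA.
rewrite EFinM -(bmeas_mu bA) -integral_cst//.
apply: ge0_le_integral => //.
exact: measurable_funS mf.
Qed.

Lemma integral_ge_cst (A : set ST) (c : R) : bmeas A -> 0 <= c ->
  (forall z, A z -> (c%:E <= f z)%E) -> ((c * vol A)%:E <= \int[mu]_(z in A) f z)%E.
Proof.
move=> bA c0 fc; have mA : measurable A by case: bA.
rewrite EFinM -(bmeas_mu bA) -integral_cst//.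
apply: ge0_le_integral => //.
exact: measurable_funS mf.
Qed.

Lemma integral_setID (A B : set ST) : measurable A -> measurable B ->
  (\int[mu]_(z in A) f z = \int[mu]_(z in A `&` B) f z + \int[mu]_(z in A `\` B) f z)%E.
Proof.
move=> mA mB; rewrite -{1}(setUIDK A B) ge0_integral_setU//.
- exact: measurableI.
- exact: measurableD.
- by rewrite setUIDK; exact: measurable_funS mf.
- by apply/disj_setPS => z [[_ Bz] [_]].
Qed.

Lemma integral_sub (A B : set ST) : measurable A -> measurable B -> A `<=` B ->
  (\int[mu]_(z in A) f z <= \int[mu]_(z in B) f z)%E.
Proof.
move=> mA mB AB; apply: ge0_subset_integral => //.
by apply: measurable_funS mf.
Qed.

End integral_bounds.

Lemma negpartE (a : R) z : ((fun z => (w z)%:E - a%:E)^\-)%E z = (Num.max (a - w z) 0)%:E.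
Proof. by rewrite funenegE -EFinB -EFinN opprB EFin_max. Qed.

Lemma negpart_measurable (a : R) :
  measurable_fun setT (((fun z => (w z)%:E - a%:E)^\-)%E).
Proof.
have -> : ((fun z => (w z)%:E - a%:E)^\-)%E = (fun z => (Num.max (a - w z) 0)%:E).
  by apply/funext => z; exact: negpartE.
have [mw _ _] := hw; apply/measurable_EFinP.
apply: measurable_maxr; last exact: measurable_cst.
by apply: measurable_funB mw; exact: measurable_cst.
Qed.

Lemma negpart_ge0 (a : R) z : (0 <= ((fun z => (w z)%:E - a%:E)^\-)%E z)%E.
Proof. exact: funeneg_ge0. Qed.

Lemma avg_le (U : set ST) (f : ST -> \bar R) (c : R) : bmeas U -> 0 < vol U ->
  (avg U f <= c%:E)%E = (\int[mu]_(z in U) f z <= (c * vol U)%:E)%E.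
Proof.
move=> bU U0; rewrite /avg (bmeas_mu bU) inver gt_eqF// EFinM.
by rewrite lee_pdivrMr.
Qed.

(** On {w < beta a} the negative part of w - a is at most a, elsewhere it is at
    most (1 - beta) a. *)
Lemma negpart_avg_le (U : set ST) (a alpha beta : R) : bmeas U -> 0 < vol U -> 0 <= a ->
  0 <= beta <= 1 -> vol (U `&` [set z | w z < beta * a]) <= alpha * vol U ->
  (avg U ((fun z => (w z)%:E - a%:E)^\-)%E <= ((1 - beta * (1 - alpha)) * a)%:E)%E.
Proof.
move=> bU U0 a0 /andP[b0 b1] low; have mU : measurable U by case: bU.
have mlt := measurable_lt hw (beta * a).
set Lw := [set z | w z < beta * a] in low mlt *.
have mn := negpart_measurable a; have n0 := negpart_ge0 a.
rewrite avg_le// (integral_setID mn n0 mU mlt).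
have w0 z : 0 <= w z by case: hw.
have H1 : (\int[mu]_(z in U `&` Lw)
    (fun z => (w z)%:E - a%:E)^\- z <= (a * vol (U `&` Lw))%:E)%E.
  apply: integral_le_cst => //; first exact: bmeasI.
  by move=> z _; rewrite negpartE lee_fin ge_max a0 gerBl w0.
have H2 : (\int[mu]_(z in U `\` Lw)
    (fun z => (w z)%:E - a%:E)^\- z <=
    ((1 - beta) * a * vol (U `\` Lw))%:E)%E.
  apply: integral_le_cst => //; first exact: bmeasD.
    by rewrite mulr_ge0// subr_ge0.
  move=> z [_] /= /negP; rewrite -leNgt => wz.
  rewrite negpartE lee_fin ge_max mulr_ge0 ?subr_ge0// andbT.
  by rewrite mulrBl mul1r lerD2l lerN2.
apply: (le_trans (leeD H1 H2)).
have volU := vol_setID bU mlt.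
rewrite -EFinD lee_fin; exact: (split_average a0 b0 low volU).
Qed.

(** Chebyshev: on {w < beta a} the negative part of w - a is at least
    (1 - beta) a. *)
Lemma negpart_avg_ge (U : set ST) (a eps beta : R) : bmeas U -> 0 < vol U -> 0 < a ->
  beta < 1 -> (avg U ((fun z => (w z)%:E - a%:E)^\-)%E <= (eps * a)%:E)%E ->
  vol (U `&` [set z | w z < beta * a]) <= eps / (1 - beta) * vol U.
Proof.
move=> bU U0 a0 b1; rewrite avg_le// => low; have mU : measurable U by case: bU.
have mlt := measurable_lt hw (beta * a).
set Lw := [set z | w z < beta * a] in mlt *.
have mn := negpart_measurable a; have n0 := negpart_ge0 a.
have b1' : 0 < 1 - beta by rewrite subr_gt0.
have H1 : (((1 - beta) * a * vol (U `&` Lw))%:E <=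
    \int[mu]_(z in U `&` Lw)
    (fun z => (w z)%:E - a%:E)^\- z)%E.
  apply: integral_ge_cst => //; first exact: bmeasI.
    by rewrite mulr_ge0// ltW.
  move=> z [_] /= wz; rewrite negpartE lee_fin le_max; apply/orP; left.
  by rewrite mulrBl mul1r lerD2l lerN2 ltW.
have H2 : (\int[mu]_(z in U `&` Lw)
    (fun z => (w z)%:E - a%:E)^\- z <= \int[mu]_(z in U) (fun z => (w z)%:E - a%:E)^\- z)%E.
  by apply: integral_sub => //; exact: measurableI.
have := le_trans H1 (le_trans H2 low); rewrite lee_fin.
have -> : eps * a * vol U = (1 - beta) * a * (eps / (1 - beta) * vol U).
  by field; rewrite gt_eqF.
by rewrite ler_pM2l// mulr_gt0.
Qed.

End Averages.

(** * Integrals of negative powers *)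

Lemma exp_small (R : realType) (d h : R) : 0 < d -> 0 < h -> h < 1 ->
  exists m, h ^+ m < d.
Proof.
move=> d0 h0 h1.
have h10 : 0 < h^-1 - 1 by rewrite subr_gt0 invf_gt1.
pose m := (Num.truncn (d^-1 / (h^-1 - 1))).+1; exists m.
have Hm : d^-1 < m%:R * (h^-1 - 1) by rewrite -ltr_pdivrMr// truncnS_gt.
have B : 1 + m%:R * (h^-1 - 1) <= h^-1 ^+ m.
  elim: (m) => [|k IH]; first by rewrite mul0r addr0 expr0.
  rewrite exprS; apply: (@le_trans _ _ (h^-1 * (1 + k%:R * (h^-1 - 1)))).
    have sq : 0 <= k%:R * (h^-1 - 1) * (h^-1 - 1) by rewrite !mulr_ge0// ltW.
    by rewrite -[k.+1%:R]natr1; move: (h^-1) (k%:R : R) sq => u v sq; lra.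
  by rewrite ler_wpM2l// invr_ge0 ltW.
rewrite -[ltLHS]invrK -[ltRHS]invrK ltf_pV2 ?posrE ?invr_gt0 ?exprn_gt0// -exprVn.
by apply: lt_le_trans B; rewrite (lt_trans Hm)// ltrDr.
Qed.

Lemma geometric_sum_le (R : realFieldType) (c : R) N : 0 <= c ->
  2 * c * (\sum_(m < N) (3 / 4) ^+ m) <= 8 * c.
Proof.
move=> c0; have E : \sum_(m < N) (3 / 4 : R) ^+ m = 4 * (1 - (3 / 4) ^+ N).
  elim: N => [|N IH]; first by rewrite big_ord0 expr0 subrr mulr0.
  by rewrite big_ord_recr/= IH exprS; field.
rewrite E; have : 0 <= c * (3 / 4) ^+ N by rewrite mulr_ge0// exprn_ge0// divr_ge0.
by lra.
Qed.

Lemma powR_exprn (R : realType) (x s : R) m : 0 <= x ->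
  (x ^+ m) `^ s = (x `^ s) ^+ m.
Proof.
move=> x0; rewrite -(powR_mulrn m x0) -powRrM mulrC powRrM.
by rewrite (powR_mulrn m (powR_ge0 x s)).
Qed.

Section InversePower.
Context {R : realType} {n : nat}.
Local Notation ST := (spacetime R n).
Local Notation mu := (@lebesgue_spacetime R n).
Context (w : ST -> R) (hw : weight w).
Local Notation mass := (mass w).
Context (s : R) (s0 : 0 < s).

Definition invpow (z : ST) : \bar R := ((w z)%:E^-1 `^ s)%E.

Let w_ge0 z : 0 <= w z. Proof. by case: hw. Qed.

Lemma invpowE z : invpow z = if w z == 0 then +oo%E else (w z `^ (- s))%:E.
Proof.
rewrite /invpow inver; case: ifPn => [_|wz]; first by rewrite poweRyr// gt_eqF.
by rewrite poweR_EFin -powR_inv1// -powRrM mulN1r.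
Qed.

Lemma invpow_ge0 z : (0 <= invpow z)%E.
Proof. exact: poweR_ge0. Qed.

Lemma measurable_invpow : measurable_fun setT invpow.
Proof.
rewrite (_ : invpow = fun z => if w z == 0 then +oo%E else (w z `^ (- s))%:E).
  have mw : measurable_fun setT w by case: hw.
  apply: measurable_fun_ifT; first by apply: measurable_fun_eqr => //; exact: measurable_cst.
    exact: measurable_cst.
  apply/measurable_EFinP.
  exact: (measurableT_comp (measurable_powR (- s)) mw).
by apply/funext => z; exact: invpowE.
Qed.

Lemma powRN_le (x y : R) : 0 < x -> x <= y -> y `^ (- s) <= x `^ (- s).
Proof.
move=> x0 xy; have y0 : 0 < y by exact: lt_le_trans xy.
rewrite !powRN lef_pV2 ?posrE ?powR_gt0//.
by apply: (ge0_ler_powR (ltW s0)) => //; rewrite nnegrE ltW.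
Qed.

(** Chebyshev for w where w >= a u, and for w^(-s) where w < a u. *)
Lemma sublevel_split_bound (U E : set ST) (a M u : R) : bmeas U -> 0 < vol U ->
  measurable E -> E `<=` U -> 0 < a -> 0 < u ->
  (\int[mu]_(z in U) invpow z <= (M * a `^ (- s) * vol U)%:E)%E ->
  vol E / vol U <= mass E / (a * vol U) / u + M * u `^ s.
Proof.
move=> bU U0 mE EU a0 u0 intU.
have bE : bmeas E by exact: bmeas_sub EU bU.
have au0 : 0 < a * u by rewrite mulr_gt0.
have mL := measurable_lt hw (a * u).
set Lw := [set z | w z < a * u] in mL *.
have H1 : a * u * vol (E `\` Lw) <= mass E.
  apply: (@le_trans _ _ (mass (E `\` Lw))).
    apply: ge_mass_vol => //; [exact: bmeasD|exact: ltW|].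
    by move=> z [_] /= /negP; rewrite -leNgt.
  by apply: le_mass => //; exact: bmeasD.
have H2 : vol (E `&` Lw) <= M * u `^ s * vol U.
  have : (((a * u) `^ (- s) * vol (E `&` Lw))%:E <= (M * a `^ (- s) * vol U)%:E)%E.
    apply: le_trans intU; apply: (@le_trans _ _ (\int[mu]_(z in E `&` Lw) invpow z)%E).
      apply: integral_ge_cst.
      - exact: measurable_invpow.
      - exact: bmeasI.
      - exact: powR_ge0.
      - move=> z [_] /= wz; rewrite invpowE; case: eqP => [_|/eqP wz0]; first exact: leey.
        by rewrite lee_fin powRN_le// ?ltW// lt_neqAle eq_sym wz0 w_ge0.
    apply: integral_sub.
    - exact: measurable_invpow.
    - exact: invpow_ge0.
    - exact: measurableI.
    - by case: bU.
    - by move=> z [/EU].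
  rewrite lee_fin powRM ?(ltW a0) ?(ltW u0)// !powRN.
  have -> : (a `^ s)^-1 * (u `^ s)^-1 * vol (E `&` Lw) = (a `^ s)^-1 * (vol (E `&` Lw) / u `^ s).
    by ring.
  have -> : M * (a `^ s)^-1 * vol U = (a `^ s)^-1 * (M * vol U) by ring.
  rewrite ler_pM2l ?invr_gt0 ?powR_gt0// ler_pdivrMr ?powR_gt0// => H.
  by rewrite -mulrA (mulrC (u `^ s)) mulrA.
rewrite ler_pdivrMr// (vol_setID bE mL) mulrDl addrC lerD//.
rewrite -(ler_pM2l au0); apply: (le_trans H1); rewrite le_eqVlt; apply/orP; left.
by apply/eqP; field; rewrite !gt_eqF.
Qed.

(** Up to a null set U is the union of {w >= a} and of the layers
    h0^(m+1) a <= w < h0^m a. On these w^(-s) is at most a multiple of (3/2)^m a^(-s) and their proportion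
    is at most 2^(-m), so the sum of (3/4)^m bounds the integral. *)
Lemma invpow_integral_le (U : set ST) (a h0 : R) : bmeas U -> 0 < a -> 0 < h0 < 1 ->
  h0 `^ (- s) = 3 / 2 ->
  (forall m, vol (U `&` [set z | w z < h0 ^+ m * a]) <= 2^-1 ^+ m * vol U) ->
  (\int[mu]_(z in U) invpow z <= (8 * a `^ (- s) * vol U)%:E)%E.
Proof.
move=> bU a0 /andP[h00 h01] hs low.
have mU : measurable U by case: bU.
(* F m contains the points of U for which h0 ^+ m * a is the first such level
   below w *)
pose F m := if m is m'.+1 then U `&` [set z | w z < h0 ^+ m' * a] else U.
have bF m : bmeas (F m).
  by case: m => [|m] //; apply: bmeasI => //; exact: measurable_lt.
have mF m : measurable (F m) by case: (bF m).
have volF m : vol (F m) <= 2 * 2^-1 ^+ m * vol U.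
  case: m => [|m]; first by rewrite expr0 mulr1 ler_peMl ?vol_ge0// ler1n.
  by apply: (le_trans (low m)); rewrite exprS mulrA divff// mul1r.
pose coef m : R := (3 / 2) ^+ m * a `^ (- s).
have coef0 m : 0 <= coef m by rewrite mulr_ge0 ?exprn_ge0 ?powR_ge0// divr_ge0.
pose term m z : \bar R := (coef m * \1_(F m) z)%:E.
have term0 m z : (0 <= term m z)%E by rewrite lee_fin mulr_ge0.
have mterm m : measurable_fun setT (term m).
  apply/measurable_EFinP; apply: measurable_funM; first exact: measurable_cst.
  exact: measurable_indic.
have termI m (A : set ST) : bmeas A ->
    (\int[mu]_(z in A) term m z <= (coef m * vol (F m))%:E)%E.
  move=> bA; have mA : measurable A by case: bA.
  rewrite (integral_setID (mterm m) (term0 m) mA (mF m)).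
  have I1 : (\int[mu]_(z in A `&` F m) term m z <= (coef m * vol (A `&` F m))%:E)%E.
    apply: (integral_le_cst (mterm m) (term0 m)) => //; first exact: bmeasI.
    by move=> z [_ Fz]; rewrite /term indicE mem_set// mulr1.
  have I2 : (\int[mu]_(z in A `\` F m) term m z <= (0 * vol (A `\` F m))%:E)%E.
    apply: (integral_le_cst (mterm m) (term0 m)) => //; first exact: bmeasD.
    by move=> z [_ nFz]; rewrite /term indicE memNset// mulr0.
  apply: (le_trans (leeD I1 I2)); rewrite mul0r adde0 lee_fin.
  apply: ler_wpM2l => //; apply: le_vol => //; exact: bmeasI.
have mpos : measurable [set z | 0 < w z].
  rewrite (_ : [set _ | _] = ~` \bigcap_(m in [set: nat]) [set z | w z < 2^-1 ^+ m]).
    apply: measurableC; apply: bigcapT_measurable => m; exact: measurable_lt.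
  apply/seteqP; split => z /=.
    move=> wz H; have [i Hi] := exp2_unbounded (w z)^-1.
    have := H i Logic.I; rewrite /= exprVn ltNge => /negP; apply.
    by rewrite -[leRHS]invrK lef_pV2 ?posrE ?invr_gt0 ?exprn_gt0// ltW.
  move=> H; rewrite lt_neqAle w_ge0 andbT; apply/eqP => wz; apply: H => m _ /=.
  by rewrite -wz exprn_gt0// invr_gt0.
rewrite (integral_setID measurable_invpow invpow_ge0 mU mpos).
have bN : bmeas (U `\` [set z | 0 < w z]) by exact: bmeasD.
(* {w = 0} lies in all the sublevel sets *)
have volN : vol (U `\` [set z | 0 < w z]) = 0.
  apply/eqP; rewrite eq_le vol_ge0 andbT leNgt; apply/negP => N0.
  have [i Hi] := exp2_unbounded (vol U / vol (U `\` [set z | 0 < w z])).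
  move: Hi; rewrite ltr_pdivrMr//; apply/negP; rewrite -leNgt.
  rewrite mulrC -ler_pdivlMr ?exprn_gt0// -exprVn mulrC.
  apply: le_trans (low i); apply: le_vol => //.
    by apply: bmeasI => //; exact: measurable_lt.
  move=> z [Uz /negP]; rewrite -leNgt => wz; split => //=.
  by apply: (le_lt_trans wz); rewrite mulr_gt0// exprn_gt0.
rewrite [X in (_ + X)%E]null_set_integral; last 3 first.
- by case: bN.
- exact: (measurable_funS measurableT (@subsetT _ _) measurable_invpow).
- by apply: (etrans (bmeas_mu bN)); rewrite volN.
rewrite adde0.
have bD : bmeas (U `&` [set z | 0 < w z]) by exact: bmeasI.
have mD : measurable (U `&` [set z | 0 < w z]) by case: bD.
set D := U `&` [set z | 0 < w z] in bD mD *.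
have mtermD m : measurable_fun D (term m).
  exact: (measurable_funS measurableT (@subsetT _ D) (mterm m)).
have pointwise z : D z -> (invpow z <= \sum_(m <oo) term m z)%E.
  move=> [Uz wz].
  have ex : exists m, h0 ^+ m * a <= w z.
    have [m Hm] := exp_small (divr_gt0 wz a0) h00 h01.
    by exists m; rewrite -ler_pdivlMr// ltW.
  case: (ex_minnP ex) => m hm mmin.
  have hma : 0 < h0 ^+ m * a by rewrite mulr_gt0// exprn_gt0.
  apply: (@le_trans _ _ (term m z)).
    have Fz : F m z.
      case: m hm mmin {hma} => [|m] hm mmin //; split => //=.
      by rewrite ltNge; apply/negP => /mmin; rewrite ltnn.
    rewrite /term indicE mem_set// mulr1 invpowE gt_eqF// lee_fin.
    apply: (le_trans (powRN_le hma hm)).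
    rewrite (powRM _ (exprn_ge0 m (ltW h00)) (ltW a0)) /coef -hs.
    by rewrite (powR_exprn _ _ (ltW h00)) lexx.
  apply: (le_trans _ (nneseries_lim_ge m.+1 (fun i _ _ => term0 i z))).
  by rewrite big_nat_recr//= leeDr// sume_ge0.
apply: (@le_trans _ _ (\int[mu]_(z in D) (\sum_(m <oo) term m z))%E).
  have mS : measurable_fun D (fun z => (\sum_(m <oo) term m z)%E).
    by apply: ge0_emeasurable_sum => [i z _ _|i _]; [exact: term0|exact: mtermD].
  apply: (ge0_le_integral mu mD (fun z _ => invpow_ge0 z) _ mS pointwise).
  exact: (measurable_funS measurableT (@subsetT _ D) measurable_invpow).
rewrite (integral_nneseries mu mD mtermD (fun m z _ => term0 m z)).
apply: lime_le.
  by apply: is_cvg_nneseries => m _ _; exact: integral_ge0.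
apply: nearW => N.
apply: (@le_trans _ _ (\sum_(0 <= m < N) (2 * a `^ (- s) * vol U * (3 / 4) ^+ m)%:E)%E).
  apply: lee_sum => m _; apply: (le_trans (termI m D bD)); rewrite lee_fin.
  apply: (@le_trans _ _ (coef m * (2 * 2^-1 ^+ m * vol U))); first exact: ler_wpM2l.
  rewrite /coef (_ : 3 / 4 = 3 / 2 * 2^-1); last by field.
  by rewrite [in leRHS]exprMn le_eqVlt; apply/orP; left; apply/eqP; ring.
rewrite sumEFin lee_fin -mulr_sumr big_mkord -(mulrA 2) -(mulrA 8).
apply: geometric_sum_le; by rewrite mulr_ge0 ?vol_ge0// powR_ge0.
Qed.

End InversePower.

(** The two terms balance for u = r^(1 / (1 + s)). When r = 0 this choice
    degenerates, and any u small against v takes its place. *)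
Lemma optimal_power (R : realType) (v r M s : R) : 0 < s -> 0 <= r -> 0 <= M ->
  (forall u, 0 < u -> v <= r / u + M * u `^ s) -> v <= (1 + M) * r `^ (s / (1 + s)).
Proof.
move=> s0 r0 M0 H; have s1 : 0 < 1 + s by rewrite addr_gt0.
have [r_gt0|] := ltP 0 r; last first.
  move=> r_le0; have {r_le0} rE : r = 0 by apply/eqP; rewrite eq_le r0 r_le0.
  rewrite rE powR0 ?mulr0; last by rewrite gt_eqF// divr_gt0.
  rewrite leNgt; apply/negP => v0.
  have M1 : 0 < M + 1 by rewrite ltr_wpDl.
  pose u := (v / (2 * (M + 1))) `^ s^-1.
  have vM : 0 < v / (2 * (M + 1)) by rewrite divr_gt0// mulr_gt0.
  have := H u (powR_gt0 _ vM); rewrite rE mul0r add0r -powRrM mulVf ?gt_eqF// (powRr1 (ltW vM)).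
  apply/negP; rewrite -ltNge mulrA ltr_pdivrMr ?mulr_gt0//.
  have : 0 <= M * v by rewrite mulr_ge0// ltW.
  by lra.
have := H _ (powR_gt0 (1 + s)^-1 r_gt0).
rewrite -powRrM [(1 + s)^-1 * s]mulrC => Hu; apply: (le_trans Hu).
rewrite mulrDl mul1r lerD2r -{1}[r](powRr1 r0) -powRN -powRD; last first.
  by rewrite (gt_eqF r_gt0) implybT.
by rewrite le_eqVlt; apply/orP; left; apply/eqP; congr (_ `^ _); field; rewrite gt_eqF.
Qed.

(** * The implications *)

Section Implications.
Context {R : realType} {n : nat}.
Local Notation ST := (spacetime R n).
Local Notation mu := (@lebesgue_spacetime R n).
Context (p g : R) (hp : 1 < p) (hg : 0 < g < 1).
Context (w : ST -> R) (hw : weight w).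
Local Notation mass := (mass w).
Local Notation V := (@boxvol R n p g).
Local Notation upper := (@upper_part R n p g).
Local Notation lower := (@lower_part R n p g).
Implicit Types (x : 'rV[R]_n) (t L : R).

Let V0 L : 0 < L -> 0 < V L. Proof. exact: boxvol_gt0. Qed.

Let mlower x t L : wmeas w (lower x t L) = (mass (lower x t L))%:E.
Proof. by rewrite (bmeas_wmeas hw)//; exact: bmeas_lower. Qed.

(** Solves the A_q bound for the average of w^(-s), which in particular is
    finite. *)
Lemma invpow_avg_le (q a C : R) (U : set ST) : 1 < q -> 0 < a -> 0 <= C ->
  (a%:E * avg U (invpow w (q - 1)^-1) `^ (q - 1) <= C%:E)%E ->
  (avg U (invpow w (q - 1)^-1) <= (C `^ (q - 1)^-1 * a `^ (- (q - 1)^-1))%:E)%E.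
Proof.
move=> q1 a0 C0; have q10 : 0 < q - 1 by rewrite subr_gt0.
have : (0 <= avg U (invpow w (q - 1)^-1))%E.
  rewrite /avg mule_ge0//; last by rewrite inve_ge0.
  by apply: integral_ge0 => z _; exact: invpow_ge0.
case: (avg _ _) => [r| |] //.
  rewrite lee_fin => r0; rewrite poweR_EFin -EFinM !lee_fin => H.
  have -> : r = (r `^ (q - 1)) `^ (q - 1)^-1.
    by rewrite -powRrM divff ?gt_eqF// powRr1.
  have -> : C `^ (q - 1)^-1 * a `^ (- (q - 1)^-1) = (C / a) `^ (q - 1)^-1.
    rewrite powRM// ?invr_ge0 ?(ltW a0)//; congr (_ * _).
    by rewrite -[in RHS](powR_inv1 (ltW a0)) -powRrM mulN1r.
  apply: ge0_ler_powR; rewrite ?nnegrE ?invr_ge0 ?(ltW q10) ?powR_ge0//.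
    by rewrite divr_ge0// ltW.
  by rewrite ler_pdivlMr// mulrC.
by move=> _; rewrite poweRyr ?gt_eqF// gt0_muley ?lte_fin.
Qed.

Lemma Aq_imp_power_bound (q : R) : 1 < q -> Aq_plus p g q w ->
  exists K delta : R, [/\ 0 < K, 0 < delta &
    forall x t L, 0 < L -> forall E : set ST, measurable E -> E `<=` upper x t L ->
    (0 < wmeas w (lower x t L))%E ->
    (mu E / mu (upper x t L) <= K%:E * (wmeas w E / wmeas w (lower x t L)) `^ delta)%E].
Proof.
move=> q1 [_ Cfin]; have q10 : 0 < q - 1 by rewrite subr_gt0.
pose s := (q - 1)^-1; have s0 : 0 < s by rewrite invr_gt0.
pose C := fine (Aq_const p g q w).
have Cge x t L : 0 < L -> (wavg w (lower x t L) *
    avg (upper x t L) (invpow w s) `^ (q - 1) <= Aq_const p g q w)%E.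
  by move=> L0; apply: ereal_sup_ubound; exists x, t, L.
have C_ge0 : (0 <= Aq_const p g q w)%E.
  apply: le_trans (Cge 0 0 1 ltr01); rewrite mule_ge0 ?poweR_ge0//.
  by rewrite wavg_lower// lee_fin divr_ge0 ?mass_ge0// ltW// V0.
have CE : Aq_const p g q w = C%:E by rewrite /C fineK// ge0_fin_numE.
have C0 : 0 <= C by rewrite -lee_fin -CE.
exists (1 + C `^ s), (s / (1 + s)); split.
- by rewrite ltr_wpDr ?powR_ge0.
- by rewrite divr_gt0// addr_gt0.
move=> x t L L0 E mE EU; rewrite mlower lte_fin => m0.
have bU := bmeas_upper p g x t L.
have bE := bmeas_sub mE EU bU.
have VL := V0 L0.
have a0 : 0 < mass (lower x t L) / V L by rewrite divr_gt0.
have aV : mass (lower x t L) / V L * V L = mass (lower x t L).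
  by rewrite divfK// gt_eqF.
have := Cge x t L L0; rewrite wavg_lower// CE => /(invpow_avg_le q1 a0 C0).
rewrite avg_le//; last by rewrite vol_upper.
move=> intU; rewrite mu_upper// (bmeas_mu bE) (bmeas_wmeas hw bE).
rewrite !EFin_div ?gt_eqF// poweR_EFin -EFinM lee_fin.
apply: optimal_power => //; [by rewrite divr_ge0 ?mass_ge0// ltW|exact: powR_ge0|].
move=> u u0; have volU : vol (upper x t L) = V L by exact: vol_upper.
have := sublevel_split_bound hw s0 bU _ mE EU a0 u0 intU.
by rewrite volU aV; apply.
Qed.

(** beta is chosen such that K beta^delta <= alpha / 2. *)
Lemma power_bound_imp_small_sets :
  (exists K delta : R, [/\ 0 < K, 0 < delta &
    forall x t L, 0 < L -> forall E : set ST, measurable E -> E `<=` upper x t L ->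
    (0 < wmeas w (lower x t L))%E ->
    (mu E / mu (upper x t L) <= K%:E * (wmeas w E / wmeas w (lower x t L)) `^ delta)%E]) ->
  forall alpha : R, 0 < alpha < 1 -> exists2 beta : R, 0 < beta < 1 &
    forall x t L, 0 < L -> forall E : set ST, measurable E -> E `<=` upper x t L ->
    (wmeas w E < beta%:E * wmeas w (lower x t L))%E ->
    (mu E < alpha%:E * mu (upper x t L))%E.
Proof.
move=> [K [d [K0 d0 H]]] alpha /andP[a0 a1].
have aK : 0 < alpha / (2 * K) by rewrite divr_gt0// mulr_gt0.
pose beta := Num.min 2^-1 ((alpha / (2 * K)) `^ d^-1).
have b0 : 0 < beta by rewrite lt_min invr_gt0 ltr0n powR_gt0.
have b1 : beta < 1 by rewrite gt_min invf_lt1// ltr1n.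
exists beta; first by rewrite b0.
move=> x t L L0 E mE EU.
have bU := bmeas_upper p g x t L.
have bE := bmeas_sub mE EU bU; have VL := V0 L0.
have := H x t L L0 E mE EU.
rewrite mlower (bmeas_wmeas hw bE) (bmeas_mu bE) mu_upper//.
rewrite -!EFinM !lte_fin => HE mE'.
have m0 : 0 < mass (lower x t L).
  by have := le_lt_trans (mass_ge0 hw E) mE'; rewrite pmulr_rgt0.
have := HE m0; rewrite !EFin_div ?gt_eqF// poweR_EFin -EFinM lee_fin.
rewrite ler_pdivrMr// => /le_lt_trans; apply; rewrite ltr_pM2r//.
apply: (@le_lt_trans _ _ (alpha / 2)); last by rewrite ltr_pdivrMr// ltr_pMr// ltr1n.
have -> : alpha / 2 = K * (alpha / (2 * K)) by field; rewrite gt_eqF.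
rewrite ler_pM2l//.
have -> : alpha / (2 * K) = ((alpha / (2 * K)) `^ d^-1) `^ d.
  by rewrite -powRrM mulVf ?gt_eqF// powRr1// ltW.
apply: ge0_ler_powR; rewrite ?nnegrE ?powR_ge0 ?(ltW d0)//.
  by rewrite divr_ge0 ?mass_ge0// ltW.
apply: (@le_trans _ _ beta); last by rewrite ge_min lexx orbT.
by rewrite ler_pdivrMr// ltW.
Qed.

(** The set {w < (beta / 2) a} has mass at most (beta / 2) a |R^+|, which is
    half of beta w(R^-). If a = 0 the set is empty. *)
Lemma small_sets_imp_small_sublevels :
  (exists alpha beta : R, [/\ 0 < alpha < 1, 0 < beta < 1 &
    forall x t L, 0 < L -> forall E : set ST, measurable E -> E `<=` upper x t L ->
    (wmeas w E < beta%:E * wmeas w (lower x t L))%E ->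
    (mu E < alpha%:E * mu (upper x t L))%E]) ->
  exists alpha beta : R, [/\ 0 < alpha < 1, 0 < beta < 1 &
    forall x t L, 0 < L ->
    (mu (upper x t L `&` [set z | (w z)%:E < beta%:E * wavg w (lower x t L)])
       < alpha%:E * mu (upper x t L))%E].
Proof.
move=> [alpha [beta [a01 /andP[b0 b1] H]]].
exists alpha, (beta / 2); split => //.
  by rewrite divr_gt0//= ltr_pdivrMr// (lt_trans b1)// mul1r ltr1n.
move=> x t L L0; have VL := V0 L0.
rewrite wavg_lower//; set a := mass (lower x t L) / V L.
have -> : [set z | ((w z)%:E < (beta / 2)%:E * a%:E)%E] = [set z | w z < beta / 2 * a].
  by apply/seteqP; split => z /=; rewrite -EFinM lte_fin.
have mlt := measurable_lt hw (beta / 2 * a).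
have bU := bmeas_upper p g x t L.
have bE : bmeas (upper x t L `&` [set z | w z < beta / 2 * a]) by exact: bmeasI.
have [m0|m0] := ltP 0 (mass (lower x t L)); last first.
  have {m0}a_le0 : a <= 0 by rewrite /a ler_pdivrMr// mul0r.
  rewrite (_ : _ `&` _ = set0).
    rewrite measure0 mu_upper// -EFinM lte_fin mulr_gt0//; by case/andP: a01.
  apply/seteqP; split => // z [_] /=; apply/negP; rewrite -leNgt.
  apply: (@le_trans _ _ 0); last by case: hw.
  by rewrite mulr_ge0_le0// divr_ge0// ltW.
apply: H => //; [by case: bE|rewrite mlower (bmeas_wmeas hw bE) -EFinM lte_fin].
apply: (@le_lt_trans _ _ (beta / 2 * a * vol (upper x t L `&` [set z | w z < beta / 2 * a]))).
  by apply: le_mass_vol => // z [_] /= /ltW.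
apply: (@le_lt_trans _ _ (beta / 2 * a * V L)).
  apply: ler_wpM2l; first by rewrite mulr_ge0// ?divr_ge0 ?ltW.
  rewrite -(vol_upper (n := n) p hg x t L0); apply: le_vol => //.
have -> : beta / 2 * a * V L = beta / 2 * mass (lower x t L).
  by rewrite /a; field; rewrite gt_eqF.
by rewrite ltr_pM2r// ltr_pdivrMr// ltr_pMr// ltr1n.
Qed.

Lemma small_sublevels_imp_small_deficit :
  (exists alpha beta : R, [/\ 0 < alpha < 1, 0 < beta < 1 &
    forall x t L, 0 < L ->
    (mu (upper x t L `&` [set z | (w z)%:E < beta%:E * wavg w (lower x t L)])
       < alpha%:E * mu (upper x t L))%E]) ->
  exists2 epsilon : R, 0 < epsilon < 1 & forall x t L, 0 < L ->
    (avg (upper x t L) ((fun z => (w z)%:E - wavg w (lower x t L))^\-)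
      <= epsilon%:E * wavg w (lower x t L))%E.
Proof.
move=> [alpha [beta [/andP[a0 a1] /andP[b0 b1] H]]].
have a1' : 0 < 1 - alpha by rewrite subr_gt0.
have ba : beta * (1 - alpha) < 1 by rewrite mulr_ilt1 ?(ltW b0) ?(ltW a1')// gtrBl.
exists (1 - beta * (1 - alpha)); first by rewrite subr_gt0 ba/= gtrBl mulr_gt0.
move=> x t L L0; have VL := V0 L0; have := H x t L L0.
rewrite wavg_lower//; set a := mass (lower x t L) / V L.
have -> : [set z | ((w z)%:E < beta%:E * a%:E)%E] = [set z | w z < beta * a].
  by apply/seteqP; split => z /=; rewrite -EFinM lte_fin.
have mlt := measurable_lt hw (beta * a).
have bU := bmeas_upper p g x t L.
have bE : bmeas (upper x t L `&` [set z | w z < beta * a]) by exact: bmeasI.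
rewrite (bmeas_mu bE) (bmeas_mu bU) -!EFinM lte_fin => low.
apply: negpart_avg_le => //.
- by rewrite vol_upper.
- by rewrite divr_ge0 ?mass_ge0// ltW.
- by rewrite !ltW.
- exact: ltW.
Qed.

(** With beta = (1 - eps) / 2 the Chebyshev proportion eps / (1 - beta) is
    less than 1, so geometric decay applies. The exponent s with
    h0^(-s) = 3/2 gives q = 1 + 1 / s and A_q constant at most 8^(1 / s). *)
Lemma small_deficit_imp_Aq :
  (exists2 epsilon : R, 0 < epsilon < 1 & forall x t L, 0 < L ->
    (avg (upper x t L) ((fun z => (w z)%:E - wavg w (lower x t L))^\-)
      <= epsilon%:E * wavg w (lower x t L))%E) ->
  exists q : R, 1 < q /\ Aq_plus p g q w.
Proof.
move=> [eps /andP[e0 e1] H].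
pose beta := (1 - eps) / 2; pose alpha := eps / (1 - beta).
have b0 : 0 < beta by rewrite divr_gt0// subr_gt0.
have b1 : beta <= 1 by rewrite /beta; lra.
have b1' : 0 < 1 - beta by rewrite /beta; lra.
have al : 0 <= alpha < 1.
  by rewrite divr_ge0 ?(ltW e0) ?(ltW b1')//= ltr_pdivrMr// mul1r /beta; lra.
have low_lower x s L : box p g x s L = lower x (s + L `^ p) L.
  by rewrite lower_partE addrK.
have up_upper x s L : box p g x (s + time_lag p g L) L = upper x (s + L `^ p) L.
  by rewrite upper_partE addrK.
have decay : sublevel_decay p g w beta alpha.
  move=> x s L lam L0 lam0; rewrite low_lower up_upper => big.
  have VL := V0 L0; have bU := bmeas_upper p g x (s + L `^ p) L.
  rewrite -(vol_upper (n := n) p hg x (s + L `^ p) L0).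
  pose a := mass (lower x (s + L `^ p) L) / V L.
  have lama : lam <= a by rewrite ler_pdivlMr.
  have a0 : 0 < a by exact: lt_le_trans lama.
  have volU0 : 0 < vol (upper x (s + L `^ p) L) by rewrite vol_upper.
  have := H x (s + L `^ p) L L0; rewrite wavg_lower// -EFinM => Hx.
  have b_lt1 : beta < 1 by rewrite -subr_gt0.
  apply: le_trans (negpart_avg_ge hw bU volU0 a0 b_lt1 Hx).
  apply: le_vol; [by apply: bmeasI => //; exact: measurable_lt..|].
  by move=> z [Uz] /= wz; split => //=; apply: (lt_le_trans wz); rewrite ler_pM2l.
have [h0 h01 geo] := geometric_decay hp hg hw b0 b1 al decay.
have [h00 h0_lt1] := andP h01.
have ln0 : ln h0 < 0 by rewrite ln_lt0.
have ln32 : 0 < ln (3 / 2 : R) by rewrite ln_gt0// ltr_pdivlMr// mul1r ltr_nat.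
pose s := - (ln (3 / 2) / ln h0).
have s0 : 0 < s by rewrite oppr_gt0 pmulr_rlt0// invr_lt0.
have hs : h0 `^ (- s) = 3 / 2.
  rewrite /powR gt_eqF// /s opprK divfK ?lt_eqF// lnK// posrE divr_gt0//.
pose q := 1 + s^-1; have q1 : 1 < q by rewrite ltrDl invr_gt0.
have qs : q - 1 = s^-1 by rewrite /q addrAC subrr add0r.
exists q; split => //; split => //.
apply: (@le_lt_trans _ _ (8 `^ s^-1)%:E); last exact: ltry.
apply: ge_ereal_sup => _ [x [t [L [L0 ->]]]].
rewrite qs invrK -/(invpow w s); have VL := V0 L0.
rewrite wavg_lower//; set a := mass (lower x t L) / V L.
have a_ge0 : 0 <= a by rewrite divr_ge0 ?mass_ge0// ltW.
have [a0|a_le0] := ltP 0 a; last first.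
  have -> : a = 0 by apply/eqP; rewrite eq_le a_ge0 a_le0.
  by rewrite mul0e lee_fin powR_ge0.
have bU := bmeas_upper p g x t L.
have volU : vol (upper x t L) = V L by exact: vol_upper.
have volU0 : 0 < vol (upper x t L) by rewrite volU.
have int : (avg (upper x t L) (invpow w s) <= (8 * a `^ (- s))%:E)%E.
  rewrite avg_le//; apply: (invpow_integral_le hw s0 bU a0 h01 hs) => m.
  have := geo m x (t - L `^ p) L a L0 a0.
  rewrite -lower_partE -upper_partE volU; apply.
  by rewrite /a divfK// gt_eqF.
have avg0 : (0 <= avg (upper x t L) (invpow w s))%E.
  rewrite /avg mule_ge0//; last by rewrite inve_ge0.
  by apply: integral_ge0 => z _; exact: invpow_ge0.
have s'0 : 0 <= s^-1 by rewrite invr_ge0 ltW.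
apply: (@le_trans _ _ (a%:E * (8 * a `^ (- s))%:E `^ s^-1)%E).
  rewrite lee_wpmul2l ?lee_fin//.
  apply: gt0_ler_poweR => //; rewrite ?in_itv/= ?leey ?andbT//.
  by rewrite lee_fin mulr_ge0// powR_ge0.
rewrite poweR_EFin -EFinM lee_fin powRM ?powR_ge0// -powRrM mulNr divff ?gt_eqF//.
by rewrite powR_inv1// mulrCA divff ?mulr1// gt_eqF.
Qed.

End Implications.

Local Close Scope ring_scope.
Local Open Scope ereal_scope.

Theorem theorem4p1 (R : realType) (n : nat) (p gamma : R)
    (w : spacetime R n -> R) :
  (0 < n)%N -> (1 < p)%R -> (0 < gamma < 1)%R -> weight w ->
  [<->
    (* (i) *)
    exists q : R, (1 < q)%R /\ Aq_plus p gamma q w;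
    (* (ii) *)
    exists K delta : R, [/\ (0 < K)%R, (0 < delta)%R &
      forall (x : 'rV[R]_n) (t L : R), (0 < L)%R ->
      forall E : set (spacetime R n), measurable E ->
        E `<=` upper_part p gamma x t L ->
        (* where the denominator vanishes, the right-hand side is +oo *)
        0 < wmeas w (lower_part p gamma x t L) ->
        lebesgue_spacetime E / lebesgue_spacetime (upper_part p gamma x t L)
          <= K%:E * (wmeas w E / wmeas w (lower_part p gamma x t L)) `^ delta];
    (* (iii) *)
    forall alpha : R, (0 < alpha < 1)%R ->
      exists2 beta : R, (0 < beta < 1)%R &
        forall (x : 'rV[R]_n) (t L : R), (0 < L)%R ->
        forall E : set (spacetime R n), measurable E ->
          E `<=` upper_part p gamma x t L ->
          wmeas w E < beta%:E * wmeas w (lower_part p gamma x t L) ->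
          lebesgue_spacetime E
            < alpha%:E * lebesgue_spacetime (upper_part p gamma x t L);
    (* (iv) *)
    exists alpha beta : R, [/\ (0 < alpha < 1)%R, (0 < beta < 1)%R &
      forall (x : 'rV[R]_n) (t L : R), (0 < L)%R ->
      forall E : set (spacetime R n), measurable E ->
        E `<=` upper_part p gamma x t L ->
        wmeas w E < beta%:E * wmeas w (lower_part p gamma x t L) ->
        lebesgue_spacetime E
          < alpha%:E * lebesgue_spacetime (upper_part p gamma x t L)];
    (* (v) *)
    exists alpha beta : R, [/\ (0 < alpha < 1)%R, (0 < beta < 1)%R &
      forall (x : 'rV[R]_n) (t L : R), (0 < L)%R ->
        lebesgue_spacetime (upper_part p gamma x t L `&`
            [set z | (w z)%:E < beta%:E * wavg w (lower_part p gamma x t L)])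
          < alpha%:E * lebesgue_spacetime (upper_part p gamma x t L)];
    (* (vi) *)
    exists2 epsilon : R, (0 < epsilon < 1)%R &
      forall (x : 'rV[R]_n) (t L : R), (0 < L)%R ->
        avg (upper_part p gamma x t L)
            (fun z => (w z)%:E - wavg w (lower_part p gamma x t L))^\-
          <= epsilon%:E * wavg w (lower_part p gamma x t L)].
Proof.
move=> _ p1 g01 hw; tfae.
- by move=> [q [q1 Aq]]; exact: Aq_imp_power_bound Aq.
- exact: power_bound_imp_small_sets.
- move=> H; have half01 : (0 < (2^-1 : R) < 1)%R.
    by rewrite invr_gt0 ltr0n invf_lt1 ?ltr0n// ltr1n.
  by have [beta b01 Hb] := H _ half01; exists 2^-1%R, beta.
- exact: small_sets_imp_small_sublevels.
- exact: small_sublevels_imp_small_deficit.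
- exact: small_deficit_imp_Aq.
Qed.
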